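(* Let $f(z)=e^z+a$ be an exponential map with accessible singular value $a$ (and an associated partition into itinerary strips) such that $a$ has a unique itinerary (kneading sequence) $u_0u_1u_2\dots$. If this kneading sequence is not periodic, then $I(f)$ is connected.
   Context: $I(f)=\{z: f^n(z)\to\infty\}$; $J(f)$ is the Julia set. The singular value $a$ is accessible if $a\in J(f)$ and there is an injective curve $\gamma:[0,\infty)\to J(f)$ with $\gamma(0)=a$, $\gamma(t)\in I(f)$ for $t>0$, and $\operatorname{Re}\gamma(t)\to\infty$. Every component of $f^{-1}(\gamma)$ is a curve to $\infty$ in both directions, and $\mathbb{C}\setminus f^{-1}(\gamma)$ consists of strips $S_k$ ($k\in\mathbb{Z}$) with $S_k=S_0+2\pi i k$. An itinerary of $z$ is an integer sequence $u_0u_1\dots$ with $f^j(z)\in\overline{S_{u_j}}$ for all $j\ge0$; it is unique if the orbit of $z$ never meets $f^{-1}(\gamma)$. The itinerary of $a$ is the kneading sequence. A sequence is periodic if $u_{j+p}=u_j$ for some $p\ge1$ and all $j\ge0$. *)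

(* Defs.v *)
From Stdlib Require Import Reals ZArith.
Open Scope R_scope.

Definition Cplx : Type := (R * R)%type.
Definition Re (z : Cplx) : R := fst z.
Definition Im (z : Cplx) : R := snd z.
Definition Cadd (z w : Cplx) : Cplx := (fst z + fst w, snd z + snd w).
Definition Csub (z w : Cplx) : Cplx := (fst z - fst w, snd z - snd w).
Definition Cnorm (z : Cplx) : R := sqrt (fst z * fst z + snd z * snd z).
Definition Cdist (z w : Cplx) : R := Cnorm (Csub z w).
Definition Cexp (z : Cplx) : Cplx := (exp (fst z) * cos (snd z), exp (fst z) * sin (snd z)).

Definition expmap (a : Cplx) (z : Cplx) : Cplx := Cadd (Cexp z) a.

Fixpoint fiter (f : Cplx -> Cplx) (n : nat) (z : Cplx) : Cplx :=
  match n with O => z | S m => f (fiter f m z) end.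

Definition escaping (f : Cplx -> Cplx) (z : Cplx) : Prop :=
  forall M : R, exists N : nat, forall n : nat, (N <= n)%nat -> Cnorm (fiter f n z) > M.

Definition ball (z : Cplx) (r : R) (w : Cplx) : Prop := Cdist w z < r.
Definition is_open (U : Cplx -> Prop) : Prop :=
  forall z, U z -> exists r, r > 0 /\ forall w, ball z r w -> U w.
Definition closure (A : Cplx -> Prop) (z : Cplx) : Prop :=
  forall eps, eps > 0 -> exists w, A w /\ Cdist z w < eps.
Definition connected (A : Cplx -> Prop) : Prop :=
  ~ exists U V : Cplx -> Prop, is_open U /\ is_open V /\
      (forall z, A z -> U z \/ V z) /\
      (exists z, A z /\ U z) /\ (exists z, A z /\ V z) /\
      (forall z, A z -> U z -> V z -> False).
Definition component (A : Cplx -> Prop) (z : Cplx) (w : Cplx) : Prop :=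
  exists B : Cplx -> Prop, connected B /\ (forall x, B x -> A x) /\ B z /\ B w.
Definition is_component (A S : Cplx -> Prop) : Prop :=
  exists z, A z /\ forall w, S w <-> component A z w.

Definition loc_unif_conv (U : Cplx -> Prop) (F : nat -> Cplx -> Cplx) (g : Cplx -> Cplx) : Prop :=
  forall w, U w -> exists rho, rho > 0 /\ (forall z, Cdist z w <= rho -> U z) /\
    forall eps, eps > 0 -> exists N : nat, forall k : nat, (N <= k)%nat ->
      forall z, Cdist z w <= rho -> Cdist (F k z) (g z) < eps.
Definition loc_unif_div (U : Cplx -> Prop) (F : nat -> Cplx -> Cplx) : Prop :=
  forall w, U w -> exists rho, rho > 0 /\ (forall z, Cdist z w <= rho -> U z) /\
    forall M, exists N : nat, forall k : nat, (N <= k)%nat ->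
      forall z, Cdist z w <= rho -> Cnorm (F k z) > M.
Definition normal_family (U : Cplx -> Prop) (F : nat -> Cplx -> Cplx) : Prop :=
  forall s : nat -> nat, exists phi : nat -> nat,
    (forall k, (phi k < phi (S k))%nat) /\
    ((exists g, loc_unif_conv U (fun k => F (s (phi k))) g) \/
     loc_unif_div U (fun k => F (s (phi k)))).
Definition fatou (f : Cplx -> Cplx) (z : Cplx) : Prop :=
  exists r, r > 0 /\ normal_family (ball z r) (fun n => fiter f n).
Definition julia (f : Cplx -> Cplx) (z : Cplx) : Prop := ~ fatou f z.

Definition accessible_curve (f : Cplx -> Cplx) (a : Cplx) (gamma : R -> Cplx) : Prop :=
  julia f a /\
  (forall t, 0 <= t -> forall eps, eps > 0 -> exists d, d > 0 /\
      forall s, 0 <= s -> Rabs (s - t) < d -> Cdist (gamma s) (gamma t) < eps) /\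
  (forall s t, 0 <= s -> 0 <= t -> gamma s = gamma t -> s = t) /\
  gamma 0 = a /\
  (forall t, 0 <= t -> julia f (gamma t)) /\
  (forall t, 0 < t -> escaping f (gamma t)) /\
  (forall M, exists T, forall t, t >= T -> Re (gamma t) > M).

Definition preimage_curve (f : Cplx -> Cplx) (gamma : R -> Cplx) (z : Cplx) : Prop :=
  exists t, 0 <= t /\ f z = gamma t.
Definition strip (S0 : Cplx -> Prop) (k : Z) (z : Cplx) : Prop :=
  S0 (fst z, snd z - 2 * PI * IZR k).
Definition is_itinerary (f : Cplx -> Cplx) (S0 : Cplx -> Prop) (z : Cplx) (u : nat -> Z) : Prop :=
  forall j : nat, closure (strip S0 (u j)) (fiter f j z).
Definition periodic_seq (u : nat -> Z) : Prop :=
  exists p : nat, (1 <= p)%nat /\ forall j, u (j + p)%nat = u j.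

(* Main.v *)
(** Let [f z = exp z + a], let [C_l] ([l] in Z) be the curves forming [f^-1(gamma)], and suppose that the set of
    escaping points is disconnected. Since the plane is unicoherent, some component [D] of a suitable open set
    contains escaping points, has escaping points in its exterior, and has a connected frontier [K] free of
    escaping points. Every image [f^n(K)] then misses [f^-1(gamma)] and lies in a single strip [S_(k n)].

    If [f^j(K)] is unbounded to the left, then [a] is adherent to [f^(j+1)(K)], so that [k (j+1+i) = u i] for all
    [i]. If this happens for [K] and then again for the unbounded set [f^(j+1)(K)], the kneading sequence is
    periodic. An unbounded connected set whose images are never unbounded to the left contains escaping points,
    provided that the heights of its strips grow at most like an iterated exponential. So it remains to see
    that images of [K] are unbounded, and to bound [u] or [k].

    Points of the backward orbit of [gamma] are dense in the escaping set. Hence, following [D] or its exterior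
    forward until it first meets [f^-1(gamma)], one obtains an open set with frontier in some [f^n(K)] which
    either contains some [C_l] but not a neighbour of it, or contains all of them. In the first case [f^n(K)]
    joins left to right infinity, and no image of [gamma] can meet two of the [C_l], as this would join
    neighbouring curves by escaping points; thus the orbit of [gamma 1] bounds [u]. In the second case
    the exterior of the open set contains [gamma] and meets no [C_l], and the argument is repeated with it.
    If the first case never occurs, then the orbit of [gamma 1], restarted at each repetition, bounds [k]. *)

Require Import Defs.
From Stdlib Require Import Reals ZArith Lra Lia Psatz Classical ClassicalEpsilon.
Open Scope R_scope.

(** The planar topology rests on lifting circle-valued maps to the line. This gives unicoherence and
    Mayer-Vietoris in degree zero, and from the latter that a proper ray does not separate the
    plane. Connectedness is handled throughout as constancy of locally constant functions. The side
    of a point relative to a curve [C_l] is read off from the change of an argument along the curve.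

    The obstacle is that [a] is an asymptotic value of [f]: the sets f^n(K) need not be closed, and
    images of open sets can acquire points of the orbit of [a] on their frontier, where [a] may
    itself escape. At each time these exceptional points are finite in number; they are avoided by
    going far to the left or right, or by choosing a vertical line that misses them.

    Iterated exponentials are the natural bound on strip heights: every orbit obeys it, and under it
    a point far enough to the right has an image whose modulus exceeds the height of the next strip,
    which forces the real part of the image to be large or negative. *)

Lemma Cnorm_nonneg z : 0 <= Cnorm z.
Proof. apply sqrt_pos. Qed.

Lemma Cnorm_sq z : Cnorm z * Cnorm z = fst z * fst z + snd z * snd z.
Proof. unfold Cnorm. apply sqrt_sqrt. nra. Qed.

Lemma Rle_sq x y : 0 <= y -> x * x <= y * y -> x <= y.
Proof. intros Hy H. destruct (Rle_dec x y) as [h|h]; [exact h|nra]. Qed.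

Lemma Cnorm_fst z : Rabs (fst z) <= Cnorm z.
Proof.
  apply Rle_sq; [apply Cnorm_nonneg|]. rewrite Cnorm_sq.
  pose proof (Rsqr_abs (fst z)) as H. unfold Rsqr in H. nra.
Qed.

Lemma Cnorm_snd z : Rabs (snd z) <= Cnorm z.
Proof.
  apply Rle_sq; [apply Cnorm_nonneg|]. rewrite Cnorm_sq.
  pose proof (Rsqr_abs (snd z)) as H. unfold Rsqr in H. nra.
Qed.

Lemma Cnorm_le_sum z : Cnorm z <= Rabs (fst z) + Rabs (snd z).
Proof.
  pose proof (Rabs_pos (fst z)). pose proof (Rabs_pos (snd z)).
  apply Rle_sq; [lra|]. rewrite Cnorm_sq.
  pose proof (Rsqr_abs (fst z)) as H1. pose proof (Rsqr_abs (snd z)) as H2. unfold Rsqr in *. nra.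
Qed.

Lemma Cnorm_triangle z w : Cnorm (Cadd z w) <= Cnorm z + Cnorm w.
Proof.
  pose proof (Cnorm_nonneg z). pose proof (Cnorm_nonneg w).
  pose proof (Cnorm_sq z) as Hz. pose proof (Cnorm_sq w) as Hw.
  assert (Hcs : fst z * fst w + snd z * snd w <= Cnorm z * Cnorm w).
  { apply Rle_sq; [nra|].
    replace (Cnorm z * Cnorm w * (Cnorm z * Cnorm w))
      with ((fst z * fst z + snd z * snd z) * (fst w * fst w + snd w * snd w)) by (rewrite <- Hz, <- Hw; ring).
    pose proof (Rle_0_sqr (fst z * snd w - snd z * fst w)) as Hs. unfold Rsqr in Hs. nra. }
  apply Rle_sq; [lra|]. rewrite Cnorm_sq. unfold Cadd; simpl. nra.
Qed.

Lemma Cdist_sq z w :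
  Cdist z w * Cdist z w = (fst z - fst w) * (fst z - fst w) + (snd z - snd w) * (snd z - snd w).
Proof. unfold Cdist. rewrite Cnorm_sq. reflexivity. Qed.

Lemma Cdist_nonneg z w : 0 <= Cdist z w.
Proof. apply Cnorm_nonneg. Qed.

Lemma Cdist_refl z : Cdist z z = 0.
Proof. unfold Cdist, Cnorm, Csub; simpl. replace (_ + _) with 0 by ring. apply sqrt_0. Qed.

Lemma Cdist_sym z w : Cdist z w = Cdist w z.
Proof. unfold Cdist, Cnorm, Csub; simpl. apply (f_equal sqrt). ring. Qed.

Lemma Cdist_triangle x y z : Cdist x z <= Cdist x y + Cdist y z.
Proof.
  unfold Cdist. replace (Csub x z) with (Cadd (Csub x y) (Csub y z)).
  - apply Cnorm_triangle.
  - unfold Cadd, Csub; simpl. f_equal; ring.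
Qed.

Lemma Cdist_eq0 z w : Cdist z w <= 0 -> z = w.
Proof.
  intro H. pose proof (Cdist_nonneg z w). pose proof (Cdist_sq z w) as Hs.
  assert (Cdist z w = 0) as E by lra. rewrite E in Hs.
  destruct z as [p q], w as [c d]; simpl in *.
  assert (Rsqr (p - c) + Rsqr (q - d) = 0) as E2 by (unfold Rsqr; lra).
  destruct (Rplus_sqr_eq_0 _ _ E2). f_equal; lra.
Qed.

Lemma Cdist_pos z w : z <> w -> 0 < Cdist z w.
Proof. intro H. destruct (Rlt_dec 0 (Cdist z w)); [auto|]. exfalso; apply H, Cdist_eq0; lra. Qed.

Lemma Cdist_fst z w : Rabs (fst z - fst w) <= Cdist z w.
Proof. apply (Cnorm_fst (Csub z w)). Qed.

Lemma Cdist_snd z w : Rabs (snd z - snd w) <= Cdist z w.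
Proof. apply (Cnorm_snd (Csub z w)). Qed.

Lemma Cdist_le_sum z w : Cdist z w <= Rabs (fst z - fst w) + Rabs (snd z - snd w).
Proof. apply (Cnorm_le_sum (Csub z w)). Qed.

Lemma Cdist_0 z : Cdist z (0, 0) = Cnorm z.
Proof. unfold Cdist, Csub, Cnorm; simpl. rewrite !Rminus_0_r. reflexivity. Qed.

Lemma Cnorm_dist z w : Cnorm z <= Cnorm w + Cdist z w.
Proof.
  rewrite <- (Cdist_0 z), <- (Cdist_0 w). pose proof (Cdist_triangle z w (0,0)). lra.
Qed.

(** * Continuity *)

(** Arbitrary distance functions let one set of rules serve all maps between the line and the
    plane. *)
Definition cont {A B : Type} (dA : A -> A -> R) (dB : B -> B -> R) (h : A -> B) (x : A) : Prop :=
  forall eps, eps > 0 -> exists d, d > 0 /\ forall y, dA y x < d -> dB (h y) (h x) < eps.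

Definition contCC := cont Cdist Cdist.
Definition contCR := cont Cdist Rdist.
Definition contRC := cont Rdist Cdist.
Definition contRR := cont Rdist Rdist.

Lemma cont_comp {A B D : Type} (dA : A -> A -> R) (dB : B -> B -> R) (dD : D -> D -> R)
      (g : B -> D) (h : A -> B) x :
  cont dA dB h x -> cont dB dD g (h x) -> cont dA dD (fun y => g (h y)) x.
Proof.
  intros Hh Hg eps He. destruct (Hg eps He) as [d [Hd Hd']].
  destruct (Hh d Hd) as [d2 [Hd2 Hd2']]. exists d2; split; auto.
Qed.

Lemma cont_ext_near {A B : Type} (dA : A -> A -> R) (dB : B -> B -> R) (g h : A -> B) x r :
  r > 0 -> dA x x = 0 -> (forall y, dA y x < r -> g y = h y) -> cont dA dB g x -> cont dA dB h x.
Proof.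
  intros Hr Hxx He Hg eps Heps. destruct (Hg eps Heps) as [d [Hd Hd']].
  exists (Rmin d r). split; [apply Rmin_glb_lt; auto|]. intros y Hy.
  rewrite <- !He; [apply Hd'| |].
  - eapply Rlt_le_trans; [exact Hy|apply Rmin_l].
  - lra.
  - eapply Rlt_le_trans; [exact Hy|apply Rmin_r].
Qed.

Lemma cont_pair {A : Type} (dA : A -> A -> R) (g h : A -> R) x :
  cont dA Rdist g x -> cont dA Rdist h x -> cont dA Cdist (fun y => (g y, h y)) x.
Proof.
  intros Hg Hh eps He. destruct (Hg (eps/2)) as [d1 [Hd1 H1]]; [lra|].
  destruct (Hh (eps/2)) as [d2 [Hd2 H2]]; [lra|].
  exists (Rmin d1 d2). split; [apply Rmin_glb_lt; auto|]. intros y Hy.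
  pose proof (H1 y (Rlt_le_trans _ _ _ Hy (Rmin_l _ _))).
  pose proof (H2 y (Rlt_le_trans _ _ _ Hy (Rmin_r _ _))).
  unfold Rdist in *. pose proof (Cdist_le_sum (g y, h y) (g x, h x)) as H3. simpl in H3. lra.
Qed.

Lemma contCR_fst z : contCR fst z.
Proof. intros e He. exists e. split; auto. intros w Hw. unfold Rdist. pose proof (Cdist_fst w z). lra. Qed.

Lemma contCR_snd z : contCR snd z.
Proof. intros e He. exists e. split; auto. intros w Hw. unfold Rdist. pose proof (Cdist_snd w z). lra. Qed.

Lemma cont_const {A B : Type} (dA : A -> A -> R) (dB : B -> B -> R) (c : B) x :
  dB c c = 0 -> cont dA dB (fun _ => c) x.
Proof. intros H e He. exists 1. split; [lra|]. intros. rewrite H. lra. Qed.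

Lemma Rdist_refl x : Rdist x x = 0.
Proof. unfold Rdist. replace (x - x) with 0 by ring. apply Rabs_R0. Qed.

Lemma cont_id {A : Type} (dA : A -> A -> R) x : cont dA dA (fun y => y) x.
Proof. intros e He. exists e. auto. Qed.

Lemma continuity_pt_cont h x : continuity_pt h x -> contRR h x.
Proof.
  intros H eps He. destruct (H eps He) as [d [Hd Hd']]. exists d. split; [exact Hd|].
  intros y Hy. destruct (Req_dec y x) as [->|n].
  - rewrite Rdist_refl; lra.
  - apply Hd'. split; [split; [exact I|auto]|]. exact Hy.
Qed.

Lemma cont_continuity_pt h x : contRR h x -> continuity_pt h x.
Proof.
  intros H eps He. destruct (H eps He) as [d [Hd Hd']]. exists d. split; [exact Hd|].
  intros y [_ Hy]. apply Hd', Hy.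
Qed.

Section RealOperations.
Variables (A : Type) (dA : A -> A -> R) (x : A).
Notation ct h := (cont dA Rdist h x).

Lemma cont_cont1 (k : R -> R) g : ct g -> continuity_pt k (g x) -> ct (fun y => k (g y)).
Proof.
  intros Hg Hk. apply (cont_comp dA Rdist Rdist k g x Hg). apply continuity_pt_cont, Hk.
Qed.

Lemma cont_plus g h : ct g -> ct h -> ct (fun y => g y + h y).
Proof.
  intros Hg Hh eps He. destruct (Hg (eps/2)) as [d1 [Hd1 H1]]; [lra|].
  destruct (Hh (eps/2)) as [d2 [Hd2 H2]]; [lra|].
  exists (Rmin d1 d2). split; [apply Rmin_glb_lt; auto|]. intros y Hy.
  pose proof (H1 y (Rlt_le_trans _ _ _ Hy (Rmin_l _ _))) as h1.
  pose proof (H2 y (Rlt_le_trans _ _ _ Hy (Rmin_r _ _))) as h2.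
  unfold Rdist in *. apply Rabs_def2 in h1. apply Rabs_def2 in h2. apply Rabs_def1; lra.
Qed.

Lemma cont_sqr g : ct g -> ct (fun y => g y * g y).
Proof.
  intro Hg. apply (cont_cont1 (fun t => t * t)); auto.
  apply derivable_continuous_pt. apply derivable_pt_mult; apply derivable_pt_id.
Qed.

Lemma cont_scal c g : ct g -> ct (fun y => c * g y).
Proof.
  intro Hg. apply (cont_cont1 (fun t => c * t)); auto.
  apply derivable_continuous_pt. apply derivable_pt_mult; [apply derivable_pt_const|apply derivable_pt_id].
Qed.

Lemma cont_opp g : ct g -> ct (fun y => - g y).
Proof.
  intro Hg. apply (cont_cont1 (fun t => - t)); auto.
  apply derivable_continuous_pt. apply derivable_pt_opp, derivable_pt_id.
Qed.

Lemma cont_minus g h : ct g -> ct h -> ct (fun y => g y - h y).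
Proof. intros Hg Hh. unfold Rminus. apply cont_plus; auto. apply cont_opp; auto. Qed.

(** Polarisation reduces a product to squares, which are compositions with a function of one real
    variable. *)
Lemma cont_mult g h : ct g -> ct h -> ct (fun y => g y * h y).
Proof.
  intros Hg Hh.
  assert (E : ct (fun y => / 4 * ((g y + h y) * (g y + h y) - (g y - h y) * (g y - h y)))).
  { apply cont_scal, cont_minus; apply cont_sqr; [apply cont_plus|apply cont_minus]; auto. }
  intros eps He. destruct (E eps He) as [d [Hd H]]. exists d. split; auto.
  intros y Hy. specialize (H y Hy).
  replace (g y * h y) with (/ 4 * ((g y + h y) * (g y + h y) - (g y - h y) * (g y - h y))) by field.
  replace (g x * h x) with (/ 4 * ((g x + h x) * (g x + h x) - (g x - h x) * (g x - h x))) by field.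
  exact H.
Qed.

Lemma cont_inv g : ct g -> g x <> 0 -> ct (fun y => / g y).
Proof.
  intros Hg H0. apply (cont_cont1 (fun t => / t)); auto.
  apply (continuity_pt_inv id (g x)); [apply derivable_continuous_pt, derivable_pt_id|exact H0].
Qed.

Lemma cont_div g h : ct g -> ct h -> h x <> 0 -> ct (fun y => g y / h y).
Proof. intros. unfold Rdiv. apply cont_mult; auto. apply cont_inv; auto. Qed.

Lemma cont_exp g : ct g -> ct (fun y => exp (g y)).
Proof. intro Hg. apply cont_cont1; auto. apply derivable_continuous_pt, derivable_pt_exp. Qed.

Lemma cont_cos g : ct g -> ct (fun y => cos (g y)).
Proof. intro Hg. apply cont_cont1; auto. apply derivable_continuous_pt, derivable_pt_cos. Qed.

Lemma cont_sin g : ct g -> ct (fun y => sin (g y)).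
Proof. intro Hg. apply cont_cont1; auto. apply derivable_continuous_pt, derivable_pt_sin. Qed.

Lemma cont_atan g : ct g -> ct (fun y => atan (g y)).
Proof. intro Hg. apply cont_cont1; auto. apply derivable_continuous_pt, derivable_pt_atan. Qed.

Lemma cont_sqrt g : ct g -> 0 <= g x -> ct (fun y => sqrt (g y)).
Proof. intros Hg H. apply cont_cont1; auto. apply continuity_pt_sqrt, H. Qed.

Lemma cont_ln g : ct g -> 0 < g x -> ct (fun y => ln (g y)).
Proof.
  intros Hg H. apply cont_cont1; auto. apply derivable_continuous_pt.
  exists (/ g x). apply derivable_pt_lim_ln, H.
Qed.
End RealOperations.

Lemma cont_fst {A : Type} (dA : A -> A -> R) (g : A -> Cplx) x :
  cont dA Cdist g x -> cont dA Rdist (fun y => fst (g y)) x.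
Proof. intro H. apply (cont_comp dA Cdist Rdist fst g x H). apply contCR_fst. Qed.

Lemma cont_snd {A : Type} (dA : A -> A -> R) (g : A -> Cplx) x :
  cont dA Cdist g x -> cont dA Rdist (fun y => snd (g y)) x.
Proof. intro H. apply (cont_comp dA Cdist Rdist snd g x H). apply contCR_snd. Qed.

Lemma cont_Cnorm {A : Type} (dA : A -> A -> R) (g : A -> Cplx) x :
  cont dA Cdist g x -> cont dA Rdist (fun y => Cnorm (g y)) x.
Proof.
  intro H. unfold Cnorm. apply cont_sqrt.
  - apply cont_plus; apply cont_sqr; [apply cont_fst|apply cont_snd]; auto.
  - nra.
Qed.

(** * Local constancy and connectedness *)

(** The zeroth cohomology of [A]: separation statements below are phrased with such functions. *)
Definition loc_const {T : Type} (A : Cplx -> Prop) (F : Cplx -> T) : Prop :=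
  forall z, A z -> exists r, r > 0 /\ forall w, A w -> Cdist w z < r -> F w = F z.

Lemma connected_loc_const {T : Type} (A : Cplx -> Prop) (F : Cplx -> T) :
  connected A -> loc_const A F -> forall z w, A z -> A w -> F z = F w.
Proof.
  intros HA HF z w Hz Hw. apply NNPP. intro Hne. apply HA.
  (* Relatively open subsets of [A] are thickened by balls centred in [A], since [connected] asks
     for open subsets of the plane, disjoint only on [A]. *)
  set (near := fun (P : T -> Prop) x => exists y r, A y /\ P (F y) /\ Cdist x y < r /\
                 forall v, A v -> Cdist v y < 2 * r -> F v = F y).
  assert (Hop : forall P, is_open (near P)).
  { intros P x (y & r & Hy & HP & Hd & Hc). exists (r - Cdist x y). split; [lra|].
    intros v Hv. exists y, r. repeat split; auto. unfold ball in Hv.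
    pose proof (Cdist_triangle v x y). lra. }
  assert (Hin : forall P x, A x -> P (F x) -> near P x).
  { intros P x Hx HP. destruct (HF x Hx) as [r [Hr Hr']]. exists x, (r/2).
    repeat split; auto.
    - rewrite Cdist_refl. lra.
    - intros v Hv Hd. apply Hr'; auto. lra. }
  exists (near (fun t => t = F z)), (near (fun t => t <> F z)).
  repeat split; try apply Hop.
  - intros x Hx. destruct (classic (F x = F z)); [left|right]; apply Hin; auto.
  - exists z. split; auto.
  - exists w. split; auto.
  - intros x Hx (y & r & Hy & HP & Hd & Hc) (y' & r' & Hy' & HP' & Hd' & Hc').
    apply HP'. rewrite <- HP. rewrite <- (Hc x), <- (Hc' x); auto; pose proof (Cdist_nonneg x y); pose proof (Cdist_nonneg x y'); lra.
Qed.

Definition indic (A : Cplx -> Prop) (z : Cplx) : R :=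
  if excluded_middle_informative (A z) then 1 else 0.

Lemma indic_1 A z : A z -> indic A z = 1.
Proof. intro H. unfold indic. destruct excluded_middle_informative; tauto. Qed.

Lemma indic_0 A z : ~ A z -> indic A z = 0.
Proof. intro H. unfold indic. destruct excluded_middle_informative; tauto. Qed.

Lemma indic_eq A z w : indic A z = indic A w -> A z -> A w.
Proof. unfold indic. do 2 destruct excluded_middle_informative; intros; try tauto; lra. Qed.

Lemma connected_intro (A : Cplx -> Prop) :
  (forall F : Cplx -> R, loc_const A F -> forall z w, A z -> A w -> F z = F w) -> connected A.
Proof.
  intros H (U & V & HU & HV & Hc & (z & Az & Uz) & (w & Aw & Vw) & Hd).
  assert (E : indic U z = indic U w).
  { apply H; auto. intros x Ax. destruct (Hc x Ax) as [Ux|Vx].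
    - destruct (HU x Ux) as [r [Hr Hr']]. exists r. split; auto. intros y Ay Hy.
      rewrite !indic_1; auto.
    - destruct (HV x Vx) as [r [Hr Hr']]. exists r. split; auto. intros y Ay Hy.
      rewrite !indic_0; eauto. }
  rewrite indic_1, indic_0 in E; eauto. lra.
Qed.

(** Supremum argument: the largest initial interval on which [G] equals [G a] can be prolonged
    unless it reaches [b]. *)
Lemma interval_loc_const {T : Type} (G : R -> T) a b :
  a <= b ->
  (forall t, a <= t <= b -> exists d, d > 0 /\ forall s, a <= s <= b -> Rabs (s - t) < d -> G s = G t) ->
  G a = G b.
Proof.
  intros Hab H.
  set (E := fun t => a <= t <= b /\ forall s, a <= s <= t -> G s = G a).
  assert (Ea : E a). { split; [lra|]. intros s Hs. f_equal. lra. }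
  destruct (completeness E) as [m [Hm1 Hm2]].
  { exists b. intros t [Ht _]. lra. }
  { exists a. exact Ea. }
  assert (am : a <= m) by (apply Hm1, Ea).
  assert (mb : m <= b). { apply Hm2. intros t [Ht _]. lra. }
  destruct (H m) as [d [Hd Hd']]; [lra|].
  assert (exists t, E t /\ m - d < t) as [t [Et Ht]].
  { apply NNPP. intro Hn. assert (m <= m - d); [|lra]. apply Hm2. intros t Et.
    destruct (Rle_dec t (m - d)); auto. exfalso. apply Hn. exists t. split; auto. lra. }
  assert (tm : t <= m) by (apply Hm1, Et).
  assert (Gm : G m = G a).
  { destruct Et as [Et1 Et2]. rewrite <- (Hd' t); [apply Et2; lra|lra|]. rewrite Rabs_left1; lra. }
  destruct (Req_dec m b) as [->|Hne]; [congruence|].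
  exfalso. set (u := Rmin b (m + d/2)).
  assert (Hu : m < u <= b /\ u < m + d).
  { unfold u. split; [split|]. - apply Rmin_glb_lt; lra. - apply Rmin_l.
    - pose proof (Rmin_r b (m + d/2)). lra. }
  assert (E u).
  { split; [lra|]. intros s Hs. destruct (Rle_dec s t) as [h|h].
    - apply Et. lra.
    - rewrite <- Gm. apply Hd'; [lra|]. apply Rabs_def1; lra. }
  assert (u <= m) by (apply Hm1; auto). lra.
Qed.

Lemma curve_loc_const {T : Type} (A : Cplx -> Prop) (F : Cplx -> T) (g : R -> Cplx) a b :
  a <= b -> (forall t, a <= t <= b -> contRC g t) -> (forall t, a <= t <= b -> A (g t)) ->
  loc_const A F -> F (g a) = F (g b).
Proof.
  intros Hab Hg HA HF. apply (interval_loc_const (fun t => F (g t)) a b Hab).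
  intros t Ht. destruct (HF (g t) (HA t Ht)) as [r [Hr Hr']].
  destruct (Hg t Ht r Hr) as [d [Hd Hd']]. exists d. split; auto.
Qed.

Lemma curve_loc_const' {T : Type} (A : Cplx -> Prop) (F : Cplx -> T) (g : R -> Cplx) (J : R -> Prop) :
  (forall a b t, J a -> J b -> a <= t <= b -> J t) ->
  (forall t, J t -> contRC g t) -> (forall t, J t -> A (g t)) ->
  loc_const A F -> forall a b, J a -> J b -> F (g a) = F (g b).
Proof.
  intros HJ Hg HA HF a b Ja Jb. destruct (Rle_dec a b) as [h|h].
  - apply (curve_loc_const A); eauto.
  - symmetry. apply (curve_loc_const A); eauto; lra.
Qed.

Definition seg (z w : Cplx) (t : R) : Cplx :=
  (fst z + t * (fst w - fst z), snd z + t * (snd w - snd z)).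

Lemma seg_cont z w t : contRC (seg z w) t.
Proof.
  apply cont_pair; apply cont_plus; try (apply cont_const, Rdist_refl);
  apply cont_mult; try apply cont_id; apply cont_const, Rdist_refl.
Qed.

Lemma seg_0 z w : seg z w 0 = z.
Proof. destruct z; unfold seg; simpl. f_equal; ring. Qed.

Lemma seg_1 z w : seg z w 1 = w.
Proof. destruct w; unfold seg; simpl. f_equal; ring. Qed.

Lemma seg_loc_const {T : Type} (A : Cplx -> Prop) (F : Cplx -> T) z w :
  (forall t, 0 <= t <= 1 -> A (seg z w t)) -> loc_const A F -> F z = F w.
Proof.
  intros HA HF. rewrite <- (seg_0 z w) at 1. rewrite <- (seg_1 z w) at 2.
  apply (curve_loc_const A); auto; [lra|]. intros. apply seg_cont.
Qed.

Lemma seg_dist_ball z w x t r :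
  0 <= t <= 1 -> Cdist z x < r -> Cdist w x < r -> Cdist (seg z w t) x < r.
Proof.
  intros Ht Hz Hw.
  assert (E : Csub (seg z w t) x = Cadd (seg (0,0) (Csub z x) (1 - t)) (seg (0,0) (Csub w x) t)).
  { unfold seg, Csub, Cadd; simpl. f_equal; ring. }
  assert (Hn : forall v s, 0 <= s -> Cnorm (seg (0,0) v s) = s * Cnorm v).
  { intros v s Hs. pose proof (Cnorm_nonneg v). unfold Cnorm, seg; simpl.
    replace (_ + _) with ((s * s) * (fst v * fst v + snd v * snd v)) by ring.
    rewrite sqrt_mult_alt by nra. rewrite sqrt_square by auto. reflexivity. }
  unfold Cdist in *. rewrite E. pose proof (Cnorm_triangle (seg (0,0) (Csub z x) (1 - t)) (seg (0,0) (Csub w x) t)) as H.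
  rewrite !Hn in H by lra.
  assert (h1 : (1 - t) * Cnorm (Csub z x) <= (1 - t) * r) by (apply Rmult_le_compat_l; lra).
  destruct (Rlt_dec 0 t) as [ht|ht].
  - assert (h2 : t * Cnorm (Csub w x) < t * r) by (apply Rmult_lt_compat_l; lra). lra.
  - assert (t = 0) by lra. subst t. lra.
Qed.

Lemma ball_loc_const {T : Type} (A : Cplx -> Prop) (F : Cplx -> T) x r z w :
  (forall y, Cdist y x < r -> A y) -> loc_const A F -> Cdist z x < r -> Cdist w x < r -> F z = F w.
Proof.
  intros HA HF Hz Hw. apply (seg_loc_const A); auto. intros t Ht. apply HA, seg_dist_ball; auto.
Qed.

Lemma loc_const_sub {T : Type} (A B : Cplx -> Prop) (F : Cplx -> T) :
  (forall z, B z -> A z) -> loc_const A F -> loc_const B F.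
Proof. intros H HF z Bz. destruct (HF z (H z Bz)) as [r [Hr Hr']]. exists r. split; auto. Qed.

(** * Compactness *)

Definition bounded (A : Cplx -> Prop) : Prop := exists M, forall z, A z -> Cnorm z <= M.
Definition closed (A : Cplx -> Prop) : Prop := forall z, closure A z -> A z.

Lemma closed_compl A : closed A -> is_open (fun z => ~ A z).
Proof.
  intros H z Hz. apply NNPP. intro Hn. apply Hz, H. intros e He. apply NNPP. intro Hn2.
  apply Hn. exists e. split; auto. intros w Hw Aw. apply Hn2. exists w.
  rewrite Cdist_sym. auto.
Qed.

Lemma open_compl U : is_open U -> closed (fun z => ~ U z).
Proof.
  intros H z Hz Uz. destruct (H z Uz) as [r [Hr Hr']]. destruct (Hz r Hr) as [w [Hw Hd]].
  apply Hw, Hr'. unfold ball. rewrite Cdist_sym. exact Hd.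
Qed.

Lemma closure_incl (A : Cplx -> Prop) z : A z -> closure A z.
Proof. intros H e He. exists z. rewrite Cdist_refl. auto. Qed.

Lemma closure_mono (A B : Cplx -> Prop) z : (forall w, A w -> B w) -> closure A z -> closure B z.
Proof. intros H Hz e He. destruct (Hz e He) as [w [Hw Hd]]. exists w; auto. Qed.

Lemma closure_closed A : closed (closure A).
Proof.
  intros z Hz e He. destruct (Hz (e/2)) as [w [Hw Hd]]; [lra|].
  destruct (Hw (e/2)) as [v [Hv Hd']]; [lra|]. exists v. split; auto.
  pose proof (Cdist_triangle v w z). rewrite (Cdist_sym z w) in *. rewrite (Cdist_sym z v).
  rewrite (Cdist_sym w v) in Hd'. lra.
Qed.

Definition cluster_R (u : nat -> R) (l : R) : Prop :=
  forall e, e > 0 -> forall N, exists n, (N <= n)%nat /\ Rabs (u n - l) < e.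
Definition cluster (u : nat -> Cplx) (z : Cplx) : Prop :=
  forall e, e > 0 -> forall N, exists n, (N <= n)%nat /\ Cdist (u n) z < e.

Lemma cluster_R_exists (u : nat -> R) M : (forall n, Rabs (u n) <= M) -> exists l, cluster_R u l.
Proof.
  intro H. destruct (Bolzano_Weierstrass u (fun x => - M <= x <= M)) as [l Hl].
  - apply compact_P3.
  - intro n. specialize (H n). unfold Rabs in H. destruct Rcase_abs; lra.
  - exists l. intros e He N.
    destruct (Hl (fun x => Rabs (x - l) < e) N) as [n [Hn Hd]].
    + exists (mkposreal e He). intros x Hx. exact Hx.
    + exists n. auto.
Qed.

Lemma subseq_of_cluster_R (u : nat -> R) l :
  cluster_R u l -> exists s : nat -> nat, (forall n, (n <= s n)%nat) /\ forall n, Rabs (u (s n) - l) < / (INR n + 1).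
Proof.
  intro H.
  assert (H' : forall n, exists m, (n <= m)%nat /\ Rabs (u m - l) < / (INR n + 1)).
  { intro n. apply H. apply Rinv_0_lt_compat. pose proof (pos_INR n). lra. }
  exists (fun n => proj1_sig (constructive_indefinite_description _ (H' n))).
  split; intro n; destruct constructive_indefinite_description as [m [h1 h2]]; simpl; auto.
Qed.

Lemma arch_inv e : e > 0 -> exists N, forall n, (N <= n)%nat -> / (INR n + 1) < e.
Proof.
  intro He. destruct (INR_unbounded (/ e)) as [N HN]. exists N. intros n Hn.
  apply le_INR in Hn. rewrite <- (Rinv_inv e). apply Rinv_lt_contravar; [|lra].
  pose proof (Rinv_0_lt_compat e He). apply Rmult_lt_0_compat; lra.
Qed.

Lemma cluster_exists (u : nat -> Cplx) M : (forall n, Cnorm (u n) <= M) -> exists z, cluster u z.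
Proof.
  intro H.
  destruct (cluster_R_exists (fun n => fst (u n)) M) as [x Hx].
  { intro n. pose proof (Cnorm_fst (u n)). specialize (H n). lra. }
  destruct (subseq_of_cluster_R _ _ Hx) as [s [Hs1 Hs2]].
  destruct (cluster_R_exists (fun n => snd (u (s n))) M) as [y Hy].
  { intro n. pose proof (Cnorm_snd (u (s n))). specialize (H (s n)). lra. }
  exists (x, y). intros e He N.
  destruct (arch_inv (e/2)) as [N1 HN1]; [lra|].
  destruct (Hy (e/2)) with (N := Nat.max N N1) as [n [Hn Hd]]; [lra|].
  exists (s n). split; [specialize (Hs1 n); lia|].
  pose proof (Cdist_le_sum (u (s n)) (x, y)). simpl in *.
  pose proof (Hs2 n). pose proof (HN1 n ltac:(lia)). lra.
Qed.

Lemma closure_seq (A : Cplx -> Prop) z :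
  closure A z -> exists u, (forall n, A (u n)) /\ forall n : nat, Cdist z (u n) < / (INR n + 1).
Proof.
  intro H.
  assert (H' : forall n : nat, exists w, A w /\ Cdist z w < / (INR n + 1)).
  { intro n. apply H. apply Rinv_0_lt_compat. pose proof (pos_INR n). lra. }
  exists (fun n => proj1_sig (constructive_indefinite_description _ (H' n))).
  split; intro n; destruct constructive_indefinite_description as [m [h1 h2]]; simpl; auto.
Qed.

Lemma cluster_closure (A : Cplx -> Prop) u z :
  (forall n, A (u n)) -> cluster u z -> closure A z.
Proof.
  intros HA H e He. destruct (H e He 0%nat) as [n [_ Hn]]. exists (u n). rewrite Cdist_sym; auto.
Qed.

Lemma cluster_cont (u : nat -> Cplx) z (h : Cplx -> Cplx) :
  cluster u z -> contCC h z -> cluster (fun n => h (u n)) (h z).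
Proof.
  intros Hu Hh e He N. destruct (Hh e He) as [d [Hd Hd']]. destruct (Hu d Hd N) as [n [Hn Hn']].
  exists n. auto.
Qed.

Lemma cluster_conv_unique u z w :
  cluster u z -> (forall n : nat, Cdist w (u n) < / (INR n + 1)) -> z = w.
Proof.
  intros Hu Hw. apply NNPP. intro Hne. apply Cdist_pos in Hne.
  destruct (arch_inv (Cdist z w / 2)) as [N HN]; [lra|].
  destruct (Hu (Cdist z w / 2)) with (N := N) as [n [Hn Hd]]; [lra|].
  pose proof (Cdist_triangle z (u n) w). specialize (HN n Hn). specialize (Hw n).
  pose proof (Cdist_sym z (u n)). pose proof (Cdist_sym w (u n)). lra.
Qed.

Lemma unif_cont (h : Cplx -> Cplx) M eps :
  (forall z, contCC h z) -> eps > 0 ->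
  exists d, d > 0 /\ forall z w, Cnorm z <= M -> Cnorm w <= M -> Cdist z w < d -> Cdist (h z) (h w) < eps.
Proof.
  intros Hh He. apply NNPP. intro Hn.
  assert (H : forall n : nat, exists p : Cplx * Cplx, Cnorm (fst p) <= M /\ Cnorm (snd p) <= M /\
      Cdist (fst p) (snd p) < / (INR n + 1) /\ eps <= Cdist (h (fst p)) (h (snd p))).
  { intro n. apply NNPP. intro Hn2. apply Hn. exists (/ (INR n + 1)). split.
    - apply Rinv_0_lt_compat. pose proof (pos_INR n). lra.
    - intros z w Hz Hw Hd. apply Rnot_le_lt. intro Hle. apply Hn2. exists (z, w). auto. }
  set (p := fun n => proj1_sig (constructive_indefinite_description _ (H n))).
  assert (Hp : forall n, Cnorm (fst (p n)) <= M /\ Cnorm (snd (p n)) <= M /\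
      Cdist (fst (p n)) (snd (p n)) < / (INR n + 1) /\ eps <= Cdist (h (fst (p n))) (h (snd (p n)))).
  { intro n. unfold p. destruct constructive_indefinite_description as [q Hq]. exact Hq. }
  clearbody p.
  destruct (cluster_exists (fun n => fst (p n)) M) as [z Hz]; [intro; apply Hp|].
  destruct (Hh z (eps/2)) as [d [Hd Hd']]; [lra|].
  destruct (arch_inv (d/2)) as [N HN]; [lra|].
  destruct (Hz (d/2)) with (N := N) as [n [Hn' Hdn]]; [lra|].
  destruct (Hp n) as (_ & _ & H3 & H4). specialize (HN n Hn').
  assert (Cdist (h (fst (p n))) (h z) < eps/2) by (apply Hd'; lra).
  assert (Cdist (h (snd (p n))) (h z) < eps/2).
  { apply Hd'. pose proof (Cdist_triangle (snd (p n)) (fst (p n)) z).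
    pose proof (Cdist_sym (snd (p n)) (fst (p n))). lra. }
  pose proof (Cdist_triangle (h (fst (p n))) (h z) (h (snd (p n)))).
  pose proof (Cdist_sym (h z) (h (snd (p n)))). lra.
Qed.

(** Parameters of a convergent sequence of image points stay bounded by properness, and a cluster
    value of them is mapped to the limit. *)
Lemma proper_image_closed (c : R -> Cplx) (X : R -> Prop) :
  (forall t, contRC c t) ->
  (forall t, (forall e, e > 0 -> exists s, X s /\ Rabs (s - t) < e) -> X t) ->
  (forall M, exists B, forall t, X t -> Cnorm (c t) <= M -> Rabs t <= B) ->
  closed (fun z => exists t, X t /\ c t = z).
Proof.
  intros Hc HX Hp z Hz. destruct (closure_seq _ _ Hz) as [u [Hu1 Hu2]].
  set (t := fun n => proj1_sig (constructive_indefinite_description _ (Hu1 n))).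
  assert (Ht : forall n, X (t n) /\ c (t n) = u n).
  { intro n. unfold t. destruct constructive_indefinite_description as [q Hq]. exact Hq. }
  clearbody t. destruct (Hp (Cnorm z + 1)) as [B HB].
  destruct (cluster_R_exists t B) as [s Hs].
  { intro n. apply HB; [apply Ht|]. destruct (Ht n) as [_ ->]. specialize (Hu2 n).
    pose proof (Cnorm_dist (u n) z). pose proof (Cdist_sym (u n) z).
    assert (/ (INR n + 1) <= 1).
    { rewrite <- Rinv_1. apply Rinv_le_contravar; pose proof (pos_INR n); lra. }
    lra. }
  exists s. split.
  - apply HX. intros e He. destruct (Hs e He 0%nat) as [n [_ Hn]]. exists (t n). split; auto. apply Ht.
  - apply (cluster_conv_unique u); auto. intros e He N.
    destruct (Hc s e He) as [d [Hd Hd']]. destruct (Hs d Hd N) as [n [Hn Hn']].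
    exists n. split; auto. destruct (Ht n) as [_ <-]. apply Hd'. exact Hn'.
Qed.

(** * Lifting maps to the circle *)

Definition cis (t : R) : Cplx := (cos t, sin t).

Lemma cis_eq s t : cis s = cis t -> exists k : Z, s - t = 2 * PI * IZR k.
Proof.
  intro H. unfold cis in H. injection H as Hc Hs.
  assert (E : cos (s - t) = 1).
  { rewrite cos_minus, Hc, Hs. pose proof (sin2_cos2 t) as h. unfold Rsqr in h. lra. }
  replace (s - t) with (2 * ((s - t) / 2)) in E by field.
  rewrite cos_2a_sin in E. assert (E2 : sin ((s - t)/2) = 0) by nra.
  destruct (sin_eq_0_0 _ E2) as [k Hk]. exists k. lra.
Qed.

Lemma IZR_small (k : Z) : Rabs (IZR k) < 1 -> k = 0%Z.
Proof.
  intro H. apply Rabs_def2 in H. destruct H as [h1 h2].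
  apply lt_IZR in h1. change (- (1)) with (-1) in h2. apply (lt_IZR (-1)) in h2. lia.
Qed.

Lemma loc_const_discrete (A : Cplx -> Prop) (F : Cplx -> R) (c : R) :
  c > 0 -> (forall z, A z -> contCR F z) -> (forall z, A z -> exists k : Z, F z = c * IZR k) ->
  loc_const A F.
Proof.
  intros Hc HF Hk z Az. destruct (HF z Az c Hc) as [d [Hd Hd']]. exists d. split; auto.
  intros w Aw Hw. specialize (Hd' w Hw). destruct (Hk z Az) as [k1 E1]. destruct (Hk w Aw) as [k2 E2].
  unfold Rdist in Hd'. rewrite E1, E2 in *.
  replace (c * IZR k2 - c * IZR k1) with (c * IZR (k2 - k1)) in Hd' by (rewrite minus_IZR; ring).
  rewrite Rabs_mult, (Rabs_pos_eq c) in Hd' by lra.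
  assert (k2 - k1 = 0)%Z by (apply IZR_small; nra). f_equal. f_equal. lia.
Qed.

Lemma cis_exists x y : x * x + y * y = 1 -> exists t, (x, y) = cis t.
Proof.
  intro H. assert (-1 <= x <= 1) as Hx by nra.
  assert (Hs : sin (acos x) = Rabs y).
  { rewrite sin_acos by lra. rewrite <- sqrt_Rsqr_abs. f_equal. unfold Rsqr. lra. }
  destruct (Rle_dec 0 y) as [h|h].
  - exists (acos x). unfold cis. rewrite cos_acos by lra. rewrite Hs, Rabs_pos_eq; auto.
  - exists (- acos x). unfold cis. rewrite cos_neg, sin_neg, cos_acos by lra.
    rewrite Hs, Rabs_left by lra. f_equal. ring.
Qed.

(** The signed angle from [u] to [v], as the arctangent of determinant over scalar product; correct
    when the scalar product is positive. *)
Definition turn (u v : Cplx) : R :=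
  atan ((fst u * snd v - snd u * fst v) / (fst u * fst v + snd u * snd v)).

Lemma atan_cis x y : 0 < x -> x * x + y * y = 1 -> (x, y) = cis (atan (y / x)).
Proof.
  intros Hx H. unfold cis. rewrite cos_atan, sin_atan.
  assert (E : sqrt (1 + (y / x)²) = / x).
  { apply sqrt_lem_1.
    - unfold Rsqr. pose proof (Rle_0_sqr (y / x)) as h. unfold Rsqr in h. lra.
    - left. apply Rinv_0_lt_compat; auto.
    - unfold Rsqr. replace (1 + y / x * (y / x)) with ((x * x + y * y) / (x * x)) by (field; lra).
      rewrite H. field. lra. }
  rewrite E. f_equal; field; lra.
Qed.

Definition unit_vec (u : Cplx) : Prop := fst u * fst u + snd u * snd u = 1.

Lemma unit_cis t : unit_vec (cis t).
Proof. unfold unit_vec, cis; simpl. pose proof (sin2_cos2 t) as h. unfold Rsqr in h. lra. Qed.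

Lemma dot_pos u v : unit_vec u -> unit_vec v -> Cdist u v < 1 -> 0 < fst u * fst v + snd u * snd v.
Proof.
  unfold unit_vec. intros Hu Hv Hd. pose proof (Cdist_sq u v) as H. pose proof (Cdist_nonneg u v). nra.
Qed.

Lemma turn_cis t v : unit_vec v -> 0 < cos t * fst v + sin t * snd v -> v = cis (t + turn (cis t) v).
Proof.
  intros Hv Hd. pose proof (sin2_cos2 t) as h. unfold Rsqr in h. unfold unit_vec in Hv.
  assert (E : (cos t * fst v + sin t * snd v, cos t * snd v - sin t * fst v) = cis (turn (cis t) v)).
  { apply atan_cis; simpl; auto.
    transitivity ((sin t * sin t + cos t * cos t) * (fst v * fst v + snd v * snd v)); [ring|].
    rewrite h, Hv. ring. }
  unfold cis in E. injection E as E1 E2. unfold cis. rewrite cos_plus, sin_plus.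
  change (fun x => _) with cis in *.
  rewrite <- E1, <- E2. destruct v as [x y]; simpl in *. f_equal.
  - transitivity ((sin t * sin t + cos t * cos t) * x); [rewrite h; ring|ring].
  - transitivity ((sin t * sin t + cos t * cos t) * y); [rewrite h; ring|ring].
Qed.

Lemma cont_turn {A : Type} (dA : A -> A -> R) (g h : A -> Cplx) x :
  cont dA Cdist g x -> cont dA Cdist h x -> 0 < fst (g x) * fst (h x) + snd (g x) * snd (h x) ->
  cont dA Rdist (fun y => turn (g y) (h y)) x.
Proof.
  intros Hg Hh H. unfold turn. apply cont_atan, cont_div.
  - apply cont_minus; apply cont_mult; (apply cont_fst || apply cont_snd); auto.
  - apply cont_plus; apply cont_mult; (apply cont_fst || apply cont_snd); auto.
  - lra.
Qed.

Definition scale (s : R) (z : Cplx) : Cplx := (s * fst z, s * snd z).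

Lemma Cnorm_scale s z : Cnorm (scale s z) = Rabs s * Cnorm z.
Proof.
  unfold Cnorm, scale; simpl.
  replace (_ + _) with ((s * s) * (fst z * fst z + snd z * snd z)) by ring.
  rewrite sqrt_mult_alt by nra. f_equal. rewrite <- sqrt_Rsqr_abs. reflexivity.
Qed.

Lemma Cdist_scale s t z : Cdist (scale s z) (scale t z) = Rabs (s - t) * Cnorm z.
Proof.
  rewrite <- Cnorm_scale. unfold Cdist, Csub, Cnorm, scale; simpl. apply (f_equal sqrt). ring.
Qed.

Lemma scale_cont s z : contCC (scale s) z.
Proof. apply cont_pair; apply cont_scal; [apply contCR_fst|apply contCR_snd]. Qed.

(** Continuation of the argument of [h] along the radius from the origin to [z], in [N] equal
    steps. *)
Fixpoint lift_sum (h : Cplx -> Cplx) (N : nat) (t0 : R) (k : nat) (z : Cplx) : R :=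
  match k with
  | O => t0
  | S k => lift_sum h N t0 k z + turn (h (scale (INR k / INR N) z)) (h (scale (INR (S k) / INR N) z))
  end.

Section Lifting.
Variable h : Cplx -> Cplx.
Hypothesis h_cont : forall z, contCC h z.
Hypothesis h_unit : forall z, unit_vec (h z).

Lemma lift_disc t0 M :
  h (0, 0) = cis t0 -> exists psi : Cplx -> R,
    psi (0, 0) = t0 /\ forall z, Cnorm z <= M -> contCR psi z /\ h z = cis (psi z).
Proof.
  intro H0.
  (* Unit vectors at distance below 1 form an acute angle, so [turn] measures it correctly; [N] is
     then chosen to make each radial step shorter than [d]. *)
  destruct (unif_cont h M 1 h_cont) as [d [Hd Hd']]; [lra|].
  destruct (INR_unbounded (Rabs M / d + 1)) as [N HN].
  assert (HN0 : 0 < INR N).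
  { assert (0 <= Rabs M / d); [|lra]. apply Rmult_le_pos; [apply Rabs_pos|]. left. apply Rinv_0_lt_compat; lra. }
  assert (Hstep : forall z k, Cnorm z <= M -> (k < N)%nat ->
     0 < fst (h (scale (INR k / INR N) z)) * fst (h (scale (INR (S k) / INR N) z))
       + snd (h (scale (INR k / INR N) z)) * snd (h (scale (INR (S k) / INR N) z))).
  { intros z k Hz Hk. apply dot_pos; auto.
    assert (HkN : forall j, (j <= N)%nat -> Cnorm (scale (INR j / INR N) z) <= M).
    { intros j Hj. apply le_INR in Hj. pose proof (pos_INR j). rewrite Cnorm_scale.
      assert (0 <= INR j / INR N <= 1).
      { split; [apply Rmult_le_pos; [lra|left; apply Rinv_0_lt_compat; lra]|].
        apply (Rmult_le_reg_r (INR N)); auto. unfold Rdiv. rewrite Rmult_assoc, Rinv_l; lra. }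
      rewrite Rabs_pos_eq by lra. pose proof (Cnorm_nonneg z). nra. }
    apply Hd'; try (apply HkN; lia).
    rewrite Cdist_scale, S_INR.
    replace (INR k / INR N - (INR k + 1) / INR N) with (- / INR N) by (field; lra).
    rewrite Rabs_Ropp, Rabs_pos_eq by (left; apply Rinv_0_lt_compat; lra).
    apply (Rmult_lt_reg_l (INR N)); auto. rewrite <- Rmult_assoc, Rinv_r, Rmult_1_l by lra.
    assert (Rabs M < INR N * d).
    { apply (Rmult_lt_reg_r (/ d)); [apply Rinv_0_lt_compat; lra|].
      rewrite Rmult_assoc, Rinv_r by lra. unfold Rdiv in HN. lra. }
    pose proof (Rle_abs M). lra. }
  assert (Hind : forall k z, Cnorm z <= M -> (k <= N)%nat ->
     contCR (lift_sum h N t0 k) z /\ h (scale (INR k / INR N) z) = cis (lift_sum h N t0 k z)).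
  { induction k as [|k IH]; intros z Hz Hk.
    - split; [apply cont_const, Rdist_refl|]. simpl lift_sum. rewrite <- H0. f_equal.
      unfold scale. simpl INR. f_equal; field; lra.
    - destruct (IH z Hz ltac:(lia)) as [IH1 IH2]. specialize (Hstep z k Hz ltac:(lia)). split.
      + simpl lift_sum. apply cont_plus; [exact IH1|].
        apply cont_turn; [| |exact Hstep]; (apply (cont_comp _ Cdist); [apply scale_cont|apply h_cont]).
      + simpl lift_sum. rewrite IH2 in *. apply turn_cis; auto. }
  exists (lift_sum h N t0 N). split.
  - assert (E : forall k, lift_sum h N t0 k (0, 0) = t0).
    { induction k as [|k IH]; [reflexivity|]. simpl lift_sum. rewrite IH.
      assert (Es : forall s, scale s (0, 0) = (0, 0)) by (intro; unfold scale; simpl; f_equal; ring).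
      rewrite !Es. unfold turn. replace (_ - _) with 0 by ring. unfold Rdiv. rewrite Rmult_0_l, atan_0. ring. }
    apply E.
  - intros z Hz. destruct (Hind N z Hz (le_n _)) as [h1 h2]. split; auto. rewrite <- h2. f_equal.
    unfold scale. destruct z; simpl. f_equal; field; lra.
Qed.

Lemma lift_unique M (p1 p2 : Cplx -> R) :
  (forall z, Cnorm z <= M -> contCR p1 z /\ h z = cis (p1 z)) ->
  (forall z, Cnorm z <= M -> contCR p2 z /\ h z = cis (p2 z)) ->
  p1 (0, 0) = p2 (0, 0) -> forall z, Cnorm z <= M -> p1 z = p2 z.
Proof.
  intros H1 H2 H0 z Hz.
  assert (E : p1 (0,0) - p2 (0,0) = p1 z - p2 z); [|lra].
  apply (seg_loc_const (fun w => Cnorm w <= M) (fun w => p1 w - p2 w)).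
  - intros t Ht. replace (seg (0,0) z t) with (scale t z) by (unfold seg, scale; simpl; f_equal; ring).
    rewrite Cnorm_scale, Rabs_pos_eq by lra. pose proof (Cnorm_nonneg z). nra.
  - apply (loc_const_discrete _ _ (2 * PI)).
    + pose proof PI_RGT_0. lra.
    + intros w Hw. apply cont_minus; [apply H1|apply H2]; auto.
    + intros w Hw. apply cis_eq. destruct (H1 w Hw) as [_ <-]. destruct (H2 w Hw) as [_ <-]. reflexivity.
Qed.

(** The lifts on growing discs all take the value [t0] at the origin, hence agree by uniqueness and
    glue. The radius [INR n + 1] leaves a margin of 1 around every point of norm below [INR n],
    which gives continuity of the glued function. *)
Theorem circle_lift : exists psi : Cplx -> R, forall z, contCR psi z /\ h z = cis (psi z).
Proof.
  destruct (cis_exists (fst (h (0,0))) (snd (h (0,0)))) as [t0 Ht0]; [apply h_unit|].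
  rewrite <- surjective_pairing in Ht0.
  set (P := fun n : nat => proj1_sig (constructive_indefinite_description _ (lift_disc t0 (INR n + 1) Ht0))).
  assert (HP : forall n, P n (0,0) = t0 /\ forall z, Cnorm z <= INR n + 1 -> contCR (P n) z /\ h z = cis (P n z)).
  { intro n. unfold P. destruct constructive_indefinite_description as [p Hp]. exact Hp. }
  clearbody P.
  assert (Hmono : forall n m z, (n <= m)%nat -> Cnorm z <= INR n + 1 -> P n z = P m z).
  { intros n m z Hnm Hz. apply (lift_unique (INR n + 1)); auto.
    - apply HP.
    - intros w Hw. apply HP. apply le_INR in Hnm. lra.
    - destruct (HP n) as [-> _]. destruct (HP m) as [-> _]. reflexivity. }
  set (b := fun z => proj1_sig (constructive_indefinite_description _ (INR_unbounded (Cnorm z)))).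
  assert (Hb : forall z, INR (b z) > Cnorm z).
  { intro z. unfold b. destruct constructive_indefinite_description as [p Hp]. exact Hp. }
  clearbody b.
  assert (Heq : forall n z, Cnorm z <= INR n + 1 -> P n z = P (b z) z).
  { intros n z Hz. specialize (Hb z). rewrite (Hmono n (Nat.max n (b z))); [|lia|lra].
    symmetry. apply Hmono; [lia|lra]. }
  exists (fun z => P (b z) z). intro z. specialize (Hb z). split.
  - apply (cont_ext_near _ _ (P (b z)) _ z 1); [lra|apply Cdist_refl| |apply HP; lra].
    intros w Hw. apply Heq. pose proof (Cnorm_dist w z). lra.
  - apply HP. lra.
Qed.
End Lifting.

(** * Separation by disjoint closed sets *)

(** The distance to [P], written as the negative of a least upper bound because [completeness]
    supplies suprema. *)
Lemma dist_fun (P : Cplx -> Prop) :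
  (exists p, P p) -> exists d : Cplx -> R,
    (forall z, contCR d z) /\ (forall z, 0 <= d z) /\ (forall z, P z -> d z = 0) /\
    (forall z, d z <= 0 -> closure P z).
Proof.
  intros [p0 Hp0].
  assert (H : forall z, { m | is_lub (fun x => exists p, P p /\ x = - Cdist z p) m }).
  { intro z. apply completeness.
    - exists 0. intros x (p & _ & ->). pose proof (Cdist_nonneg z p). lra.
    - exists (- Cdist z p0). eauto. }
  exists (fun z => - proj1_sig (H z)).
  assert (Hlip : forall z w, - proj1_sig (H z) <= - proj1_sig (H w) + Cdist z w).
  { intros z w. destruct (H z) as [m [h1 h2]], (H w) as [m' [h1' h2']]; simpl.
    assert (m' <= m + Cdist z w); [|lra]. apply h2'. intros x (p & Hp & ->).
    assert (- Cdist z p <= m) by (apply h1; eauto). pose proof (Cdist_triangle z w p). lra. }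
  repeat split.
  - intros z e He. exists e. split; auto. intros w Hw. unfold Rdist.
    pose proof (Hlip z w). pose proof (Hlip w z). pose proof (Cdist_sym z w). apply Rabs_def1; lra.
  - intro z. destruct (H z) as [m [h1 h2]]; simpl. assert (m <= 0); [|lra]. apply h2.
    intros x (p & _ & ->). pose proof (Cdist_nonneg z p). lra.
  - intros z Hz. destruct (H z) as [m [h1 h2]]; simpl.
    assert (0 <= m). { apply h1. exists z. rewrite Cdist_refl. split; auto. lra. }
    assert (m <= 0); [|lra]. apply h2.
    intros x (p & _ & ->). pose proof (Cdist_nonneg z p). lra.
  - intros z Hz e He. destruct (H z) as [m [h1 h2]]; simpl in *. apply NNPP. intro Hn.
    assert (m <= - e); [|lra]. apply h2. intros x (p & Hp & ->).
    destruct (Rlt_dec (Cdist z p) e); [exfalso; eauto|lra].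
Qed.

Lemma urysohn (P1 P2 : Cplx -> Prop) :
  closed P1 -> closed P2 -> (forall z, P1 z -> P2 z -> False) -> (exists z, P1 z) -> (exists z, P2 z) ->
  exists phi : Cplx -> R, (forall z, contCR phi z) /\ (forall z, P1 z -> phi z = 0) /\ (forall z, P2 z -> phi z = 1).
Proof.
  intros C1 C2 Hd H1 H2.
  destruct (dist_fun P1 H1) as (d1 & A1 & B1 & D1 & E1).
  destruct (dist_fun P2 H2) as (d2 & A2 & B2 & D2 & E2).
  assert (Hpos : forall z, d1 z + d2 z <> 0).
  { intros z Hz. specialize (B1 z). specialize (B2 z). apply (Hd z).
    - apply C1, E1. lra.
    - apply C2, E2. lra. }
  exists (fun z => d1 z / (d1 z + d2 z)). repeat split.
  - intro z. apply cont_div; [apply A1| |apply Hpos]. apply cont_plus; [apply A1|apply A2].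
  - intros z Hz. rewrite D1 by auto. unfold Rdiv. ring.
  - intros z Hz. specialize (Hpos z). rewrite (D2 z) in * by auto. field. lra.
Qed.

(** The circle-valued function equal to [exp(2 pi i phi)] on [chi = 1] and to [1] elsewhere is continuous,
    since [phi] is an integer on the frontier [P1 \/ P2] of [chi = 1]; [2 pi psi] is its argument. *)
Lemma separation_lift (P1 P2 Q : Cplx -> Prop) :
  closed P1 -> closed P2 -> (forall z, P1 z -> P2 z -> False) -> (exists z, P1 z) -> (exists z, P2 z) ->
  loc_const (fun z => ~ P1 z /\ ~ P2 z) (indic Q) -> (forall z, Q z -> ~ P1 z /\ ~ P2 z) ->
  exists phi psi : Cplx -> R,
    (forall z, contCR phi z) /\ (forall z, P1 z -> phi z = 0) /\ (forall z, P2 z -> phi z = 1) /\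
    (forall z, contCR psi z) /\ (forall z, Q z -> exists k : Z, psi z - phi z = IZR k) /\
    (forall z, ~ Q z -> exists k : Z, psi z = IZR k).
Proof.
  intros C1 C2 Hd H1 H2 HQ HQ'.
  destruct (urysohn P1 P2 C1 C2 Hd H1 H2) as (phi & Hphi & p1 & p2).
  assert (Hpi : 0 < 2 * PI) by (pose proof PI_RGT_0; lra).
  set (k := fun z => cis (2 * PI * phi z)).
  assert (Hk : forall z, contCC k z).
  { intro z. apply cont_pair; [apply cont_cos|apply cont_sin]; apply cont_scal, Hphi. }
  assert (Hk1 : forall z, P1 z \/ P2 z -> k z = (1, 0)).
  { intros z Hz. unfold k, cis. destruct Hz as [Hz|Hz]; [rewrite (p1 z Hz)|rewrite (p2 z Hz)].
    - rewrite Rmult_0_r, cos_0, sin_0. reflexivity.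
    - rewrite Rmult_1_r, cos_2PI, sin_2PI. reflexivity. }
  set (h := fun z => if excluded_middle_informative (Q z) then k z else (1, 0)).
  assert (hQ : forall z, Q z -> h z = k z) by (intros z Hz; unfold h; destruct excluded_middle_informative; tauto).
  assert (hN : forall z, ~ Q z -> h z = (1, 0)) by (intros z Hz; unfold h; destruct excluded_middle_informative; tauto).
  assert (Hop : forall z, ~ P1 z /\ ~ P2 z -> exists r, r > 0 /\ forall w, Cdist w z < r -> ~ P1 w /\ ~ P2 w).
  { intros z [n1 n2]. destruct (closed_compl _ C1 z n1) as [r1 [Hr1 Hr1']].
    destruct (closed_compl _ C2 z n2) as [r2 [Hr2 Hr2']]. exists (Rmin r1 r2).
    split; [apply Rmin_glb_lt; auto|]. intros w Hw. split; [apply Hr1'|apply Hr2']; unfold ball;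
    eapply Rlt_le_trans; try exact Hw; [apply Rmin_l|apply Rmin_r]. }
  destruct (circle_lift h) as [theta Hth].
  - intro z. destruct (classic (P1 z \/ P2 z)) as [Hz|Hz].
    + assert (Ez : h z = (1, 0)).
      { apply hN. intro q. apply HQ' in q. tauto. }
      intros e He. destruct (Hk z e He) as [d [Hd1 Hd2]]. exists d. split; auto. intros w Hw.
      rewrite Ez. destruct (classic (Q w)) as [q|q].
      * rewrite hQ by auto. rewrite <- (Hk1 z Hz). auto.
      * rewrite hN, Cdist_refl by auto. lra.
    + assert (Hz' : ~ P1 z /\ ~ P2 z) by tauto.
      destruct (HQ z Hz') as [r1 [Hr1 Hr1']]. destruct (Hop z Hz') as [r2 [Hr2 Hr2']].
      assert (Hr : Rmin r1 r2 > 0) by (apply Rmin_glb_lt; auto).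
      assert (Hqq : forall w, Cdist w z < Rmin r1 r2 -> indic Q w = indic Q z).
      { intros w Hw. apply Hr1'; [apply Hr2'|]; eapply Rlt_le_trans; try exact Hw; [apply Rmin_r|apply Rmin_l]. }
      destruct (classic (Q z)) as [q|q].
      * apply (cont_ext_near _ _ k _ z (Rmin r1 r2)); [exact Hr|apply Cdist_refl| |apply Hk].
        intros w Hw. symmetry. apply hQ. apply (indic_eq Q z w); auto. symmetry. auto.
      * apply (cont_ext_near _ _ (fun _ => (1,0)) _ z (Rmin r1 r2)); [exact Hr|apply Cdist_refl| |apply cont_const, Cdist_refl].
        intros w Hw. symmetry. apply hN. intro qw. apply q. apply (indic_eq Q w z); auto.
  - intro z. destruct (classic (Q z)) as [q|q].
    + rewrite hQ by auto. apply unit_cis.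
    + rewrite hN by auto. unfold unit_vec; simpl. ring.
  - exists phi, (fun z => theta z / (2 * PI)). repeat split; auto.
    + intro z. apply (cont_cont1 _ _ _ (fun t => t / (2 * PI))); [apply Hth|].
      apply cont_continuity_pt. apply cont_div; [apply cont_id|apply cont_const, Rdist_refl|lra].
    + intros z q. destruct (Hth z) as [_ E]. rewrite hQ in E by auto. symmetry in E.
      apply cis_eq in E. destruct E as [m E]. exists m.
      apply (Rmult_eq_reg_l (2 * PI)); [|lra]. rewrite <- E. field. lra.
    + intros z q. destruct (Hth z) as [_ E]. rewrite hN in E by auto. symmetry in E.
      replace (1, 0) with (cis 0) in E by (unfold cis; rewrite cos_0, sin_0; reflexivity).
      apply cis_eq in E. destruct E as [m E]. exists m.
      apply (Rmult_eq_reg_l (2 * PI)); [|lra]. rewrite <- E. field. lra.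
Qed.

(** The Mayer-Vietoris sequence of the plane in degree zero. *)
Lemma mayer_vietoris (P1 P2 Q : Cplx -> Prop) :
  closed P1 -> closed P2 -> (forall z, P1 z -> P2 z -> False) ->
  loc_const (fun z => ~ P1 z /\ ~ P2 z) (indic Q) ->
  exists alpha beta : Cplx -> R,
    loc_const (fun z => ~ P1 z) alpha /\ loc_const (fun z => ~ P2 z) beta /\
    forall z, ~ P1 z -> ~ P2 z -> indic Q z = alpha z - beta z.
Proof.
  intros C1 C2 Hd HQ.
  destruct (classic (exists z, P1 z)) as [H1|H1]; [destruct (classic (exists z, P2 z)) as [H2|H2]|].
  - set (Q' := fun z => Q z /\ ~ P1 z /\ ~ P2 z).
    assert (EQ : forall z, ~ P1 z /\ ~ P2 z -> indic Q' z = indic Q z).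
    { intros z Hz. destruct (classic (Q z)).
      - rewrite !indic_1; auto. split; auto.
      - rewrite !indic_0; auto. intros [q _]; auto. }
    destruct (separation_lift P1 P2 Q') as (phi & psi & Hphi & p1 & p2 & Hpsi & k1 & k2); auto.
    { intros z Hz. destruct (HQ z Hz) as [r [Hr Hr']]. exists r. split; auto. intros w Hw Hwz.
      rewrite !EQ; auto. }
    { intros z q. apply q. }
    assert (Hcont : forall z, ~ P1 z /\ ~ P2 z -> contCR (indic Q') z).
    { intros z Hz. destruct (HQ z Hz) as [r [Hr Hr']].
      destruct (closed_compl _ C1 z (proj1 Hz)) as [r1 [Hr1 Hr1']].
      destruct (closed_compl _ C2 z (proj2 Hz)) as [r2 [Hr2 Hr2']].
      intros e He. exists (Rmin r (Rmin r1 r2)). split; [repeat apply Rmin_glb_lt; auto|].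
      intros w Hw.
      assert (Cdist w z < r /\ Cdist w z < r1 /\ Cdist w z < r2) as (h0 & h1 & h2).
      { pose proof (Rmin_l r (Rmin r1 r2)). pose proof (Rmin_r r (Rmin r1 r2)).
        pose proof (Rmin_l r1 r2). pose proof (Rmin_r r1 r2). lra. }
      assert (Hw2 : ~ P1 w /\ ~ P2 w) by (split; [apply Hr1'|apply Hr2']; auto).
      rewrite !EQ by auto. rewrite Hr', Rdist_refl; auto. }
    assert (Hb : forall z, 0 <= indic Q' z <= 1).
    { intro z. unfold indic. destruct excluded_middle_informative; lra. }
    assert (H0 : forall z, P1 z \/ P2 z -> indic Q' z = 0).
    { intros z Hz. apply indic_0. intros (_ & n1 & n2). tauto. }
    assert (Hprod : forall g z, contCR g z -> g z = 0 -> contCR (fun w => indic Q' w * g w) z).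
    { intros g z Hg Hz e He. destruct (Hg e He) as [d [Hd1 Hd2]]. exists d. split; auto.
      intros w Hw. specialize (Hd2 w Hw). unfold Rdist in *. rewrite Hz in *. rewrite Rmult_0_r, Rminus_0_r in *.
      rewrite Rabs_mult. pose proof (Rabs_pos (g w)). specialize (Hb w). rewrite (Rabs_pos_eq (indic Q' w)) by lra. nra. }
    (* The difference is the indicator of [Q']. The second function is integer-valued since
       [psi - phi] is an integer on [Q'] and [psi] off it. The indicator jumps only at [P1] and
       [P2]: the factor [phi] hides the jump at [P1], and [1 - phi] the one at [P2], so each
       function is continuous off the other closed set. *)
    exists (fun z => psi z + indic Q' z * (1 - phi z)), (fun z => psi z - indic Q' z * phi z).
    assert (Hint : forall z, exists k : Z, psi z - indic Q' z * phi z = 1 * IZR k).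
    { intro z. destruct (classic (Q' z)) as [q|q].
      - destruct (k1 z q) as [m E]. exists m. rewrite indic_1 by auto. lra.
      - destruct (k2 z q) as [m E]. exists m. rewrite indic_0 by auto. lra. }
    split; [|split].
    + apply (loc_const_discrete _ _ 1); [lra| |].
      * intros z n1. apply cont_plus; [apply Hpsi|]. destruct (classic (P2 z)) as [q2|q2].
        -- apply (Hprod (fun w => 1 - phi w)).
           ++ apply cont_minus; [apply cont_const, Rdist_refl|apply Hphi].
           ++ rewrite p2; auto. lra.
        -- apply cont_mult; [apply Hcont; auto|].
           apply cont_minus; [apply cont_const, Rdist_refl|apply Hphi].
      * intros z _. destruct (Hint z) as [m E]. destruct (classic (Q' z)) as [q|q].
        -- exists (m + 1)%Z. rewrite plus_IZR. rewrite indic_1 in * by auto. lra.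
        -- exists m. rewrite indic_0 in * by auto. lra.
    + apply (loc_const_discrete _ _ 1); [lra| |auto].
      intros z n2. apply cont_minus; [apply Hpsi|]. destruct (classic (P1 z)) as [q1|q1].
      * apply (Hprod phi); auto.
      * apply cont_mult; [apply Hcont; auto|apply Hphi].
    + intros z n1 n2. rewrite <- EQ by auto. ring.
  - exists (indic Q), (fun _ => 0). split; [|split].
    + intros z n1. destruct (HQ z) as [r [Hr Hr']]; [split; eauto|]. exists r. split; auto.
      intros w n1w Hw. apply Hr'; auto. split; eauto.
    + intros z _. exists 1. split; [lra|auto].
    + intros. ring.
  - exists (fun _ => 0), (fun z => - indic Q z). split; [|split].
    + intros z _. exists 1. split; [lra|auto].
    + intros z n2. destruct (HQ z) as [r [Hr Hr']]; [split; eauto|]. exists r. split; auto.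
      intros w n2w Hw. f_equal. apply Hr'; auto. split; eauto.
    + intros. ring.
Qed.

(** If the intersection split into closed pieces [P1] and [P2], apply [separation_lift] with the
    complement of [B] as [Q]. Then [psi] is an integer on [B] and [psi - phi] is an integer on [A],
    so both are constant there. Hence [phi] takes the same value on [P1] and [P2], although it is 0
    on one and 1 on the other. *)
Lemma unicoherence (A B : Cplx -> Prop) :
  closed A -> closed B -> connected A -> connected B -> (forall z, A z \/ B z) ->
  connected (fun z => A z /\ B z).
Proof.
  intros CA CB KA KB HAB. apply connected_intro. intros F HF z w [Az Bz] [Aw Bw].
  apply NNPP. intro Hne.
  set (P1 := fun x => (A x /\ B x) /\ F x = F z). set (P2 := fun x => (A x /\ B x) /\ F x <> F z).
  assert (CAB : closed (fun x => A x /\ B x)).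
  { intros x Hx. split; [apply CA|apply CB]; eapply closure_mono; try exact Hx; simpl; tauto. }
  assert (C12 : forall (P : R -> Prop), closed (fun x => (A x /\ B x) /\ P (F x))).
  { intros P x Hx. assert (Kx : A x /\ B x).
    { apply CAB. eapply closure_mono; try exact Hx. simpl; tauto. }
    split; auto. destruct (HF x Kx) as [r [Hr Hr']]. destruct (Hx r Hr) as (y & [Ky Py] & Hd).
    rewrite <- (Hr' y); auto. rewrite Cdist_sym; auto. }
  destruct (separation_lift P1 P2 (fun x => ~ B x)) as (phi & psi & Hphi & p1 & p2 & Hpsi & k1 & k2).
  - apply (C12 (fun t => t = F z)).
  - apply (C12 (fun t => t <> F z)).
  - intros x [_ h1] [_ h2]. auto.
  - exists z. split; auto.
  - exists w. split; auto.
  - intros x [n1 n2]. assert (n : ~ (A x /\ B x)).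
    { intro Kx. destruct (classic (F x = F z)); [apply n1|apply n2]; split; auto. }
    destruct (classic (B x)) as [b|b].
    + assert (nA : ~ A x) by tauto. destruct (closed_compl _ CA x nA) as [r [Hr Hr']].
      exists r. split; auto. intros y _ Hy. specialize (Hr' y Hy). destruct (HAB y); [tauto|].
      rewrite !indic_0; auto.
    + destruct (closed_compl _ CB x b) as [r [Hr Hr']].
      exists r. split; auto. intros y _ Hy. specialize (Hr' y Hy).
      rewrite !indic_1; auto.
  - intros x nb. split; intros [[_ b] _]; auto.
  - assert (E1 : psi z - phi z = psi w - phi w).
    { apply (connected_loc_const A (fun x => psi x - phi x)); auto.
      apply (loc_const_discrete _ _ 1); [lra| |].
      - intros x _. apply cont_minus; [apply Hpsi|apply Hphi].
      - intros x Ax. destruct (classic (B x)) as [b|b].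
        + destruct (k2 x) as [m E]; [tauto|]. destruct (classic (F x = F z)) as [e|e].
          * rewrite (p1 x) by (split; auto). exists m. lra.
          * rewrite (p2 x) by (split; auto). exists (m - 1)%Z. rewrite minus_IZR. lra.
        + destruct (k1 x b) as [m E]. exists m. lra. }
    assert (E2 : psi z = psi w).
    { apply (connected_loc_const B psi); auto.
      apply (loc_const_discrete _ _ 1); [lra|auto|].
      intros x Bx. destruct (k2 x) as [m E]; [tauto|]. exists m. lra. }
    rewrite (p1 z), (p2 w) in E1; [lra| |]; split; auto.
Qed.

(** * Proper arcs do not separate the plane *)

(** Separation is tested by locally constant functions on the complement, the form in which
    Mayer-Vietoris applies. *)
Definition unseparated (A : Cplx -> Prop) (p q : Cplx) : Prop :=
  forall F : Cplx -> R, loc_const (fun z => ~ A z) F -> F p = F q.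

Lemma unseparated_sub (A B : Cplx -> Prop) p q :
  (forall z, B z -> A z) -> unseparated A p q -> unseparated B p q.
Proof. intros H HA F HF. apply HA. apply (loc_const_sub (fun z => ~ B z)); auto. Qed.

Lemma loc_const_comp {T : Type} (A B : Cplx -> Prop) (F : Cplx -> T) (g : Cplx -> Cplx) :
  (forall z, B z -> A (g z)) -> (forall z, B z -> contCC g z) -> loc_const A F ->
  loc_const B (fun z => F (g z)).
Proof.
  intros H Hg HF z Bz. destruct (HF (g z) (H z Bz)) as [r [Hr Hr']].
  destruct (Hg z Bz r Hr) as [d [Hd Hd']]. exists d. split; auto.
Qed.

Lemma loc_const_post {S T : Type} (A : Cplx -> Prop) (F : Cplx -> S) (k : S -> T) :
  loc_const A F -> loc_const A (fun z => k (F z)).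
Proof. intros HF z Az. destruct (HF z Az) as [r [Hr Hr']]. exists r. split; auto. intros. f_equal. auto. Qed.

(** [inv0 0 = 0], because [/ 0 * 0 = 0]. *)
Definition inv0 (y : Cplx) : Cplx :=
  (fst y / (fst y * fst y + snd y * snd y), - snd y / (fst y * fst y + snd y * snd y)).

Lemma sqnorm_pos y : y <> (0, 0) -> 0 < fst y * fst y + snd y * snd y.
Proof.
  intro H. destruct y as [x y]; simpl. apply Rnot_le_lt. intro Hle. apply H.
  assert (E : Rsqr x + Rsqr y = 0) by (unfold Rsqr; nra).
  destruct (Rplus_sqr_eq_0 _ _ E). congruence.
Qed.

Lemma inv0_0 : inv0 (0, 0) = (0, 0).
Proof. unfold inv0; simpl. f_equal; unfold Rdiv; ring. Qed.

Lemma inv0_inv0 y : inv0 (inv0 y) = y.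
Proof.
  destruct (classic (y = (0, 0))) as [->|H]; [rewrite !inv0_0; reflexivity|].
  pose proof (sqnorm_pos y H). destruct y as [u v]; unfold inv0; simpl in *.
  f_equal; field; lra.
Qed.

Lemma inv0_neq0 y : y <> (0, 0) -> inv0 y <> (0, 0).
Proof. intros H E. apply H. rewrite <- (inv0_inv0 y), E. apply inv0_0. Qed.

Lemma inv0_norm y : Cnorm y * Cnorm (inv0 y) <= 1.
Proof.
  destruct (classic (y = (0, 0))) as [->|H].
  - rewrite inv0_0. rewrite <- Cdist_0, Cdist_refl. lra.
  - pose proof (sqnorm_pos y H). pose proof (Cnorm_nonneg y). pose proof (Cnorm_nonneg (inv0 y)).
    apply Rle_sq; [lra|].
    replace (Cnorm y * Cnorm (inv0 y) * (Cnorm y * Cnorm (inv0 y)))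
      with ((Cnorm y * Cnorm y) * (Cnorm (inv0 y) * Cnorm (inv0 y))) by ring.
    rewrite !Cnorm_sq. unfold inv0; simpl. right. field. lra.
Qed.

Lemma inv0_cont y : y <> (0, 0) -> contCC inv0 y.
Proof.
  intro H. pose proof (sqnorm_pos y H). unfold inv0.
  apply cont_pair; apply cont_div; try (apply cont_plus; apply cont_sqr); try lra;
  try apply cont_opp; try apply contCR_fst; apply contCR_snd.
Qed.

Definition recip (x z : Cplx) : Cplx := inv0 (Csub z x).
Definition recip_inv (x y : Cplx) : Cplx := Cadd x (inv0 y).

Lemma recip_K x z : recip_inv x (recip x z) = z.
Proof. unfold recip, recip_inv. rewrite inv0_inv0. unfold Cadd, Csub. destruct z; simpl. f_equal; ring. Qed.

Lemma recip_inv_0 x y : recip_inv x y = x -> y = (0, 0).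
Proof.
  intro E. rewrite <- (inv0_inv0 y). rewrite <- inv0_0. f_equal.
  pose proof (f_equal fst E) as E1. pose proof (f_equal snd E) as E2.
  change (fst x + fst (inv0 y) = fst x) in E1. change (snd x + snd (inv0 y) = snd x) in E2.
  rewrite (surjective_pairing (inv0 y)). f_equal; lra.
Qed.

Lemma recip_cont x z : z <> x -> contCC (recip x) z.
Proof.
  intro H. apply (cont_comp _ Cdist _ inv0).
  - apply cont_pair; (apply cont_minus; [|apply cont_const, Rdist_refl]); [apply contCR_fst|apply contCR_snd].
  - apply inv0_cont. intro E. apply H. unfold Csub in E. injection E as E1 E2.
    destruct z, x; simpl in *. f_equal; lra.
Qed.

Lemma recip_inv_cont x y : y <> (0, 0) -> contCC (recip_inv x) y.
Proof.
  intro H. pose proof (inv0_cont y H) as Hc. unfold recip_inv, Cadd.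
  apply cont_pair; (apply cont_plus; [apply cont_const, Rdist_refl|]); [apply cont_fst|apply cont_snd]; exact Hc.
Qed.

(** Sending the common point [x] to infinity makes [A1] and [A2] disjoint. The image [0] of infinity
    is added to the image of [A2]. *)
Lemma unseparated_union (A1 A2 : Cplx -> Prop) x p q :
  closed A1 -> closed A2 -> bounded A1 -> A1 x -> A2 x -> (forall z, A1 z -> A2 z -> z = x) ->
  ~ A1 p -> ~ A2 p -> ~ A1 q -> ~ A2 q ->
  unseparated A1 p q -> unseparated A2 p q -> unseparated (fun z => A1 z \/ A2 z) p q.
Proof.
  intros C1 C2 [M HM] x1 x2 Hx p1 p2 q1 q2 H1 H2 F HF.
  set (P1 := fun y => y <> (0,0) /\ A1 (recip_inv x y)).
  set (P2 := fun y => A2 (recip_inv x y)).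
  assert (Hcl : forall (A : Cplx -> Prop) y, closed A -> y <> (0, 0) ->
             closure (fun v => A (recip_inv x v)) y -> A (recip_inv x y)).
  { intros A y CA Hy Hc. apply CA. intros e He. destruct (recip_inv_cont x y Hy e He) as [d [Hd Hd']].
    destruct (Hc d Hd) as [w [Hw Hwd]]. exists (recip_inv x w). split; auto.
    rewrite Cdist_sym. apply Hd'. rewrite Cdist_sym. auto. }
  assert (jx : recip_inv x (0, 0) = x).
  { unfold recip_inv. rewrite inv0_0. unfold Cadd; destruct x; simpl. f_equal; ring. }
  destruct (mayer_vietoris P1 P2 (fun y => F (recip_inv x y) = F p)) as (alpha & beta & Ha & Hb & E).
  - intros y Hy. assert (y <> (0, 0)).
    (* Since [A1] is bounded, its image under the inversion stays away from 0, the image of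
       infinity; [e] is a lower bound for the distance. *)
    { intros ->. set (e := / (1 + M + Cnorm x)).
      assert (Hpos : 0 < 1 + M + Cnorm x).
      { pose proof (HM x x1). pose proof (Cnorm_nonneg x). lra. }
      assert (He : e > 0) by (apply Rinv_0_lt_compat; auto).
      destruct (Hy e He) as (w & [Hw HA] & Hwd).
      rewrite Cdist_sym, Cdist_0 in Hwd.
      pose proof (HM _ HA) as HMw. pose proof (inv0_norm (inv0 w)) as Hn. rewrite inv0_inv0 in Hn.
      assert (Hle : Cnorm (inv0 w) <= M + Cnorm x).
      { pose proof (Cnorm_triangle (recip_inv x w) (Csub (0,0) x)) as Ht.
        replace (Cadd (recip_inv x w) (Csub (0,0) x)) with (inv0 w) in Ht.
        - change (Cnorm (Csub (0,0) x)) with (Cdist (0,0) x) in Ht. rewrite Cdist_sym, Cdist_0 in Ht. lra.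
        - unfold recip_inv, Cadd, Csub. rewrite (surjective_pairing (inv0 w)) at 1. simpl. f_equal; ring. }
      assert (0 < Cnorm w). { rewrite <- Cdist_0. apply Cdist_pos; auto. }
      pose proof (Cnorm_nonneg (inv0 w)).
      destruct (Req_dec (Cnorm (inv0 w)) 0) as [E0|E0].
      - apply (inv0_neq0 w Hw). apply Cdist_eq0. rewrite Cdist_0. lra.
      - assert (Hn2 : Cnorm w * Cnorm (inv0 w) = 1).
        { pose proof (sqnorm_pos w Hw).
          assert (Hs : (Cnorm w * Cnorm (inv0 w)) * (Cnorm w * Cnorm (inv0 w)) = 1).
          { replace (Cnorm w * Cnorm (inv0 w) * (Cnorm w * Cnorm (inv0 w)))
              with ((Cnorm w * Cnorm w) * (Cnorm (inv0 w) * Cnorm (inv0 w))) by ring.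
            rewrite !Cnorm_sq. unfold inv0; simpl. field. lra. }
          assert (0 <= Cnorm w * Cnorm (inv0 w)) by nra. nra. }
        assert (Cnorm w * (1 + M + Cnorm x) < 1).
        { apply (Rmult_lt_compat_r (1 + M + Cnorm x)) in Hwd; auto. unfold e in Hwd. rewrite Rinv_l in Hwd; lra. }
        nra. }
    split; auto. apply (Hcl A1); auto. eapply closure_mono; try exact Hy. intros w [_ Hw]; exact Hw.
  - intros y Hy. destruct (classic (y = (0, 0))) as [->|n].
    + unfold P2. rewrite jx. exact x2.
    + apply (Hcl A2); auto.
  - intros y [n h1] h2. apply n. apply (recip_inv_0 x). apply Hx; auto.
  - apply (loc_const_comp (fun z => ~ (A1 z \/ A2 z)) _ (indic (fun z => F z = F p)) (recip_inv x)).
    + intros y [n1 n2] [h|h]; [|auto]. apply n1. split; auto. intros ->. apply n2. unfold P2. rewrite jx. auto.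
    + intros y [n1 n2]. apply recip_inv_cont. intros ->. apply n2. unfold P2. rewrite jx. auto.
    + apply (loc_const_post _ F (fun t => if excluded_middle_informative (t = F p) then 1 else 0)). exact HF.
  - assert (Hne : forall A : Cplx -> Prop, A x -> forall z, ~ A z -> z <> x) by (intros A Ax z n ->; auto).
    (* Pulled back to the complements of [A1] and [A2], the functions [alpha] and [beta] do not
       distinguish [p] from [q], hence neither does their difference. *)
    assert (Ea : alpha (recip x p) = alpha (recip x q)).
    { apply (H1 (fun z => alpha (recip x z))).
      apply (loc_const_comp (fun z => ~ P1 z)); auto.
      - intros z n [_ h]. rewrite recip_K in h. auto.
      - intros z n. apply recip_cont, (Hne A1); auto. }
    assert (Eb : beta (recip x p) = beta (recip x q)).
    { apply (H2 (fun z => beta (recip x z))).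
      apply (loc_const_comp (fun z => ~ P2 z)); auto.
      - intros z n h. unfold P2 in h. rewrite recip_K in h. auto.
      - intros z n. apply recip_cont, (Hne A2); auto. }
    assert (E2 : forall z, ~ A1 z -> ~ A2 z -> indic (fun y => F (recip_inv x y) = F p) (recip x z)
                    = alpha (recip x z) - beta (recip x z)).
    { intros z n1 n2. apply E.
      - intros [_ h]. rewrite recip_K in h. auto.
      - intro h. unfold P2 in h. rewrite recip_K in h. auto. }
    assert (E3 : indic (fun y => F (recip_inv x y) = F p) (recip x p) = indic (fun y => F (recip_inv x y) = F p) (recip x q)).
    { rewrite !E2 by auto. lra. }
    pose proof (indic_eq _ _ _ E3) as E4. simpl in E4. rewrite !recip_K in E4. symmetry. auto.
Qed.

Lemma seg_closed z w : closed (fun x => exists t, 0 <= t <= 1 /\ seg z w t = x).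
Proof.
  apply proper_image_closed.
  - apply seg_cont.
  - intros t Ht. split; apply Rnot_lt_le; intro h.
    + destruct (Ht (0 - t)) as [s [Hs Hd]]; [lra|]. apply Rabs_def2 in Hd. lra.
    + destruct (Ht (t - 1)) as [s [Hs Hd]]; [lra|]. apply Rabs_def2 in Hd. lra.
  - intro M. exists 1. intros t Ht _. rewrite Rabs_pos_eq; lra.
Qed.

(** The determinant says that [x] is off the line through [z] and [w], and the segment is closed. *)
Lemma seg_avoids z w x :
  (fst z - fst x) * (snd w - snd x) - (snd z - snd x) * (fst w - fst x) <> 0 ->
  exists rho, rho > 0 /\ forall t, 0 <= t <= 1 -> rho <= Cdist (seg z w t) x.
Proof.
  intro H. destruct (closed_compl _ (seg_closed z w) x) as [r [Hr Hr']].
  - intros (t & _ & <-). apply H. unfold seg; simpl. ring.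
  - exists r. split; auto. intros t Ht. apply Rnot_lt_le. intro Hd. apply (Hr' _ Hd). exists t. auto.
Qed.

(** One or two segments join [p] to [q] outside a whole disc around [x]. *)
Lemma unseparated_small p q x :
  p <> x -> q <> x ->
  exists rho, rho > 0 /\ forall A : Cplx -> Prop, (forall z, A z -> Cdist z x < rho) -> unseparated A p q.
Proof.
  intros Hp Hq.
  assert (Hm : exists m rho, rho > 0 /\ (forall t, 0 <= t <= 1 -> rho <= Cdist (seg p m t) x) /\
                 (forall t, 0 <= t <= 1 -> rho <= Cdist (seg m q t) x)).
  { destruct (Req_dec ((fst p - fst x) * (snd q - snd x) - (snd p - snd x) * (fst q - fst x)) 0) as [E|E].
    (* If [p], [q] and [x] are collinear, detour through [p] rotated by a quarter turn about [x]. *)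
    - set (m := (fst x - (snd p - snd x), snd x + (fst p - fst x))).
      assert (np : 0 < (fst p - fst x) * (fst p - fst x) + (snd p - snd x) * (snd p - snd x)).
      { rewrite <- Cdist_sq. pose proof (Cdist_pos _ _ Hp). nra. }
      assert (nq : 0 < (fst q - fst x) * (fst q - fst x) + (snd q - snd x) * (snd q - snd x)).
      { rewrite <- Cdist_sq. pose proof (Cdist_pos _ _ Hq). nra. }
      destruct (seg_avoids p m x) as [r1 [Hr1 H1]]; [unfold m; simpl; nra|].
      destruct (seg_avoids m q x) as [r2 [Hr2 H2]].
      { unfold m; simpl. intro E2.
        set (a := fst p - fst x) in *. set (b := snd p - snd x) in *.
        set (c := fst q - fst x) in *. set (d := snd q - snd x) in *.
        assert (E3 : a * c + b * d = 0) by lra.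
        assert ((a * a + b * b) * (c * c + d * d) = (a * c + b * d) * (a * c + b * d) + (a * d - b * c) * (a * d - b * c)) by ring.
        rewrite E, E3 in H. nra. }
      exists m, (Rmin r1 r2). split; [apply Rmin_glb_lt; auto|].
      split; intros t Ht; [specialize (H1 t Ht)|specialize (H2 t Ht)].
      + pose proof (Rmin_l r1 r2). lra.
      + pose proof (Rmin_r r1 r2). lra.
    - destruct (seg_avoids p q x E) as [r1 [Hr1 H1]]. pose proof (Cdist_pos _ _ Hq) as Hq'.
      exists q, (Rmin r1 (Cdist q x)). split; [apply Rmin_glb_lt; auto|].
      split; intros t Ht.
      + specialize (H1 t Ht). pose proof (Rmin_l r1 (Cdist q x)). lra.
      + replace (seg q q t) with q by (unfold seg; destruct q; simpl; f_equal; ring). apply Rmin_r. }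
  destruct Hm as (m & rho & Hr & H1 & H2). exists rho. split; auto.
  intros A HA F HF. transitivity (F m).
  - apply (seg_loc_const (fun z => ~ A z)); auto. intros t Ht h. specialize (H1 t Ht). specialize (HA _ h). lra.
  - apply (seg_loc_const (fun z => ~ A z)); auto. intros t Ht h. specialize (H2 t Ht). specialize (HA _ h). lra.
Qed.

Section ProperRay.
Variable r : R -> Cplx.
Hypothesis r_cont : forall t, contRC r t.
Hypothesis r_inj : forall s t, 0 <= s -> 0 <= t -> r s = r t -> s = t.
Hypothesis r_proper : forall M, exists B, forall t, 0 <= t -> Cnorm (r t) <= M -> t <= B.

Let arc s t (z : Cplx) : Prop := exists x, s <= x <= t /\ r x = z.
Let tail s (z : Cplx) : Prop := exists x, s <= x /\ r x = z.

Lemma arc_closed s t : closed (arc s t).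
Proof.
  apply proper_image_closed; auto.
  - intros x Hx. split; apply Rnot_lt_le; intro h.
    + destruct (Hx (s - x)) as [y [Hy Hd]]; [lra|]. apply Rabs_def2 in Hd. lra.
    + destruct (Hx (x - t)) as [y [Hy Hd]]; [lra|]. apply Rabs_def2 in Hd. lra.
  - intro M. exists (Rabs s + Rabs t). intros x Hx _.
    pose proof (Rle_abs s). pose proof (Rle_abs t). pose proof (Rle_abs (- s)). pose proof (Rle_abs (- t)).
    rewrite Rabs_Ropp in *. apply Rabs_le. lra.
Qed.

Lemma tail_closed s : 0 <= s -> closed (tail s).
Proof.
  intro Hs. apply proper_image_closed; auto.
  - intros x Hx. apply Rnot_lt_le; intro h.
    destruct (Hx (s - x)) as [y [Hy Hd]]; [lra|]. apply Rabs_def2 in Hd. lra.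
  - intro M. destruct (r_proper M) as [B HB]. exists B. intros t Ht HM. rewrite Rabs_pos_eq by lra.
    apply HB; auto. lra.
Qed.

Lemma arc_bounded s t : bounded (arc s t).
Proof.
  apply NNPP. intro Hn.
  assert (H : forall n : nat, exists x, s <= x <= t /\ INR n < Cnorm (r x)).
  { intro n. apply NNPP. intro Hn2. apply Hn. exists (INR n). intros z (x & Hx & <-).
    apply Rnot_lt_le. intro h. apply Hn2. eauto. }
  set (u := fun n => proj1_sig (constructive_indefinite_description _ (H n))).
  assert (Hu : forall n, s <= u n <= t /\ INR n < Cnorm (r (u n))).
  { intro n. unfold u. destruct constructive_indefinite_description as [q Hq]. exact Hq. }
  destruct (cluster_R_exists u (Rabs s + Rabs t)) as [l Hl].
  { intro n. destruct (Hu n) as [h _].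
    pose proof (Rle_abs s). pose proof (Rle_abs t). pose proof (Rle_abs (- s)). pose proof (Rle_abs (- t)).
    rewrite Rabs_Ropp in *. apply Rabs_le. lra. }
  destruct (r_cont l 1) as [d [Hd Hd']]; [lra|].
  destruct (INR_unbounded (Cnorm (r l) + 1)) as [N HN].
  destruct (Hl d Hd N) as [n [Hn1 Hn2]]. specialize (Hd' _ Hn2). destruct (Hu n) as [_ Hun].
  apply le_INR in Hn1. pose proof (Cnorm_dist (r (u n)) (r l)). lra.
Qed.

(** Short arcs do not separate [p] from [q], and neither does a far tail, which misses a disc
    containing both. By [unseparated_union] arcs can be concatenated, so the set of [t] for which
    the arc from 0 to [t] does not separate is clopen in the parameter interval. *)
Lemma ray_unseparated p q : ~ tail 0 p -> ~ tail 0 q -> unseparated (tail 0) p q.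
Proof.
  intros Hp Hq.
  assert (HT : exists T, 0 <= T /\ unseparated (tail T) p q).
  { destruct (r_proper (Rmax (Cnorm p) (Cnorm q) + 1)) as [B HB]. exists (Rmax 0 (B + 1)).
    split; [apply Rmax_l|]. intros F HF. apply (seg_loc_const (fun z => ~ tail (Rmax 0 (B + 1)) z)); auto.
    intros t Ht (x & Hx & E).
    pose proof (Rmax_l 0 (B + 1)). pose proof (Rmax_r 0 (B + 1)).
    assert (Hd : Cdist (seg p q t) (0,0) < Rmax (Cnorm p) (Cnorm q) + 1).
    { apply seg_dist_ball; auto; rewrite Cdist_0.
      - pose proof (Rmax_l (Cnorm p) (Cnorm q)). lra.
      - pose proof (Rmax_r (Cnorm p) (Cnorm q)). lra. }
    rewrite Cdist_0, <- E in Hd. assert (x <= B) by (apply HB; lra). lra. }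
  destruct HT as (T & HT0 & HT).
  assert (Harc : forall s t z, 0 <= s -> ~ tail 0 z -> ~ arc s t z).
  { intros s t z Hs Hz (x & Hx & E). apply Hz. exists x. split; auto. lra. }
  assert (Hloc : forall t0, 0 <= t0 -> exists d, d > 0 /\ forall s t, 0 <= s -> t0 - d < s -> t < t0 + d -> unseparated (arc s t) p q).
  { intros t0 Ht0. destruct (unseparated_small p q (r t0)) as [rho [Hrho H]].
    - intro E. apply Hp. exists t0. auto.
    - intro E. apply Hq. exists t0. auto.
    - destruct (r_cont t0 rho Hrho) as [d [Hd Hd']]. exists d. split; auto.
      intros s t Hs hs ht. apply H. intros z (x & Hx & <-). apply Hd'. apply Rabs_def1; lra. }
  assert (Hadd : forall s t, 0 <= s <= t -> unseparated (arc 0 s) p q -> unseparated (arc s t) p q -> unseparated (arc 0 t) p q).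
  { intros s t Hst h1 h2. apply (unseparated_sub (fun z => arc 0 s z \/ arc s t z)).
    - intros z (x & Hx & E). destruct (Rle_dec x s); [left|right]; exists x; split; auto; lra.
    - apply (unseparated_union _ _ (r s)); auto; try (apply Harc; auto; lra).
      + apply arc_closed. + apply arc_closed. + apply arc_bounded.
      + exists s. split; auto; lra. + exists s. split; auto; lra.
      + intros z (x & Hx & E) (y & Hy & E2). assert (x = y) by (apply r_inj; try lra; congruence).
        assert (x = s) by lra. congruence. }
  assert (H0T : unseparated (arc 0 T) p q).
  { set (G := fun t => if excluded_middle_informative (unseparated (arc 0 t) p q) then 1 else 0).
    assert (HG : forall s t, unseparated (arc 0 s) p q <-> unseparated (arc 0 t) p q -> G s = G t).
    { intros s t h. unfold G. do 2 destruct excluded_middle_informative; tauto. }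
    assert (E : G 0 = G T).
    { apply interval_loc_const; auto. intros t0 Ht0. destruct (Hloc t0) as [d [Hd Hd']]; [lra|].
      exists d. split; auto. intros s Hs Hsd. apply Rabs_def2 in Hsd.
      assert (Hmono : forall u v, 0 <= u -> u <= v -> t0 - d < u -> v < t0 + d ->
               (unseparated (arc 0 u) p q <-> unseparated (arc 0 v) p q)).
      { intros u v hu huv h1 h2. split; intro h.
        - apply (Hadd u v); auto.
        - apply (unseparated_sub (arc 0 v)); auto. intros z (x & Hx & Ez). exists x. split; auto; lra. }
      apply HG. destruct (Rle_dec s t0).
      - apply Hmono; lra.
      - symmetry. apply Hmono; lra. }
    unfold G in E. destruct (excluded_middle_informative (unseparated (arc 0 T) p q)); auto.
    destruct excluded_middle_informative as [h|h]; [lra|]. exfalso. apply h.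
    destruct (Hloc 0) as [d [Hd Hd']]; [lra|]. apply Hd'; lra. }
  apply (unseparated_sub (fun z => arc 0 T z \/ tail T z)).
  - intros z (x & Hx & E). destruct (Rle_dec x T); [left|right]; exists x; split; auto; lra.
  - assert (Htl : forall z, ~ tail 0 z -> ~ tail T z).
    { intros z Hz (x & Hx & E). apply Hz. exists x. split; auto; lra. }
    apply (unseparated_union _ _ (r T)); auto; try (apply Harc; auto; lra).
    + apply arc_closed. + apply tail_closed; auto. + apply arc_bounded.
    + exists T. split; auto; lra. + exists T. split; auto; lra.
    + intros z (x & Hx & E) (y & Hy & E2). assert (x = y) by (apply r_inj; try lra; congruence).
      assert (x = T) by lra. congruence.
Qed.
End ProperRay.

(** * The two sides of a curve from left to right infinity *)

Lemma polar_turn rho t u v :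
  0 < rho -> u = scale rho (cis t) -> 0 < fst u * fst v + snd u * snd v ->
  exists rho', 0 < rho' /\ v = scale rho' (cis (t + turn u v)).
Proof.
  intros Hr -> HD.
  set (D := fst (scale rho (cis t)) * fst v + snd (scale rho (cis t)) * snd v) in *.
  set (E := fst (scale rho (cis t)) * snd v - snd (scale rho (cis t)) * fst v).
  set (n := sqrt (D * D + E * E)).
  assert (Hn2 : n * n = D * D + E * E) by (apply sqrt_sqrt; nra).
  assert (Hn : 0 < n) by (apply sqrt_lt_R0; nra).
  pose proof (sin2_cos2 t) as h. unfold Rsqr in h.
  assert (Ht : (D / n, E / n) = cis (turn (scale rho (cis t)) v)).
  { rewrite (atan_cis (D / n) (E / n)).
    - unfold turn. fold D. fold E. do 2 f_equal. field. lra.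
    - apply Rmult_lt_0_compat; [auto|apply Rinv_0_lt_compat; auto].
    - replace (D / n * (D / n) + E / n * (E / n)) with ((D * D + E * E) / (n * n)) by (field; lra).
      rewrite Hn2. field. nra. }
  pose proof (f_equal fst Ht) as Hc. pose proof (f_equal snd Ht) as Hs. simpl in Hc, Hs.
  exists (n / rho). split; [apply Rmult_lt_0_compat; [auto|apply Rinv_0_lt_compat; auto]|].
  unfold cis at 1. rewrite cos_plus, sin_plus, <- Hc, <- Hs. unfold D, E, scale; simpl.
  destruct v as [x y]; simpl. f_equal.
  - transitivity ((sin t * sin t + cos t * cos t) * x); [rewrite h; ring|field; lra].
  - transitivity ((sin t * sin t + cos t * cos t) * y); [rewrite h; ring|field; lra].
Qed.

Lemma dot_pos_near u v : Cdist v u < Cnorm u -> 0 < fst u * fst v + snd u * snd v.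
Proof.
  intro H. pose proof (Cnorm_sq u) as Hu. pose proof (Cnorm_sq v) as Hv. pose proof (Cdist_sq v u) as Hd.
  pose proof (Cdist_nonneg v u). pose proof (Cnorm_nonneg u).
  assert (Cdist v u * Cdist v u < Cnorm u * Cnorm u) by nra.
  pose proof (Rle_0_sqr (fst v)) as h1. pose proof (Rle_0_sqr (snd v)) as h2. unfold Rsqr in *. nra.
Qed.

Lemma turn_bound u v : - (PI/2) < turn u v < PI/2.
Proof. unfold turn. match goal with |- context [atan ?x] => pose proof (atan_bound x) end. lra. Qed.

Lemma avoid_value (th : R -> R) c :
  (forall x, contRR th x) -> (forall x, th x <> c) -> forall s t, th s < c -> th t < c.
Proof.
  intros Hc Hne.
  assert (H : forall s t, s <= t -> (if Rlt_dec (th s) c then 1 else 0) = (if Rlt_dec (th t) c then 1 else 0)).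
  { intros s t Hst. apply (interval_loc_const (fun x => if Rlt_dec (th x) c then 1 else 0)); auto.
    intros x _. destruct (Hc x (Rabs (th x - c))) as [d [Hd Hd']].
    - apply Rabs_pos_lt. specialize (Hne x). lra.
    - exists d. split; auto. intros y _ Hy. specialize (Hd' y Hy). unfold Rdist in Hd'. specialize (Hne x).
      revert Hd'. unfold Rabs. repeat destruct Rcase_abs; repeat destruct Rlt_dec; intros; lra. }
  intros s t Hs. destruct (Rle_dec s t) as [h|h].
  - specialize (H s t h). destruct (Rlt_dec (th s) c); [|lra]. destruct (Rlt_dec (th t) c); lra.
  - specialize (H t s ltac:(lra)). destruct (Rlt_dec (th s) c); [|lra]. destruct (Rlt_dec (th t) c); lra.
Qed.

Lemma avoid_value' (th : R -> R) c :
  (forall x, contRR th x) -> (forall x, th x <> c) -> forall s t, c < th s -> c < th t.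
Proof.
  intros Hc Hne s t Hs. apply Ropp_lt_cancel.
  apply (avoid_value (fun x => - th x) (- c)) with (s := s).
  - intro x. apply cont_opp, Hc.
  - intros x E. apply (Hne x). lra.
  - lra.
Qed.

Lemma cis_2PI t k : cis (t + 2 * PI * IZR k) = cis t.
Proof.
  unfold cis. replace (2 * PI * IZR k) with (2 * IZR k * PI) by ring.
  assert (Hp : forall n : nat, cos (t + 2 * INR n * PI) = cos t /\ sin (t + 2 * INR n * PI) = sin t)
    by (intro n; split; [apply cos_period|apply sin_period]).
  assert (Hm : forall n : nat, cos (t - 2 * INR n * PI) = cos t /\ sin (t - 2 * INR n * PI) = sin t).
  { intro n. pose proof (cos_period (t - 2 * INR n * PI) n) as h1.
    pose proof (sin_period (t - 2 * INR n * PI) n) as h2.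
    replace (t - 2 * INR n * PI + 2 * INR n * PI) with t in * by ring. auto. }
  destruct (Z_le_dec 0 k) as [h|h].
  - replace k with (Z.of_nat (Z.to_nat k)) by lia. rewrite <- INR_IZR_INZ. destruct (Hp (Z.to_nat k)) as [-> ->]. reflexivity.
  - replace k with (- Z.of_nat (Z.to_nat (- k)))%Z by lia. rewrite opp_IZR, <- INR_IZR_INZ.
    replace (t + 2 * - INR (Z.to_nat (- k)) * PI) with (t - 2 * INR (Z.to_nat (- k)) * PI) by ring.
    destruct (Hm (Z.to_nat (- k))) as [-> ->]. reflexivity.
Qed.

Lemma angle_in_window t : 0 < cos t -> exists k : Z, Rabs (t - 2 * PI * IZR k) < PI / 2.
Proof.
  intro H. pose proof (sin2_cos2 t) as h. unfold Rsqr in h.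
  assert (E : cis t = cis (atan (sin t / cos t))) by (apply atan_cis; lra).
  destruct (cis_eq _ _ E) as [k Hk]. exists k. pose proof (atan_bound (sin t / cos t)).
  apply Rabs_def1; lra.
Qed.

Section Sides.
Variable L : R -> Cplx.
Hypothesis L_cont : forall x, contRC L x.
Hypothesis L_left : forall M, exists X, forall x, x <= X -> fst (L x) < M.
Hypothesis L_right : forall M, exists X, forall x, X <= x -> M < fst (L x).

Definition on_curve (z : Cplx) : Prop := exists x, L x = z.

Lemma curve_params_bounded M : exists B, forall x, Rabs (fst (L x)) <= M -> Rabs x <= B.
Proof.
  destruct (L_left (- M)) as [X1 H1]. destruct (L_right M) as [X2 H2].
  exists (Rabs X1 + Rabs X2). intros x Hx.
  assert (X1 < x). { apply Rnot_le_lt. intro h. apply H1 in h. revert Hx. unfold Rabs. destruct Rcase_abs; lra. }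
  assert (x < X2). { apply Rnot_le_lt. intro h. apply H2 in h. revert Hx. unfold Rabs. destruct Rcase_abs; lra. }
  pose proof (Rle_abs X2). pose proof (Rle_abs (- X1)). rewrite Rabs_Ropp in *. apply Rabs_le.
  pose proof (Rabs_pos X1). pose proof (Rabs_pos X2). lra.
Qed.

Lemma subcurve_closed (X : R -> Prop) :
  (forall t, (forall e, e > 0 -> exists s, X s /\ Rabs (s - t) < e) -> X t) ->
  closed (fun z => exists t, X t /\ L t = z).
Proof.
  intro HX. apply proper_image_closed; auto. intro M.
  destruct (curve_params_bounded M) as [B HB]. exists B. intros t _ Ht. apply HB.
  pose proof (Cnorm_fst (L t)). lra.
Qed.

Lemma on_curve_closed : closed on_curve.
Proof.
  intros z Hz. destruct (subcurve_closed (fun _ => True)) with (z := z) as (t & _ & E).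
  - auto.
  - eapply closure_mono; try exact Hz. intros w [x <-]. exists x. auto.
  - exists t. auto.
Qed.

(** A continuous argument of [w - L x]. Towards the left end [w] is to the right of the curve, which
    allows the normalisation near 0. *)
Definition arg_lift (w : Cplx) (th : R -> R) : Prop :=
  (forall x, contRR th x) /\
  (forall x, exists rho, 0 < rho /\ Csub w (L x) = scale rho (cis (th x))) /\
  (exists x0, forall x, x <= x0 -> - (PI/2) < th x < PI/2).

(** At the right end [w] is to the left of the curve, so the argument is near an odd multiple of pi.
    A point above the curve sees the total change +pi. *)
Definition above (w : Cplx) : Prop :=
  exists th, arg_lift w th /\ exists x1, forall x, x1 <= x -> PI/2 < th x < 3 * (PI/2).

Lemma arg_lift_exists w : ~ on_curve w -> exists th, arg_lift w th.
Proof.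
  intro Hw.
  assert (Hne : forall x, Csub w (L x) <> (0, 0)).
  { intros x E. apply Hw. exists x. unfold Csub in E. injection E as E1 E2. destruct w, (L x); simpl in *. f_equal; lra. }
  assert (Hpos : forall x, 0 < Cnorm (Csub w (L x))).
  { intro x. rewrite <- Cdist_0. apply Cdist_pos, Hne. }
  assert (Hv : forall z, contCC (fun z => Csub w (L (fst z))) z).
  { intro z. assert (Hl : contCC (fun z => L (fst z)) z) by (apply (cont_comp _ Rdist _ L); [apply contCR_fst|apply L_cont]).
    apply cont_pair; (apply cont_minus; [apply cont_const, Rdist_refl|]); [apply cont_fst|apply cont_snd]; exact Hl. }
  (* [circle_lift] concerns maps on the plane, so the direction is extended to be independent of the
     second coordinate. *)
  destruct (circle_lift (fun z => scale (/ Cnorm (Csub w (L (fst z)))) (Csub w (L (fst z))))) as [psi Hpsi].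
  - intro z. specialize (Hpos (fst z)).
    apply cont_pair; apply cont_mult; try (apply cont_inv; [apply cont_Cnorm, Hv|lra]);
    [apply cont_fst|apply cont_snd]; apply Hv.
  - intro z. specialize (Hpos (fst z)). unfold unit_vec, scale. cbn [fst snd].
    set (v := Csub w (L (fst z))) in *. pose proof (Cnorm_sq v) as Hs.
    transitivity ((fst v * fst v + snd v * snd v) / (Cnorm v * Cnorm v)); [field; lra|].
    rewrite <- Hs. field. lra.
  - set (th := fun x => psi (x, 0)).
    assert (Hc : forall x, contRR th x).
    { intro x. apply (cont_comp _ Cdist _ psi (fun x => (x, 0))); [|apply Hpsi].
      apply cont_pair; [apply cont_id|apply cont_const, Rdist_refl]. }
    assert (Hp : forall x, Csub w (L x) = scale (Cnorm (Csub w (L x))) (cis (th x))).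
    { intro x. destruct (Hpsi (x, 0)) as [_ E]. simpl in E. unfold th. rewrite <- E. specialize (Hpos x).
      unfold scale. cbn [fst snd]. rewrite (surjective_pairing (Csub w (L x))) at 1. f_equal; field; lra. }
    destruct (L_left (fst w)) as [x0 Hx0].
    assert (Hcos : forall x, x <= x0 -> 0 < cos (th x)).
    { intros x Hx. specialize (Hx0 x Hx). pose proof (f_equal fst (Hp x)) as E. unfold scale, cis in E. cbn [fst snd] in E.
      change (fst (Csub w (L x))) with (fst w - fst (L x)) in E. specialize (Hpos x). nra. }
    destruct (angle_in_window (th x0) (Hcos x0 (Rle_refl _))) as [k Hk].
    exists (fun x => th x - 2 * PI * IZR k). split; [|split].
    + intro x. apply cont_minus; [apply Hc|apply cont_const, Rdist_refl].
    + intro x. exists (Cnorm (Csub w (L x))). split; auto. rewrite (Hp x) at 1. f_equal.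
      rewrite <- (cis_2PI (th x - 2 * PI * IZR k) k). f_equal. ring.
    + exists x0. intros x Hx. apply Rabs_def2 in Hk.
      (* Freezing the argument to the right of [x0] keeps its cosine positive on the whole line, as
         [avoid_value] requires. *)
      set (th1 := fun y => th (Rmin y x0) - 2 * PI * IZR k).
      assert (Hc1 : forall y, contRR th1 y).
      { intro y. apply cont_minus; [|apply cont_const, Rdist_refl].
        apply (cont_comp _ Rdist _ th (fun y => Rmin y x0)); [|apply Hc].
        intros e He. exists e. split; auto. intros v Hv'. unfold Rdist in *. unfold Rmin.
        revert Hv'. repeat destruct Rle_dec; unfold Rabs; repeat destruct Rcase_abs; lra. }
      assert (Hcos1 : forall y, 0 < cos (th1 y)).
      { intro y. unfold th1. pose proof (cis_2PI (th (Rmin y x0) - 2 * PI * IZR k) k) as E.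
        replace (th (Rmin y x0) - 2 * PI * IZR k + 2 * PI * IZR k) with (th (Rmin y x0)) in E by ring.
        pose proof (f_equal fst E) as E1. simpl in E1. rewrite <- E1. apply Hcos, Rmin_r. }
      assert (E0 : th1 x0 = th x0 - 2 * PI * IZR k) by (unfold th1; rewrite Rmin_left; lra).
      assert (Ex : th1 x = th x - 2 * PI * IZR k) by (unfold th1; rewrite Rmin_left; lra).
      rewrite <- Ex. split.
      * apply (avoid_value' th1) with (s := x0); auto; [|lra].
        intros y Ey. specialize (Hcos1 y). rewrite Ey, cos_neg, cos_PI2 in Hcos1. lra.
      * apply (avoid_value th1) with (s := x0); auto; [|lra].
        intros y Ey. specialize (Hcos1 y). rewrite Ey, cos_PI2 in Hcos1. lra.
Qed.

Lemma arg_lift_fst w th x : arg_lift w th -> (fst (L x) < fst w <-> 0 < cos (th x)) /\ (fst w < fst (L x) <-> cos (th x) < 0).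
Proof.
  intros (_ & p & _). destruct (p x) as (r & Hr & E). pose proof (f_equal fst E) as E1. simpl in E1.
  split; split; intro; nra.
Qed.

Lemma arg_lift_snd w th x : arg_lift w th -> (snd (L x) < snd w <-> 0 < sin (th x)) /\ (snd w < snd (L x) <-> sin (th x) < 0).
Proof.
  intros (_ & p & _). destruct (p x) as (r & Hr & E). pose proof (f_equal snd E) as E1. simpl in E1.
  split; split; intro; nra.
Qed.

(** The argument changes by [turn], less than pi/2 in modulus. At both ends this leaves an interval
    of length 2 pi, which the sign of the cosine narrows to the required window. *)
Lemma above_near w w' : (forall x, Cdist w' w < Cdist w (L x)) -> above w -> above w'.
Proof.
  intros Hd (th & Hth & x1 & Hx1).
  assert (Hdot : forall x, 0 < fst (Csub w (L x)) * fst (Csub w' (L x)) + snd (Csub w (L x)) * snd (Csub w' (L x))).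
  { intro x. apply dot_pos_near. specialize (Hd x). unfold Cdist in *.
    replace (Csub (Csub w' (L x)) (Csub w (L x))) with (Csub w' w); auto.
    unfold Csub; simpl. f_equal; ring. }
  set (th' := fun x => th x + turn (Csub w (L x)) (Csub w' (L x))).
  assert (Hc' : forall x, contRR th' x).
  { intro x. apply cont_plus; [apply Hth|]. apply cont_turn; [| |apply Hdot];
    (apply cont_pair; (apply cont_minus; [apply cont_const, Rdist_refl|]); [apply cont_fst|apply cont_snd]; apply L_cont). }
  assert (Hp' : forall x, exists rho, 0 < rho /\ Csub w' (L x) = scale rho (cis (th' x))).
  { intro x. destruct Hth as (_ & p & _). destruct (p x) as (r & Hr & E).
    apply (polar_turn r); auto. }
  destruct (L_left (fst w')) as [y0 Hy0]. destruct (L_right (fst w')) as [y1 Hy1].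
  destruct Hth as (c & p & x0 & Hx0).
  assert (Hfst : forall x, (fst (L x) < fst w' -> 0 < cos (th' x)) /\ (fst w' < fst (L x) -> cos (th' x) < 0)).
  { intro x. destruct (Hp' x) as (r & Hr & E). pose proof (f_equal fst E) as E1. simpl in E1.
    split; intro; nra. }
  exists th'. split; [split; [exact Hc'|split; [exact Hp'|]]|].
  - exists (Rmin x0 y0). intros x Hx. pose proof (Rmin_l x0 y0). pose proof (Rmin_r x0 y0).
    specialize (Hx0 x ltac:(lra)). specialize (Hy0 x ltac:(lra)). apply Hfst in Hy0.
    pose proof (turn_bound (Csub w (L x)) (Csub w' (L x))) as Ht. fold (th' x) in Hy0.
    assert (Hb : - PI < th' x < PI) by (unfold th'; lra).
    split; apply Rnot_le_lt; intro h.
    + assert (cos (- th' x) <= 0) by (apply cos_le_0; lra). rewrite cos_neg in *. lra.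
    + assert (cos (th' x) <= 0) by (apply cos_le_0; lra). lra.
  - exists (Rmax x1 y1). intros x Hx. pose proof (Rmax_l x1 y1). pose proof (Rmax_r x1 y1).
    specialize (Hx1 x ltac:(lra)). specialize (Hy1 x ltac:(lra)). apply Hfst in Hy1.
    pose proof (turn_bound (Csub w (L x)) (Csub w' (L x))) as Ht.
    assert (Hb : 0 < th' x < 2 * PI) by (unfold th'; lra).
    split; apply Rnot_le_lt; intro h.
    + assert (0 <= cos (th' x)) by (apply cos_ge_0; lra). lra.
    + assert (0 <= cos (th' x)) by (apply cos_ge_0_3PI2; lra). lra.
Qed.

Lemma above_loc_const : loc_const (fun z => ~ on_curve z) (indic above).
Proof.
  intros w Hw. destruct (closed_compl _ on_curve_closed w Hw) as [r [Hr Hr']].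
  (* Half the distance to the curve makes [above_near] applicable in both directions. *)
  exists (r / 2). split; [lra|]. intros w' Hw' Hd.
  assert (Hdist : forall x, r <= Cdist w (L x)).
  { intro x. apply Rnot_lt_le. intro h. apply (Hr' (L x)); [unfold ball; rewrite Cdist_sym; auto|]. exists x. auto. }
  assert (above w <-> above w').
  { split; apply above_near; intro x; specialize (Hdist x).
    - lra.
    - rewrite Cdist_sym. pose proof (Cdist_triangle w w' (L x)). rewrite (Cdist_sym w w') in *. lra. }
  destruct (classic (above w)).
  - rewrite !indic_1; tauto.
  - rewrite !indic_0; tauto.
Qed.

(** No point of the curve lies in the closed quadrant to the right of and above [w]. Hence the
    argument never equals pi or -pi/2, and starting between them it remains there. *)
Lemma above_intro w : (forall x, fst (L x) < fst w \/ snd (L x) < snd w) -> above w.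
Proof.
  intro H. destruct (arg_lift_exists w) as [th Hth].
  { intros [x <-]. destruct (H x); lra. }
  assert (Hx : forall x, 0 < cos (th x) \/ 0 < sin (th x)).
  { intro x. destruct (arg_lift_fst w th x Hth) as [[h1 _] _]. destruct (arg_lift_snd w th x Hth) as [[h2 _] _].
    destruct (H x); auto. }
  pose proof PI_RGT_0.
  pose proof Hth as (c & p & x0 & Hx0). specialize (Hx0 x0 (Rle_refl _)).
  exists th. split; auto. destruct (L_right (fst w)) as [x1 Hx1]. exists x1. intros x hx.
  specialize (Hx1 x hx). apply (arg_lift_fst w th x Hth) in Hx1.
  assert (h1 : th x < PI).
  { apply (avoid_value th PI c) with (s := x0); [|lra]. intros y E. specialize (Hx y).
    rewrite E, cos_PI, sin_PI in Hx. lra. }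
  assert (h2 : - (PI/2) < th x).
  { apply (avoid_value' th (- (PI/2)) c) with (s := x0); [|lra]. intros y E. specialize (Hx y).
    rewrite E, cos_neg, sin_neg, cos_PI2, sin_PI2 in Hx. lra. }
  split; [|lra]. apply Rnot_le_lt. intro h.
  assert (0 <= cos (th x)) by (apply cos_ge_0; lra). lra.
Qed.

(** Here the value pi/2 is never taken, so the argument cannot climb to the window of [above]. *)
Lemma not_above_intro w : (forall x, fst (L x) < fst w \/ snd w < snd (L x)) -> ~ above w.
Proof.
  intros H (th & Hth & x1 & Hx1).
  assert (Hx : forall x, 0 < cos (th x) \/ sin (th x) < 0).
  { intro x. destruct (arg_lift_fst w th x Hth) as [[h1 _] _]. destruct (arg_lift_snd w th x Hth) as [_ [h2 _]].
    destruct (H x); auto. }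
  pose proof PI_RGT_0. destruct Hth as (c & p & x0 & Hx0). specialize (Hx0 x0 (Rle_refl _)).
  specialize (Hx1 x1 (Rle_refl _)).
  assert (h1 : th x1 < PI/2); [|lra].
  apply (avoid_value th (PI/2) c) with (s := x0); [|lra]. intros y E. specialize (Hx y).
  rewrite E, cos_PI2, sin_PI2 in Hx. lra.
Qed.
End Sides.

(** * The exponential map *)

Definition shift (k : Z) (z : Cplx) : Cplx := (fst z, snd z + 2 * PI * IZR k).

Lemma shift_shift k l z : shift k (shift l z) = shift (k + l) z.
Proof. unfold shift; simpl. rewrite plus_IZR. f_equal. ring. Qed.

Lemma shift_0 z : shift 0 z = z.
Proof. unfold shift; destruct z; simpl. f_equal. ring. Qed.

Lemma shift_dist k z w : Cdist (shift k z) (shift k w) = Cdist z w.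
Proof. unfold Cdist, Csub, shift, Cnorm; simpl. apply (f_equal sqrt). ring. Qed.

Lemma shift_cont k z : contCC (shift k) z.
Proof. intros e He. exists e. split; auto. intros w Hw. rewrite shift_dist. auto. Qed.

Lemma atan_abs_le x : Rabs (atan x) <= Rabs x.
Proof.
  assert (H : forall y, 0 < y -> 0 < atan y <= y).
  { intros y Hy. split.
    - rewrite <- atan_0. apply atan_increasing. auto.
    - destruct (MVT_cor2 atan (fun t => / (1 + t * t)) 0 y Hy) as (c & E & Hc).
      + intros t _. pose proof (derivable_pt_lim_atan t) as h. unfold Rsqr in h.
        replace (t ^ 2) with (t * t) in h by ring. exact h.
      + rewrite atan_0, !Rminus_0_r in E. rewrite E.
        assert (/ (1 + c * c) <= 1).
        { rewrite <- Rinv_1. apply Rinv_le_contravar; nra. }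
        assert (0 < / (1 + c * c)) by (apply Rinv_0_lt_compat; nra). nra. }
  destruct (Rtotal_order x 0) as [h|[->|h]].
  - specialize (H (- x) ltac:(lra)). rewrite atan_opp in H. rewrite !Rabs_left; lra.
  - rewrite atan_0. lra.
  - specialize (H x h). rewrite !Rabs_pos_eq; lra.
Qed.

Lemma ln_abs_le t : 1/2 <= t -> Rabs (ln t) <= 2 * Rabs (t - 1).
Proof.
  intro Ht.
  assert (H : forall s, 0 < s -> ln s <= s - 1).
  { intros s Hs. pose proof (exp_ineq1_le (ln s)) as h. rewrite exp_ln in h; lra. }
  pose proof (H t ltac:(lra)) as h1.
  assert (h2 : ln (/ t) <= / t - 1) by (apply H, Rinv_0_lt_compat; lra).
  rewrite ln_Rinv in h2 by lra.
  assert (h3 : t * / t = 1) by (apply Rinv_r; lra).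
  assert (0 < / t) by (apply Rinv_0_lt_compat; lra).
  destruct (Rle_dec 1 t).
  - assert (0 <= ln t) by (rewrite <- ln_1; (destruct (Req_dec t 1) as [->|]; [lra|left; apply ln_increasing; lra])).
    rewrite !Rabs_pos_eq; lra.
  - assert (ln t < 0) by (rewrite <- ln_1; apply ln_increasing; lra).
    rewrite !Rabs_left by lra. nra.
Qed.

Section ExpMap.
Variable a : Cplx.
Notation f := (expmap a).

Lemma expmap_polar z : Csub (f z) a = scale (exp (fst z)) (cis (snd z)).
Proof. unfold expmap, Cexp, Cadd, Csub, scale, cis; simpl. f_equal; ring. Qed.

Lemma Cnorm_polar r t : 0 <= r -> Cnorm (scale r (cis t)) = r.
Proof.
  intro Hr. rewrite Cnorm_scale, Rabs_pos_eq by auto.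
  pose proof (unit_cis t) as hu. unfold unit_vec in hu. unfold Cnorm. rewrite hu, sqrt_1. ring.
Qed.

Lemma expmap_dist z : Cdist (f z) a = exp (fst z).
Proof. unfold Cdist. rewrite expmap_polar. apply Cnorm_polar. left; apply exp_pos. Qed.

Lemma expmap_omits z : f z <> a.
Proof. intro E. pose proof (expmap_dist z) as H. rewrite E, Cdist_refl in H. pose proof (exp_pos (fst z)). lra. Qed.

Lemma expmap_cont z : contCC f z.
Proof.
  unfold expmap, Cexp, Cadd.
  apply cont_pair; (apply cont_plus; [|apply cont_const, Rdist_refl]); simpl;
  (apply cont_mult; [apply cont_exp, contCR_fst|]); [apply cont_cos|apply cont_sin]; apply contCR_snd.
Qed.

Lemma expmap_shift k z : f (shift k z) = f z.
Proof.
  unfold expmap, Cexp, shift; simpl. pose proof (cis_2PI (snd z) k) as E. unfold cis in E.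
  injection E as -> ->. reflexivity.
Qed.

Lemma expmap_eq z w : f z = f w -> exists k, z = shift k w.
Proof.
  intro E. assert (Ef : fst z = fst w).
  { apply exp_inv. rewrite <- !expmap_dist, E. reflexivity. }
  pose proof (expmap_polar z) as Pz. rewrite E, expmap_polar, Ef in Pz.
  assert (Ec : cis (snd z) = cis (snd w)).
  { pose proof (exp_pos (fst w)). pose proof (f_equal fst Pz) as e1. pose proof (f_equal snd Pz) as e2. simpl in e1, e2.
    unfold cis. f_equal; apply (Rmult_eq_reg_l (exp (fst w))); lra. }
  destruct (cis_eq _ _ Ec) as [k Hk]. exists k. unfold shift. destruct z; simpl in *. f_equal; auto. lra.
Qed.

Lemma expmap_log w : w <> a -> exists z, f z = w.
Proof.
  intro H. apply Cdist_pos in H. set (n := Cdist w a) in *.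
  assert (Hn : n * n = (fst w - fst a) * (fst w - fst a) + (snd w - snd a) * (snd w - snd a)) by apply Cdist_sq.
  destruct (cis_exists ((fst w - fst a) / n) ((snd w - snd a) / n)) as [t Ht].
  { transitivity (((fst w - fst a) * (fst w - fst a) + (snd w - snd a) * (snd w - snd a)) / (n * n)); [field; lra|].
    rewrite <- Hn. field. lra. }
  exists (ln n, t). unfold expmap, Cexp, Cadd; simpl. rewrite exp_ln by auto.
  injection Ht as E1 E2. rewrite <- E1, <- E2. destruct w; simpl. f_equal; field; lra.
Qed.

(** The logarithm of [w - a] continued from [z0]. The bound 4 is the sum of 2 for the logarithm of
    the modulus and 2 for the angle. *)
Lemma expmap_local_inverse z0 w :
  Cdist w (f z0) <= exp (fst z0) / 2 ->
  exists z, f z = w /\ Cdist z z0 <= 4 * (Cdist w (f z0) / exp (fst z0)).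
Proof.
  intro H. set (rho := exp (fst z0)) in *. set (d := Cdist w (f z0)) in *.
  assert (Hr : 0 < rho) by apply exp_pos. pose proof (Cdist_nonneg w (f z0)) as Hd. fold d in Hd.
  set (u := Csub (f z0) a). set (v := Csub w a).
  assert (Hu : u = scale rho (cis (snd z0))) by apply expmap_polar.
  assert (Hun : Cnorm u = rho) by (rewrite Hu; apply Cnorm_polar; lra).
  assert (Hvu : Cdist v u = d).
  { unfold d, v, u, Cdist. f_equal. unfold Csub; simpl. f_equal; ring. }
  assert (Hdot : 0 < fst u * fst v + snd u * snd v) by (apply dot_pos_near; lra).
  destruct (polar_turn rho (snd z0) u v Hr Hu Hdot) as (r & Hr' & Hv).
  assert (Hrn : r = Cnorm v) by (rewrite Hv, Cnorm_polar; lra).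
  assert (Hvn : rho - d <= r <= rho + d).
  { pose proof (Cnorm_dist v u). pose proof (Cnorm_dist u v). rewrite (Cdist_sym u v) in *. lra. }
  exists (ln r, snd z0 + turn u v). split.
  - assert (Hgen : forall p, Csub p a = v -> p = w).
    { intros p E. unfold v, Csub in E. pose proof (f_equal fst E) as E1. pose proof (f_equal snd E) as E2.
      cbn [fst snd] in E1, E2. rewrite (surjective_pairing p), (surjective_pairing w). apply f_equal2; lra. }
    apply Hgen. rewrite expmap_polar. cbn [fst snd]. rewrite exp_ln by auto. symmetry; exact Hv.
  - eapply Rle_trans; [apply Cdist_le_sum|]. cbn [fst snd].
    assert (E1 : Rabs (ln r - fst z0) <= 2 * (d / rho)).
    { replace (ln r - fst z0) with (ln (r / rho)).
      - eapply Rle_trans; [apply ln_abs_le|].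
        + apply (Rmult_le_reg_r rho); auto. replace (r / rho * rho) with r by (field; lra). lra.
        + apply Rmult_le_compat_l; [lra|].
          replace (r / rho - 1) with ((r - rho) / rho) by (field; lra).
          unfold Rdiv. rewrite Rabs_mult, (Rabs_pos_eq (/ rho)) by (left; apply Rinv_0_lt_compat; auto).
          apply Rmult_le_compat_r; [left; apply Rinv_0_lt_compat; auto|]. apply Rabs_le. lra.
      - unfold Rdiv. rewrite ln_mult, ln_Rinv by (auto; apply Rinv_0_lt_compat; auto).
        unfold rho. rewrite ln_exp. ring. }
    assert (E2 : Rabs (snd z0 + turn u v - snd z0) <= 2 * (d / rho)).
    { replace (snd z0 + turn u v - snd z0) with (turn u v) by ring. unfold turn.
      eapply Rle_trans; [apply atan_abs_le|].
      set (D := fst u * fst v + snd u * snd v) in *. set (C := fst u * snd v - snd u * fst v).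
      pose proof (Cnorm_sq u) as hu. rewrite Hun in hu.
      pose proof (Cdist_sq v u) as hd. rewrite Hvu in hd.
      assert (HD : rho * rho - rho * d <= D).
      { assert (Hk : - (rho * d) <= fst u * (fst v - fst u) + snd u * (snd v - snd u)).
        { apply Ropp_le_cancel. rewrite Ropp_involutive. apply Rle_sq; [nra|].
          replace (rho * d * (rho * d)) with ((rho * rho) * (d * d)) by ring. rewrite hu, hd.
          pose proof (Rle_0_sqr (fst u * (snd v - snd u) - snd u * (fst v - fst u))) as h. unfold Rsqr in h. nra. }
        unfold D. nra. }
      assert (HC : Rabs C <= rho * d).
      { apply Rle_sq; [nra|].
        replace (Rabs C * Rabs C) with (C * C) by (pose proof (Rsqr_abs C) as h; unfold Rsqr in h; exact h).
        replace (rho * d * (rho * d)) with ((rho * rho) * (d * d)) by ring. rewrite hu, hd.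
        replace C with (fst u * (snd v - snd u) - snd u * (fst v - fst u)) by (unfold C; ring).
        pose proof (Rle_0_sqr (fst u * (fst v - fst u) + snd u * (snd v - snd u))) as h. unfold Rsqr in h. nra. }
      unfold Rdiv. rewrite Rabs_mult, (Rabs_pos_eq (/ D)) by (left; apply Rinv_0_lt_compat; auto).
      apply (Rmult_le_reg_r D); auto. rewrite Rmult_assoc, Rinv_l, Rmult_1_r by lra.
      eapply Rle_trans; [exact HC|].
      assert (Hq : 0 <= d * / rho) by (apply Rmult_le_pos; [auto|left; apply Rinv_0_lt_compat; auto]).
      assert (Hq2 : d * / rho * (rho * rho) = rho * d) by (field; lra).
      assert (rho * rho / 2 <= D) by nra.
      assert (d * / rho * (rho * rho / 2) <= d * / rho * D) by (apply Rmult_le_compat_l; auto). lra. }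
    lra.
Qed.

Lemma expmap_open z0 e : e > 0 -> exists d, d > 0 /\ forall w, Cdist w (f z0) < d -> exists z, f z = w /\ Cdist z z0 < e.
Proof.
  intro He. pose proof (exp_pos (fst z0)) as Hr. exists (Rmin (exp (fst z0) / 2) (exp (fst z0) * e / 8)).
  split; [apply Rmin_glb_lt; nra|]. intros w Hw.
  pose proof (Rmin_l (exp (fst z0) / 2) (exp (fst z0) * e / 8)).
  pose proof (Rmin_r (exp (fst z0) / 2) (exp (fst z0) * e / 8)).
  destruct (expmap_local_inverse z0 w) as (z & Ez & Hz); [lra|]. exists z. split; auto.
  eapply Rle_lt_trans; [exact Hz|].
  assert (Cdist w (f z0) / exp (fst z0) <= e / 8); [|lra].
  apply (Rmult_le_reg_r (exp (fst z0))); auto.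
  replace (Cdist w (f z0) / exp (fst z0) * exp (fst z0)) with (Cdist w (f z0)) by (field; lra). lra.
Qed.

Lemma expmap_inj_near z0 e : e > 0 -> exists d, d > 0 /\ forall z, Cdist (f z) (f z0) < d -> exists k, Cdist (shift k z) z0 < e.
Proof.
  intro He. destruct (expmap_open z0 e He) as (d & Hd & H). exists d. split; auto. intros z Hz.
  destruct (H (f z) Hz) as (z' & E & Hz'). destruct (expmap_eq z' z E) as [k ->]. exists k. auto.
Qed.

Lemma fiter_add n m z : fiter f (n + m) z = fiter f n (fiter f m z).
Proof. induction n; simpl; congruence. Qed.

Lemma fiter_S n z : fiter f (S n) z = fiter f n (f z).
Proof. replace (S n) with (n + 1)%nat by lia. rewrite fiter_add. reflexivity. Qed.

Lemma fiter_cont n z : contCC (fiter f n) z.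
Proof.
  revert z. induction n as [|n IH]; intro z; [apply cont_id|].
  apply (cont_comp _ Cdist _ f); [apply IH|apply expmap_cont].
Qed.

Lemma expmap_norm_le z : Cnorm (f z) <= exp (fst z) + Cnorm a.
Proof. rewrite <- expmap_dist. pose proof (Cnorm_dist (f z) a). lra. Qed.

Lemma expmap_norm_ge z : exp (fst z) - Cnorm a <= Cnorm (f z).
Proof. rewrite <- expmap_dist. pose proof (Cdist_triangle (f z) (0,0) a). rewrite Cdist_0, (Cdist_sym (0,0)), Cdist_0 in H. lra. Qed.

(** The modulus of [f z] is bounded in terms of the real part of [z] alone, so escaping orbits tend
    to infinity to the right. *)
Lemma escaping_fst z M : escaping f z -> exists N, forall n, (N <= n)%nat -> M < fst (fiter f n z).
Proof.
  intro H. destruct (H (exp M + Cnorm a)) as [N HN]. exists N. intros n Hn.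
  specialize (HN (S n) ltac:(lia)). simpl in HN. pose proof (expmap_norm_le (fiter f n z)).
  apply exp_lt_inv. lra.
Qed.

Lemma escaping_of_fst z : (forall M, exists N, forall n, (N <= n)%nat -> M < fst (fiter f n z)) -> escaping f z.
Proof.
  intros H M. destruct (H M) as [N HN]. exists N. intros n Hn. specialize (HN n Hn).
  pose proof (Cnorm_fst (fiter f n z)). pose proof (Rle_abs (fst (fiter f n z))). lra.
Qed.

Lemma escaping_f z : escaping f z <-> escaping f (f z).
Proof.
  split; intros H M.
  - destruct (H M) as [N HN]. exists N. intros n Hn. rewrite <- fiter_S. apply HN. lia.
  - destruct (H M) as [N HN]. exists (S N). intros n Hn. destruct n as [|n]; [lia|].
    rewrite fiter_S. apply HN. lia.
Qed.

Lemma escaping_fiter n z : escaping f z <-> escaping f (fiter f n z).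
Proof. induction n as [|n IH]; simpl; [tauto|]. rewrite <- escaping_f. auto. Qed.

Lemma escaping_shift k z : escaping f z -> escaping f (shift k z).
Proof. rewrite (escaping_f z), (escaping_f (shift k z)), expmap_shift. auto. Qed.

Definition image (h : Cplx -> Cplx) (E : Cplx -> Prop) (w : Cplx) : Prop := exists z, E z /\ h z = w.

Lemma image_connected (h : Cplx -> Cplx) E : (forall z, contCC h z) -> connected E -> connected (image h E).
Proof.
  intros Hh HE. apply connected_intro. intros F HF w1 w2 (z1 & E1 & <-) (z2 & E2 & <-).
  apply (connected_loc_const E (fun z => F (h z))); auto.
  apply (loc_const_comp (image h E)); auto. intros z Ez. exists z. auto.
Qed.

Lemma closure_image_cont (h : Cplx -> Cplx) E z : contCC h z -> closure E z -> closure (image h E) (h z).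
Proof.
  intros Hh Hz e He. destruct (Hh e He) as (d & Hd & Hd'). destruct (Hz d Hd) as (w & Ew & Hw).
  exists (h w). split; [exists w; auto|]. rewrite Cdist_sym. apply Hd'. rewrite Cdist_sym. auto.
Qed.

(** Satisfied by strips, which can be vertically unbounded only towards the left. Inside such a set,
    points whose images stay bounded and away from [a] form a bounded set. *)
Definition vert_bounded (Z : Cplx -> Prop) : Prop :=
  forall M, exists W, forall z, Z z -> - M <= fst z -> Rabs (snd z) <= W.

(** If the images of points of [Z] tend to [b], their real parts are bounded because [b] differs
    from [a], and their heights because [Z] is vertically bounded; so the points cluster. For
    [b = a] they could run off to the left. *)
Lemma closure_image Z b :
  vert_bounded Z -> closure (image f Z) b -> b <> a -> exists z, closure Z z /\ f z = b.
Proof.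
  intros HZ Hb Hne. destruct (closure_seq _ _ Hb) as (u & Hu1 & Hu2).
  set (v := fun n => proj1_sig (constructive_indefinite_description _ (Hu1 n))).
  assert (Hv : forall n, Z (v n) /\ f (v n) = u n).
  { intro n. unfold v. destruct constructive_indefinite_description as [q Hq]. exact Hq. }
  clearbody v. pose proof (Cdist_pos _ _ Hne) as Hpos.
  destruct (arch_inv (Cdist b a / 2)) as [N HN]; [lra|].
  assert (Hlow : forall n, (N <= n)%nat -> ln (Cdist b a / 2) <= fst (v n) <= ln (Cdist b a + 1)).
  { intros n Hn. specialize (HN n Hn). specialize (Hu2 n). destruct (Hv n) as [_ E].
    pose proof (expmap_dist (v n)) as Ed. rewrite E in Ed.
    pose proof (Cdist_triangle b (u n) a). pose proof (Cdist_triangle (u n) b a). rewrite (Cdist_sym (u n) b) in *.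
    assert (/ (INR n + 1) <= 1).
    { rewrite <- Rinv_1. apply Rinv_le_contravar; pose proof (pos_INR n); lra. }
    rewrite <- (ln_exp (fst (v n))), <- Ed. split; (match goal with |- ln ?x <= ln ?y => destruct (Req_dec x y) as [->|]; [lra|left; apply ln_increasing; lra] end). }
  set (M := Rabs (ln (Cdist b a / 2)) + Rabs (ln (Cdist b a + 1))).
  destruct (HZ M) as [W HW].
  assert (HM : forall n, (N <= n)%nat -> Rabs (fst (v n)) <= M).
  { intros n Hn. specialize (Hlow n Hn). unfold M.
    pose proof (Rle_abs (ln (Cdist b a + 1))). pose proof (Rle_abs (- ln (Cdist b a / 2))). rewrite Rabs_Ropp in *.
    pose proof (Rabs_pos (ln (Cdist b a + 1))). pose proof (Rabs_pos (ln (Cdist b a / 2))).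
    apply Rabs_le. lra. }
  destruct (cluster_exists (fun n => v (N + n)%nat) (M + W)) as [z Hz].
  { intro n. specialize (HM (N + n)%nat ltac:(lia)). eapply Rle_trans; [apply Cnorm_le_sum|].
    assert (Rabs (snd (v (N + n)%nat)) <= W); [|lra]. apply HW; [apply Hv|].
    pose proof (Rle_abs (- fst (v (N + n)%nat))). rewrite Rabs_Ropp in *. lra. }
  exists z. split.
  - apply (cluster_closure _ (fun n => v (N + n)%nat)); auto. intro n. apply Hv.
  - apply (cluster_conv_unique (fun n => u (N + n)%nat)).
    + intros e He k. destruct (cluster_cont _ z f Hz (expmap_cont z) e He k) as (n & Hn & Hd).
      exists n. split; auto. destruct (Hv (N + n)%nat) as [_ <-]. exact Hd.
    + intro n. eapply Rlt_le_trans; [apply Hu2|]. apply Rinv_le_contravar.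
      * pose proof (pos_INR n). lra.
      * rewrite plus_INR. pose proof (pos_INR N). lra.
Qed.
End ExpMap.

(** * Components, and connected sets separating a disconnected set *)

Lemma connected_union (A B : Cplx -> Prop) x :
  connected A -> connected B -> A x -> B x -> connected (fun z => A z \/ B z).
Proof.
  intros HA HB Ax Bx. apply connected_intro. intros F HF.
  assert (E : forall z, A z \/ B z -> F z = F x).
  { intros z [Az|Bz].
    - apply (connected_loc_const A); auto. apply (loc_const_sub (fun z => A z \/ B z)); auto.
    - apply (connected_loc_const B); auto. apply (loc_const_sub (fun z => A z \/ B z)); auto. }
  intros z w Hz Hw. rewrite (E z), (E w); auto.
Qed.

Lemma ball_connected x r : connected (fun y => Cdist y x < r).
Proof.
  apply connected_intro. intros F HF z w Hz Hw. apply (ball_loc_const (fun y => Cdist y x < r) F x r); auto.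
Qed.

Lemma component_sub A z w : component A z w -> A w.
Proof. intros (B & _ & H & _ & Bw). auto. Qed.

Lemma component_refl (A : Cplx -> Prop) z : A z -> component A z z.
Proof.
  intro Az. exists (fun w => w = z). repeat split; auto.
  - apply connected_intro. intros F _ v w -> ->. reflexivity.
  - intros w ->. exact Az.
Qed.

Lemma component_connected A z : connected (component A z).
Proof.
  apply connected_intro. intros F HF.
  assert (E : forall w, component A z w -> F z = F w).
  { intros w (B & HB & Hsub & Bz & Bw). apply (connected_loc_const B); auto.
    apply (loc_const_sub (component A z)); auto. intros v Bv. exists B. auto. }
  intros v w Hv Hw. rewrite <- (E v), <- (E w); auto.
Qed.

Lemma component_maximal A z (B : Cplx -> Prop) x y :
  connected B -> (forall w, B w -> A w) -> B x -> component A z x -> B y -> component A z y.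
Proof.
  intros HB Hsub Bx (B' & HB' & Hsub' & Bz & Bx') By.
  exists (fun w => B' w \/ B w). split; [apply (connected_union B' B x); auto|].
  split; [intros w [h|h]; auto|auto].
Qed.

Lemma component_open A z : is_open A -> is_open (component A z).
Proof.
  intros HA w Hw. destruct (HA w (component_sub _ _ _ Hw)) as [r [Hr Hr']].
  exists r. split; auto. intros v Hv.
  apply (component_maximal A z (fun y => Cdist y w < r) w); auto.
  - apply ball_connected.
  - rewrite Cdist_refl. lra.
Qed.

Lemma component_closure (A : Cplx -> Prop) z w :
  is_open A -> A w -> closure (component A z) w -> component A z w.
Proof.
  intros HA Aw Hc. destruct (HA w Aw) as [r [Hr Hr']]. destruct (Hc r Hr) as (v & Hv & Hd).
  apply (component_maximal A z (fun y => Cdist y w < r) v); auto.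
  - apply ball_connected.
  - rewrite Cdist_sym. auto.
  - rewrite Cdist_refl. lra.
Qed.

Definition frontier (D : Cplx -> Prop) (z : Cplx) : Prop := closure D z /\ ~ D z.

Lemma frontier_loc_const D : is_open D -> loc_const (fun z => ~ frontier D z) (indic D).
Proof.
  intros HD z Hz. destruct (classic (D z)) as [Dz|Dz].
  - destruct (HD z Dz) as [r [Hr Hr']]. exists r. split; auto. intros w _ Hw. rewrite !indic_1; auto.
  - assert (Hc : ~ closure D z) by (intro h; apply Hz; split; auto).
    destruct (closed_compl _ (closure_closed D) z Hc) as [r [Hr Hr']].
    exists r. split; auto. intros w _ Hw. rewrite !indic_0; auto.
    intro Dw. apply (Hr' w Hw). apply closure_incl, Dw.
Qed.

Lemma frontier_closed D : is_open D -> closed (frontier D).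
Proof.
  intros HD z Hz. split.
  - apply closure_closed. eapply closure_mono; try exact Hz. intros w [h _]; exact h.
  - apply (open_compl D HD). eapply closure_mono; try exact Hz. intros w [_ h]; exact h.
Qed.

Lemma closure_connected D : connected D -> connected (closure D).
Proof.
  intro HD. apply connected_intro. intros F HF.
  assert (E : forall z, closure D z -> exists w, D w /\ F w = F z).
  { intros z Hz. destruct (HF z Hz) as [r [Hr Hr']]. destruct (Hz r Hr) as (w & Dw & Hw).
    exists w. split; auto. apply Hr'; [apply closure_incl; auto|]. rewrite Cdist_sym. auto. }
  intros z w Hz Hw. destruct (E z Hz) as (z' & Dz' & <-). destruct (E w Hw) as (w' & Dw' & <-).
  apply (connected_loc_const D); auto. apply (loc_const_sub (closure D)); auto. apply closure_incl.
Qed.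

(** [W] is a component of one half of a separation and [D] a component of the exterior of [W];
    the frontier of [D] is connected because the plane is unicoherent. *)
Lemma disconnected_frontier (I : Cplx -> Prop) :
  ~ connected I -> exists D p q,
    is_open D /\ connected (frontier D) /\ (forall z, frontier D z -> ~ I z) /\
    I p /\ ~ closure D p /\ I q /\ D q.
Proof.
  intro HI. apply NNPP in HI. destruct HI as (U & V & HU & HV & Hcov & (p & Ip & Up) & (q & Iq & Vq) & Hdis).
  (* The given open sets are disjoint only on [I]. Balls of at most half the distance to the other
     part of [I] are disjoint in the plane. *)
  set (nb := fun (P Q : Cplx -> Prop) z => exists x r, I x /\ P x /\ Cdist z x < r /\
               forall y, I y -> Q y -> 2 * r <= Cdist y x).
  assert (Hop : forall P Q, is_open (nb P Q)).
  { intros P Q z (x & r & Ix & Px & Hd & Hr). exists (r - Cdist z x). split; [lra|].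
    intros w Hw. exists x, r. repeat split; auto. unfold ball in Hw. pose proof (Cdist_triangle w z x). lra. }
  assert (Hin : forall P Q z, is_open P -> (forall y, I y -> P y -> Q y -> False) -> I z -> P z -> nb P Q z).
  { intros P Q z HP Hd Iz Pz. destruct (HP z Pz) as [r [Hr Hr']]. exists z, (r/2).
    repeat split; auto; [rewrite Cdist_refl; lra|]. intros y Iy Qy. apply Rnot_lt_le. intro h.
    apply (Hd y); auto. apply Hr'. unfold ball. lra. }
  set (U1 := nb U V). set (V1 := nb V U).
  assert (Hdisj : forall z, U1 z -> V1 z -> False).
  { intros z (x & r & Ix & Ux & Hx & H1) (y & s & Iy & Vy & Hy & H2).
    specialize (H1 y Iy Vy). specialize (H2 x Ix Ux).
    pose proof (Cdist_triangle x z y) as Ht. rewrite (Cdist_sym x z) in Ht. rewrite (Cdist_sym y x) in H1. lra. }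
  assert (U1p : U1 p) by (apply Hin; auto).
  assert (V1q : V1 q) by (apply Hin; auto; eauto).
  set (W := component U1 p). set (D := component (fun z => ~ closure W z) q).
  assert (HWo : is_open W) by (apply component_open, Hop).
  assert (Wp : W p) by (apply component_refl; auto).
  assert (HVW : forall z, V1 z -> ~ closure W z).
  { intros z Vz Hc. destruct (Hop V U z Vz) as [r [Hr Hr']]. destruct (Hc r Hr) as (w & Ww & Hd).
    apply (Hdisj w); [apply (component_sub _ _ _ Ww)|]. apply Hr'. unfold ball. rewrite Cdist_sym. auto. }
  assert (HOo : is_open (fun z => ~ closure W z)) by (apply closed_compl, closure_closed).
  assert (HDo : is_open D) by (apply component_open; auto).
  assert (HDW : forall z, D z -> ~ closure W z) by (intros z Dz; apply (component_sub _ _ _ Dz)).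
  assert (HpD : ~ closure D p).
  { intro Hc. destruct (HWo p Wp) as [r [Hr Hr']]. destruct (Hc r Hr) as (w & Dw & Hd).
    apply (HDW w Dw). apply closure_incl, Hr'. unfold ball. rewrite Cdist_sym. auto. }
  exists D, p, q. split; [auto|]. split; [|split; [|repeat split; auto; apply component_refl; auto]].
  - apply (unicoherence (closure D) (fun z => ~ D z)).
    + apply closure_closed.
    + apply open_compl; auto.
    + apply closure_connected, component_connected.
    (* A locally constant function on the complement of [D] is constant on the closure of [W]. The
       set where it takes other values is clopen in the plane, because the components of the
       exterior of [W] other than [D] have no point near [D] outside the closure of [W]. Hence it is
       empty. *)
    + apply connected_intro. intros F HF.
      assert (HW : forall z, closure W z -> F z = F p).
      { intros z Hz. apply (connected_loc_const (closure W) F); auto.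
        - apply closure_connected, component_connected.
        - apply (loc_const_sub (fun z => ~ D z)); auto. intros w Hw Dw. apply (HDW w Dw Hw).
        - apply closure_incl, Wp. }
      assert (Hall : forall z, ~ D z -> F z = F p).
      { intros z Hz. apply NNPP. intro Hne.
        set (Q := fun w => ~ D w /\ F w <> F p).
        assert (E : indic Q z = indic Q p).
        { apply (seg_loc_const (fun _ => True)); auto. intros w _.
          destruct (classic (D w)) as [Dw|Dw].
          - destruct (HDo w Dw) as [r [Hr Hr']]. exists r. split; auto. intros v _ Hv.
            rewrite !indic_0; [auto|intros [h _]; auto|intros [h _]; apply h, Hr', Hv].
          - destruct (HF w Dw) as [r [Hr Hr']]. destruct (classic (F w = F p)) as [e|e].
            + exists r. split; auto. intros v _ Hv. rewrite !indic_0; [auto|intros [_ h]; auto|].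
              intros [h1 h2]. apply h2. rewrite <- e. apply Hr'; auto.
            + assert (Hw : ~ closure W w) by (intro h; apply e, HW, h).
              destruct (HOo w Hw) as [r2 [Hr2 Hr2']].
              assert (HnD : forall v, Cdist v w < r2 -> ~ D v).
              { intros v Hv Dv. apply Dw. apply (component_maximal _ q (fun y => Cdist y w < r2) v); auto.
                - apply ball_connected.
                - rewrite Cdist_refl. lra. }
              exists (Rmin r r2). split; [apply Rmin_glb_lt; auto|]. intros v _ Hv.
              pose proof (Rmin_l r r2). pose proof (Rmin_r r r2).
              assert (~ D v) by (apply HnD; lra).
              rewrite !indic_1; auto; split; auto. rewrite Hr'; auto; lra. }
        rewrite indic_1, indic_0 in E; [lra|intros [_ h]; auto|split; auto]. }
      intros z w Hz Hw. rewrite (Hall z), (Hall w); auto.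
    + intro z. destruct (classic (D z)); [left; apply closure_incl|right]; auto.
  - intros z [Hc HnD] Iz.
    assert (Hcw : closure W z).
    { apply NNPP. intro h. apply HnD. apply component_closure; auto. }
    destruct (Hcov z Iz) as [Uz|Vz].
    + assert (Ww : W z) by (apply component_closure; [apply Hop|apply Hin; auto|auto]).
      destruct (HWo z Ww) as [r [Hr Hr']]. destruct (Hc r Hr) as (w & Dw & Hd).
      apply (HDW w Dw). apply closure_incl, Hr'. unfold ball. rewrite Cdist_sym. auto.
    + apply (HVW z); auto. apply Hin; auto. intros y Iy Vy Uy. eauto.
Qed.

(** * The itinerary strips *)

Lemma Rabs_le_bounds x y : Rabs x <= y -> - y <= x <= y.
Proof. unfold Rabs. destruct Rcase_abs; lra. Qed.

Lemma finite_bound (s : nat -> R) n : exists M, 0 <= M /\ forall i, (i < n)%nat -> Rabs (s i) <= M.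
Proof.
  induction n as [|n (M & HM & IH)]; [exists 0; split; [lra|intros; lia]|].
  exists (M + Rabs (s n)). pose proof (Rabs_pos (s n)). split; [lra|]. intros i Hi.
  destruct (Nat.eq_dec i n) as [->|hi]; [lra|]. specialize (IH i ltac:(lia)). lra.
Qed.

Lemma finite_avoid (s : nat -> R) n : forall x r, r > 0 -> exists y, x < y < x + r /\ forall i, (i < n)%nat -> s i <> y.
Proof.
  induction n as [|n IH]; intros x r Hr; [exists (x + r/2); split; [lra|intros; lia]|].
  destruct (IH x (r/2)) as (y1 & Hy1 & H1); [lra|]. destruct (IH (x + r/2) (r/2)) as (y2 & Hy2 & H2); [lra|].
  destruct (Req_dec (s n) y1) as [e|e].
  - exists y2. split; [lra|]. intros i Hi. destruct (Nat.eq_dec i n) as [->|hi]; [lra|]. apply H2. lia.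
  - exists y1. split; [lra|]. intros i Hi. destruct (Nat.eq_dec i n) as [->|hi]; [lra|]. apply H1. lia.
Qed.

Section Strips.
Variable a : Cplx.
Variable g : R -> Cplx.
Notation f := (expmap a).
Hypothesis g_cont : forall t, contRC g t.
Hypothesis g_inj : forall s t, 0 <= s -> 0 <= t -> g s = g t -> s = t.
Hypothesis g_0 : g 0 = a.
Hypothesis g_right : forall M, exists T, forall t, t >= T -> fst (g t) > M.

(** A logarithm of [g - a] along the curve. The parameter [exp x] puts the endpoint [a], which has
    no preimage, at the left end of the line. *)
Lemma curve_log : exists L : R -> Cplx, (forall x, contRC L x) /\ forall x, f (L x) = g (exp x).
Proof.
  set (v := fun x => Csub (g (exp x)) a).
  assert (Hpos : forall x, 0 < Cnorm (v x)).
  { intro x. apply (Cdist_pos (g (exp x)) a). intro E. rewrite <- g_0 in E. pose proof (exp_pos x).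
    apply g_inj in E; lra. }
  assert (Hv : forall x, contRC v x).
  { intro x. assert (Hg : contRC (fun x => g (exp x)) x).
    { apply (cont_comp _ Rdist _ g exp); [|apply g_cont]. apply (cont_exp _ _ _ (fun y => y)), cont_id. }
    apply cont_pair; (apply cont_minus; [|apply cont_const, Rdist_refl]); [apply cont_fst|apply cont_snd]; exact Hg. }
  assert (Hvz : forall z, contCC (fun z => v (fst z)) z).
  { intro z. apply (cont_comp _ Rdist _ v fst); [apply contCR_fst|apply Hv]. }
  destruct (circle_lift (fun z => scale (/ Cnorm (v (fst z))) (v (fst z)))) as [psi Hpsi].
  - intro z. specialize (Hpos (fst z)).
    apply cont_pair; apply cont_mult; try (apply cont_inv; [apply cont_Cnorm, Hvz|lra]);
    [apply cont_fst|apply cont_snd]; apply Hvz.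
  - intro z. specialize (Hpos (fst z)). unfold unit_vec, scale. cbn [fst snd].
    pose proof (Cnorm_sq (v (fst z))) as Hs.
    transitivity ((fst (v (fst z)) * fst (v (fst z)) + snd (v (fst z)) * snd (v (fst z))) / (Cnorm (v (fst z)) * Cnorm (v (fst z)))); [field; lra|].
    rewrite <- Hs. field. lra.
  - exists (fun x => (ln (Cnorm (v x)), psi (x, 0))). split.
    + intro x. apply cont_pair.
      * apply cont_ln; [apply cont_Cnorm, Hv|apply Hpos].
      * apply (cont_comp _ Cdist _ psi (fun x => (x, 0))); [|apply Hpsi].
        apply cont_pair; [apply cont_id|apply cont_const, Rdist_refl].
    + intro x. destruct (Hpsi (x, 0)) as [_ E]. cbn [fst snd] in E. specialize (Hpos x).
      unfold expmap, Cexp, Cadd. cbn [fst snd]. rewrite exp_ln by auto.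
      pose proof (f_equal fst E) as E1. pose proof (f_equal snd E) as E2. unfold scale, cis in E1, E2. cbn [fst snd] in E1, E2.
      rewrite <- E1, <- E2. rewrite (surjective_pairing (g (exp x))).
      assert (Ef : fst (v x) = fst (g (exp x)) - fst a) by reflexivity.
      assert (Es : snd (v x) = snd (g (exp x)) - snd a) by reflexivity.
      apply f_equal2; [rewrite Ef|rewrite Es]; field; lra.
Qed.

Lemma g_proper : forall M, exists B, forall t, 0 <= t -> Cnorm (g t) <= M -> t <= B.
Proof.
  intro M. destruct (g_right M) as [T HT]. exists T. intros t _ H. apply Rnot_lt_le. intro h.
  specialize (HT t ltac:(lra)). pose proof (Cnorm_fst (g t)). pose proof (Rle_abs (fst (g t))). lra.
Qed.

Definition ray (z : Cplx) : Prop := exists t, 0 <= t /\ g t = z.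

Lemma ray_closed : closed ray.
Proof. apply (tail_closed g g_cont g_proper 0). lra. Qed.

Notation cut := (preimage_curve f g).

Lemma cut_ray z : cut z <-> ray (f z).
Proof. split; intros (t & Ht & E); exists t; auto. Qed.

Lemma cut_shift k z : cut (shift k z) <-> cut z.
Proof. rewrite !cut_ray, expmap_shift. tauto. Qed.

Lemma uncut_open : is_open (fun z => ~ cut z).
Proof.
  intros z Hz. rewrite cut_ray in Hz. destruct (closed_compl _ ray_closed _ Hz) as [r [Hr Hr']].
  destruct (expmap_cont a z r Hr) as [d [Hd Hd']]. exists d. split; auto.
  intros w Hw. rewrite cut_ray. apply Hr', Hd', Hw.
Qed.

Variable L : R -> Cplx.
Hypothesis L_cont : forall x, contRC L x.
Hypothesis L_f : forall x, f (L x) = g (exp x).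

Lemma L_fst x : exp (fst (L x)) = Cdist (g (exp x)) a.
Proof. rewrite <- (expmap_dist a), L_f. reflexivity. Qed.

Lemma L_right M : exists X, forall x, X <= x -> M < fst (L x).
Proof.
  destruct (g_right (exp M + fst a)) as [T HT]. exists (Rmax T 0). intros x Hx.
  pose proof (Rmax_l T 0). pose proof (Rmax_r T 0).
  assert (x <= exp x) by (pose proof (exp_ineq1_le x); lra).
  specialize (HT (exp x) ltac:(lra)). apply exp_lt_inv. rewrite L_fst.
  pose proof (Cdist_fst (g (exp x)) a). pose proof (Rle_abs (fst (g (exp x)) - fst a)). lra.
Qed.

Lemma L_left M : exists X, forall x, x <= X -> fst (L x) < M.
Proof.
  destruct (g_cont 0 (exp M) (exp_pos M)) as [d [Hd Hd']]. exists (ln (d/2)). intros x Hx.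
  apply exp_lt_inv. rewrite L_fst, <- g_0. apply Hd'. unfold Rdist.
  assert (exp x <= d/2).
  { rewrite <- (exp_ln (d/2)) by lra. destruct Hx as [h| ->]; [left; apply exp_increasing; auto|lra]. }
  pose proof (exp_pos x). rewrite Rabs_pos_eq; lra.
Qed.

Lemma cut_iff z : cut z <-> exists x l, z = shift l (L x).
Proof.
  split.
  - intros (t & [Ht| <-] & E).
    + assert (E2 : f z = f (L (ln t))) by (rewrite L_f, exp_ln by auto; auto).
      destruct (expmap_eq a _ _ E2) as [k ->]. eauto.
    + exfalso. rewrite g_0 in E. apply (expmap_omits a z E).
  - intros (x & l & ->). rewrite cut_shift. exists (exp x). split; [left; apply exp_pos|apply L_f].
Qed.

Lemma cut_gpos z : cut z -> exists t, 0 < t /\ f z = g t.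
Proof. rewrite cut_iff. intros (x & l & ->). exists (exp x). rewrite expmap_shift, L_f. split; auto. apply exp_pos. Qed.

Lemma cut_curve x l : cut (shift l (L x)).
Proof. apply cut_iff. eauto. Qed.

Lemma L_inj x y l : L x = shift l (L y) -> x = y /\ l = 0%Z.
Proof.
  intro E. assert (x = y).
  { apply exp_inv. pose proof (f_equal f E) as E2. rewrite expmap_shift, !L_f in E2.
    apply g_inj; auto; left; apply exp_pos. }
  subst y. split; auto. pose proof (f_equal snd E) as E2. simpl in E2. pose proof PI_RGT_0.
  apply eq_IZR. apply (Rmult_eq_reg_l (2 * PI)); lra.
Qed.

(** Where [g] lies to the right of [a], the height of [L] has positive cosine and therefore cannot
    leave a window of length pi. *)
Lemma L_far : exists X, forall x y, X <= x -> X <= y -> Rabs (snd (L x) - snd (L y)) < PI.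
Proof.
  destruct (g_right (fst a)) as [T HT]. set (X := Rmax T 0).
  assert (Hcos : forall x, X <= x -> 0 < cos (snd (L x))).
  { intros x Hx. pose proof (Rmax_l T 0). pose proof (Rmax_r T 0). fold X in H, H0.
    assert (x <= exp x) by (pose proof (exp_ineq1_le x); lra).
    specialize (HT (exp x) ltac:(lra)). rewrite <- L_f in HT.
    pose proof (f_equal fst (expmap_polar a (L x))) as E. simpl in E, HT. pose proof (exp_pos (fst (L x))). nra. }
  destruct (angle_in_window _ (Hcos X (Rle_refl _))) as [k Hk]. apply Rabs_def2 in Hk.
  set (th := fun y => snd (L (Rmax y X)) - 2 * PI * IZR k).
  assert (Hc : forall y, contRR th y).
  { intro y. apply cont_minus; [|apply cont_const, Rdist_refl].
    apply (cont_snd _ (fun y => L (Rmax y X))).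
    apply (cont_comp _ Rdist _ L (fun y => Rmax y X)); [|apply L_cont].
    intros e He. exists e. split; auto. intros v Hv'. unfold Rdist in *. unfold Rmax.
    revert Hv'. repeat destruct Rle_dec; unfold Rabs; repeat destruct Rcase_abs; lra. }
  assert (Hcos1 : forall y, 0 < cos (th y)).
  { intro y. unfold th. pose proof (cis_2PI (snd (L (Rmax y X)) - 2 * PI * IZR k) k) as E.
    replace (snd (L (Rmax y X)) - 2 * PI * IZR k + 2 * PI * IZR k) with (snd (L (Rmax y X))) in E by ring.
    pose proof (f_equal fst E) as E1. simpl in E1. rewrite <- E1. apply Hcos, Rmax_r. }
  assert (E0 : th X = snd (L X) - 2 * PI * IZR k) by (unfold th; rewrite Rmax_left; lra).
  assert (Hw : forall x, X <= x -> - (PI/2) < snd (L x) - 2 * PI * IZR k < PI/2).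
  { intros x Hx. replace (snd (L x) - 2 * PI * IZR k) with (th x) by (unfold th; rewrite Rmax_left; lra).
    split.
    - apply (avoid_value' th) with (s := X); auto; [|lra].
      intros y Ey. specialize (Hcos1 y). rewrite Ey, cos_neg, cos_PI2 in Hcos1. lra.
    - apply (avoid_value th) with (s := X); auto; [|lra].
      intros y Ey. specialize (Hcos1 y). rewrite Ey, cos_PI2 in Hcos1. lra. }
  exists X. intros x y Hx Hy. pose proof (Hw x Hx). pose proof (Hw y Hy). apply Rabs_def1; lra.
Qed.

Lemma L_window M : exists Y, forall x, - M <= fst (L x) -> Rabs (snd (L x)) <= Y.
Proof.
  destruct L_far as [X HX]. destruct (L_left (- M)) as [X0 HX0].
  destruct (arc_bounded L L_cont X0 X) as [B HB].
  exists (Rmax B (Rabs (snd (L X)) + PI)). intros x Hx.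
  assert (X0 < x). { apply Rnot_le_lt. intro h. apply HX0 in h. lra. }
  destruct (Rle_dec x X) as [h|h].
  - eapply Rle_trans; [apply Cnorm_snd|]. eapply Rle_trans; [apply HB|apply Rmax_l]. exists x. split; auto; lra.
  - eapply Rle_trans; [|apply Rmax_r]. specialize (HX x X ltac:(lra) ltac:(lra)).
    pose proof (Rabs_triang (snd (L x) - snd (L X)) (snd (L X))) as h2.
    replace (snd (L x) - snd (L X) + snd (L X)) with (snd (L x)) in h2 by ring. lra.
Qed.

(** * Sides of the translated curves *)

Definition aboveL (l : Z) (w : Cplx) : Prop := above L (shift (- l) w).

Lemma aboveL_shift k l w : aboveL l (shift k w) <-> aboveL (l - k) w.
Proof. unfold aboveL. rewrite shift_shift. replace (- l + k)%Z with (- (l - k))%Z by lia. tauto. Qed.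

(** [L_window] clears the relevant quadrant at [w] of curve points. One [Y] serves all
    translates. *)
Lemma aboveL_window M : exists Y, forall l w, - M <= fst w ->
  (Y < snd w - 2 * PI * IZR l -> aboveL l w) /\ (snd w - 2 * PI * IZR l < - Y -> ~ aboveL l w).
Proof.
  destruct (L_window M) as [Y HY]. exists Y. intros l w Hw.
  assert (H : forall x, fst (L x) < fst w \/ Rabs (snd (L x)) <= Y).
  { intro x. destruct (Rlt_dec (fst (L x)) (fst w)); [auto|right; apply HY; lra]. }
  split; intro h.
  - apply (above_intro L L_cont L_left L_right). intro x. unfold shift; cbn [fst snd].
    rewrite opp_IZR. destruct (H x) as [h1|h1]; [auto|right]. apply Rabs_le_bounds in h1. lra.
  - apply (not_above_intro L). intro x. unfold shift; cbn [fst snd].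
    rewrite opp_IZR. destruct (H x) as [h1|h1]; [auto|right]. apply Rabs_le_bounds in h1. lra.
Qed.

Definition on_curveL (l : Z) (w : Cplx) : Prop := on_curve L (shift (- l) w).

Lemma on_curveL_iff l w : on_curveL l w <-> exists x, w = shift l (L x).
Proof.
  unfold on_curveL, on_curve. split; intros [x E]; exists x.
  - rewrite E, shift_shift. replace (l + - l)%Z with 0%Z by lia. symmetry; apply shift_0.
  - rewrite E, shift_shift. replace (- l + l)%Z with 0%Z by lia. symmetry; apply shift_0.
Qed.

Lemma cut_on_curveL w : cut w <-> exists l, on_curveL l w.
Proof.
  rewrite cut_iff. split.
  - intros (x & l & E). exists l. apply on_curveL_iff. eauto.
  - intros [l H]. apply on_curveL_iff in H. destruct H as [x E]. eauto.
Qed.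

Lemma aboveL_loc_const l : loc_const (fun z => ~ on_curveL l z) (indic (aboveL l)).
Proof.
  apply (loc_const_comp (fun z => ~ on_curve L z) _ (indic (above L)) (shift (- l))); auto.
  - intros. apply shift_cont.
  - apply above_loc_const; auto. apply L_left. apply L_right.
Qed.

Lemma aboveL_uncut l : loc_const (fun z => ~ cut z) (indic (aboveL l)).
Proof.
  apply (loc_const_sub (fun z => ~ on_curveL l z)); [|apply aboveL_loc_const].
  intros z Hz H. apply Hz. apply cut_on_curveL. eauto.
Qed.

(** Proved by comparing heights near right infinity. *)
Lemma aboveL_curve l m x : (l <> m)%Z -> aboveL l (shift m (L x)) <-> (l < m)%Z.
Proof.
  intro Hlm.
  assert (Hno : forall y, ~ on_curveL l (shift m (L y))).
  { intros y H. apply on_curveL_iff in H. destruct H as [x' E].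
    assert (E2 : L y = shift (l - m) (L x')).
    { rewrite <- (shift_0 (L y)). replace 0%Z with (- m + m)%Z by lia. rewrite <- shift_shift, E, shift_shift. f_equal. lia. }
    apply L_inj in E2. lia. }
  destruct L_far as [X HX]. destruct (L_left (fst (L X))) as [X0 HX0].
  (* A point [L y] so far right that every curve point not to the left of it has nearly the same
     height; a translate by a nonzero multiple of 2 pi then clears the curve. *)
  assert (Hfar : exists y, forall x', fst (L x') < fst (L y) \/ Rabs (snd (L x') - snd (L y)) < PI).
  { destruct (arc_bounded L L_cont X0 X) as [B HB].
    destruct (L_right (Rmax B (fst (L X)))) as [X1 HX1]. exists (Rmax X X1). intro x'.
    pose proof (Rmax_l X X1) as h1. pose proof (Rmax_r X X1) as h2. pose proof (HX1 _ h2) as h3.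
    pose proof (Rmax_l B (fst (L X))). pose proof (Rmax_r B (fst (L X))).
    destruct (Rle_dec X x') as [h|h]; [right; apply HX; auto|left].
    destruct (Rle_dec x' X0) as [h'|h'].
    - specialize (HX0 x' h'). lra.
    - assert (Cnorm (L x') <= B) by (apply HB; exists x'; split; auto; lra).
      pose proof (Cnorm_fst (L x')). pose proof (Rle_abs (fst (L x'))). lra. }
  destruct Hfar as [y Hy].
  assert (E : indic (aboveL l) (shift m (L x)) = indic (aboveL l) (shift m (L y))).
  { apply (curve_loc_const' (fun z => ~ on_curveL l z) _ (fun t => shift m (L t)) (fun _ => True)); auto.
    - intros t _. apply (cont_comp _ Cdist _ (shift m) L); [apply L_cont|apply shift_cont].
    - apply aboveL_loc_const. }
  pose proof PI_RGT_0.
  assert (Hsn : forall z, snd (shift (- l) (shift m z)) = snd z + 2 * PI * IZR (m - l)).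
  { intro z. rewrite shift_shift. unfold shift; simpl. do 2 f_equal. f_equal. lia. }
  assert (Hff : fst (shift (- l) (shift m (L y))) = fst (L y)) by reflexivity.
  destruct (Z.lt_ge_cases l m) as [h|h].
  - split; auto. intros _. apply (indic_eq _ (shift m (L y))); auto.
    apply (above_intro L L_cont L_left L_right). intro x'. rewrite Hsn, Hff.
    assert (1 <= IZR (m - l)) by (apply IZR_le; lia).
    destruct (Hy x') as [h1|h1]; [auto|right]. apply Rabs_def2 in h1. nra.
  - split; [|lia]. intro hab. exfalso. apply (indic_eq _ _ _ E) in hab. revert hab.
    apply (not_above_intro L). intro x'. rewrite Hsn, Hff.
    assert (IZR (m - l) <= -1) by (apply (IZR_le _ (-1)); lia).
    destruct (Hy x') as [h1|h1]; [auto|right]. apply Rabs_def2 in h1. nra.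
Qed.

(** * The strips as translates of one component *)

Variable S0 : Cplx -> Prop.
Hypothesis S0_comp : is_component (fun z => ~ cut z) S0.
Notation T := (strip S0).

Lemma strip_shift k z : T k z <-> S0 (shift (- k) z).
Proof.
  unfold strip, shift. rewrite opp_IZR. replace (snd z - 2 * PI * IZR k) with (snd z + 2 * PI * - IZR k) by ring. tauto.
Qed.

Lemma strip_of_shift k l z : T k (shift l z) <-> T (k - l) z.
Proof. rewrite !strip_shift, shift_shift. replace (- k + l)%Z with (- (k - l))%Z by lia. tauto. Qed.

Lemma S0_uncut z : S0 z -> ~ cut z.
Proof. destruct S0_comp as (z0 & _ & H). rewrite H. apply component_sub. Qed.

Lemma S0_inhabited : exists z, S0 z.
Proof. destruct S0_comp as (z0 & H0 & H). exists z0. apply H, component_refl, H0. Qed.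

Lemma S0_connected : connected S0.
Proof.
  destruct S0_comp as (z0 & _ & H). apply connected_intro. intros F HF z w Hz Hw.
  apply (connected_loc_const _ F (component_connected (fun z => ~ cut z) z0)); try (apply H; auto).
  apply (loc_const_sub S0); auto. intros v. apply H.
Qed.

Lemma S0_maximal (B : Cplx -> Prop) x :
  connected B -> (forall z, B z -> ~ cut z) -> B x -> S0 x -> forall y, B y -> S0 y.
Proof.
  destruct S0_comp as (z0 & _ & H). intros HB Hsub Bx Sx y By. apply H. apply H in Sx.
  apply (component_maximal _ _ B x); auto.
Qed.

Lemma strip_uncut k z : T k z -> ~ cut z.
Proof. rewrite strip_shift. intros H Hc. apply (S0_uncut _ H). apply cut_shift; auto. Qed.

Lemma strip_maximal (B : Cplx -> Prop) k x :
  connected B -> (forall z, B z -> ~ cut z) -> B x -> T k x -> forall y, B y -> T k y.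
Proof.
  intros HB Hsub Bx Tx y By. rewrite strip_shift in *.
  apply (S0_maximal (image (shift (- k)) B) (shift (- k) x)); auto.
  - apply image_connected; auto. apply shift_cont.
  - intros z (w & Bw & <-). rewrite cut_shift. auto.
  - exists x. auto.
  - exists y. auto.
Qed.

Lemma strip_open k : is_open (T k).
Proof.
  intros z Hz. destruct (uncut_open z (strip_uncut k z Hz)) as [r [Hr Hr']].
  exists r. split; auto. intros w Hw.
  apply (strip_maximal (fun y => Cdist y z < r) k z); auto.
  - apply ball_connected.
  - rewrite Cdist_refl. lra.
Qed.

Lemma strip_closure k z : ~ cut z -> closure (T k) z -> T k z.
Proof.
  intros Hz Hc. destruct (uncut_open z Hz) as [r [Hr Hr']]. destruct (Hc r Hr) as (w & Tw & Hd).
  apply (strip_maximal (fun y => Cdist y z < r) k w); auto.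
  - apply ball_connected.
  - rewrite Cdist_sym. auto.
  - rewrite Cdist_refl. lra.
Qed.

(** [f S0] is open and closed in the connected complement of the ray. *)
Lemma strip_cover z : ~ cut z -> exists k, T k z.
Proof.
  intro Hz. destruct S0_inhabited as [z0 Hz0].
  set (Q := fun y => exists x, S0 x /\ f x = y).
  assert (E : indic Q (f z0) = indic Q (f z)).
  { apply (ray_unseparated g g_cont g_inj g_proper (f z0) (f z)).
    - intro h. apply (S0_uncut z0 Hz0), cut_ray, h.
    - intro h. apply Hz, cut_ray, h.
    - intros y Hy.
      destruct (expmap_log a y) as [z1 <-]. { intros ->. apply Hy. exists 0. split; [lra|auto]. }
      assert (Hz1 : ~ cut z1) by (intro h; apply Hy, cut_ray, h).
      destruct (uncut_open z1 Hz1) as [r [Hr Hr']].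
      assert (Hball : forall k x y, Cdist (shift k x) z1 < r -> Cdist (shift k y) z1 < r -> S0 x -> S0 y).
      { intros k x y0 Hx Hy0 Sx.
        apply (S0_maximal (fun v => Cdist v (shift (- k) z1) < r) x).
        - apply ball_connected.
        - intros v Hv. rewrite <- (cut_shift k). apply Hr'. unfold ball.
          rewrite <- (shift_dist (- k)), shift_shift. replace (- k + k)%Z with 0%Z by lia. rewrite shift_0. auto.
        - rewrite <- (shift_dist k), shift_shift. replace (k + - k)%Z with 0%Z by lia. rewrite shift_0. auto.
        - auto.
        - rewrite <- (shift_dist k), shift_shift. replace (k + - k)%Z with 0%Z by lia. rewrite shift_0. auto. }
      destruct (expmap_inj_near a z1 r Hr) as (d1 & Hd1 & H1).
      destruct (expmap_open a z1 r Hr) as (d2 & Hd2 & H2).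
      exists (Rmin d1 d2). split; [apply Rmin_glb_lt; auto|]. intros w Hw Hwd.
      pose proof (Rmin_l d1 d2). pose proof (Rmin_r d1 d2).
      assert (Hself : forall k, Cdist (shift k (shift (- k) z1)) z1 < r).
      { intro k. rewrite shift_shift. replace (k + - k)%Z with 0%Z by lia. rewrite shift_0, Cdist_refl. auto. }
      assert (Q w <-> Q (f z1)).
      { split.
        - intros (x & Sx & <-). destruct (H1 x) as [k Hk]; [lra|].
          exists (shift (- k) z1). split; [|apply expmap_shift]. apply (Hball k x); auto.
        - intros (x & Sx & Ex). destruct (expmap_eq a _ _ Ex) as [k ->].
          destruct (H2 w) as (x' & <- & Hx'); [lra|].
          exists (shift k x'). split; [|apply expmap_shift]. apply (Hball (- k)%Z (shift k z1)); auto.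
          + rewrite shift_shift. replace (- k + k)%Z with 0%Z by lia. rewrite shift_0, Cdist_refl. auto.
          + rewrite shift_shift. replace (- k + k)%Z with 0%Z by lia. rewrite shift_0. auto. }
      destruct (classic (Q w)); [rewrite !indic_1|rewrite !indic_0]; tauto. }
  assert (Qz : Q (f z)) by (apply (indic_eq Q (f z0)); auto; exists z0; auto).
  destruct Qz as (x & Sx & Ex). symmetry in Ex. destruct (expmap_eq a _ _ Ex) as [k ->].
  exists k. rewrite strip_shift, shift_shift. replace (- k + k)%Z with 0%Z by lia. rewrite shift_0. auto.
Qed.

Lemma S0_aboveL l z w : S0 z -> S0 w -> (aboveL l z <-> aboveL l w).
Proof.
  intros Hz Hw.
  assert (E : indic (aboveL l) z = indic (aboveL l) w).
  { apply (connected_loc_const S0); auto; [apply S0_connected|].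
    apply (loc_const_sub (fun z => ~ cut z)); [apply S0_uncut|apply aboveL_uncut]. }
  split; apply indic_eq; auto.
Qed.

Lemma strip_aboveL k l z w : T k z -> T k w -> (aboveL l z <-> aboveL l w).
Proof.
  rewrite !strip_shift. intros Hz Hw. pose proof (S0_aboveL (l - k) _ _ Hz Hw) as H.
  rewrite !aboveL_shift in H. replace (l - k - - k)%Z with l in H by lia. exact H.
Qed.

(** If [S0] met a translate of itself, maximality would make it invariant under that translation.
    Its points would then have arbitrary heights over a fixed abscissa, although all of them lie on
    the same side of each curve. *)
Lemma strip_disjoint : forall k l z, T k z -> T l z -> k = l.
Proof.
  assert (Hmain : forall m w, S0 w -> S0 (shift m w) -> (0 < m)%Z -> False).
  { intros m w Hw Hm Hpos.
    assert (Hstep : forall v, S0 v -> S0 (shift m v)).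
    { intros v Hv. apply (S0_maximal (image (shift m) S0) (shift m w)); auto.
      - apply image_connected; [apply shift_cont|apply S0_connected].
      - intros x (y & Hy & <-). rewrite cut_shift. apply S0_uncut, Hy.
      - exists w. auto.
      - exists v. auto. }
    assert (Hiter : forall n : nat, S0 (shift (Z.of_nat n * m) w)).
    { induction n as [|n IH]; [simpl; rewrite shift_0; auto|].
      apply Hstep in IH. rewrite shift_shift in IH.
      replace (Z.of_nat (S n) * m)%Z with (m + Z.of_nat n * m)%Z by lia. auto. }
    destruct (aboveL_window (- fst w)) as [Y HY].
    assert (Hall : forall l (n : nat), aboveL l w <-> aboveL (l - Z.of_nat n * m) w).
    { intros l n. rewrite <- aboveL_shift. apply S0_aboveL; auto. }
    pose proof PI_RGT_0.
    destruct (INR_unbounded ((Rabs Y + Rabs (snd w)) / PI)) as [n Hn].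
    assert (Hn2 : INR n * PI > Rabs Y + Rabs (snd w)).
    { apply (Rmult_gt_compat_r PI) in Hn; auto.
      replace ((Rabs Y + Rabs (snd w)) / PI * PI) with (Rabs Y + Rabs (snd w)) in Hn by (field; lra). auto. }
    pose proof (pos_INR n) as Hn0. pose proof (Rle_abs Y). pose proof (Rabs_pos Y).
    pose proof (Rle_abs (snd w)). pose proof (Rle_abs (- snd w)) as Hneg. rewrite Rabs_Ropp in Hneg.
    assert (Hm1 : 1 <= IZR m) by (apply IZR_le; lia).
    assert (Hnm : INR n * PI <= INR n * IZR m * PI).
    { replace (INR n * IZR m * PI) with (INR n * PI * IZR m) by ring.
      rewrite <- (Rmult_1_r (INR n * PI)) at 1. apply Rmult_le_compat_l; [nra|auto]. }
    (* [w] is far below the curve of index [n * m] and far above that of index [- n * m], whereas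
       invariance under the shift by [2 * n * m] identifies the two sides. *)
    assert (Hlow : aboveL (Z.of_nat n * m - Z.of_nat (2 * n) * m) w).
    { apply (HY _ w); [lra|]. replace (Z.of_nat n * m - Z.of_nat (2 * n) * m)%Z with (- (Z.of_nat n * m))%Z by lia.
      rewrite opp_IZR, mult_IZR, <- INR_IZR_INZ. nra. }
    apply Hall in Hlow. revert Hlow. apply (HY _ w); [lra|].
    rewrite mult_IZR, <- INR_IZR_INZ. nra. }
  assert (H2 : forall k l z, T k z -> T l z -> (k < l)%Z -> False).
  { intros k l z Hk Hl Hkl. rewrite strip_shift in *.
    apply (Hmain (l - k)%Z (shift (- l) z)); auto; [|lia].
    rewrite shift_shift. replace (l - k + - l)%Z with (- k)%Z by lia. auto. }
  intros k l z Hk Hl. destruct (Z.lt_trichotomy k l) as [h|[h|h]]; auto; exfalso; eauto.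
Qed.

Lemma strip_closure_disjoint k l z : closure (T k) z -> T l z -> k = l.
Proof.
  intros Hk Hl. apply (strip_disjoint k l z); auto. apply strip_closure; auto. apply (strip_uncut l); auto.
Qed.

(** Two points of [S0] in a right half-plane whose heights differ by more than the stated amount
    would have one of the curves between them. [M'] enlarges the half-plane to include the reference
    point [z0]. *)
Lemma strip_window M : exists W, forall k z, T k z -> - M <= fst z -> Rabs (snd z - 2 * PI * IZR k) <= W.
Proof.
  destruct S0_inhabited as [z0 Hz0]. set (M' := Rmax M (- fst z0)).
  destruct (aboveL_window M') as [Y HY]. pose proof PI_RGT_0.
  assert (Hkey : forall z w, S0 z -> S0 w -> - M' <= fst z -> - M' <= fst w -> snd z <= snd w + 2 * Rabs Y + 2 * PI).
  { intros z w Hz Hw h1 h2. apply Rnot_lt_le. intro Hlt. pose proof (Rle_abs Y).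
    destruct (archimed ((snd w + Y) / (2 * PI))) as [A1 A2].
    set (l := up ((snd w + Y) / (2 * PI))) in *.
    assert (E : (snd w + Y) / (2 * PI) * (2 * PI) = snd w + Y) by (field; lra).
    assert (B1 : snd w + Y < 2 * PI * IZR l).
    { rewrite <- E. rewrite (Rmult_comm (2 * PI)). apply Rmult_lt_compat_r; lra. }
    assert (B2 : 2 * PI * IZR l <= snd w + Y + 2 * PI).
    { rewrite <- E at 1. replace ((snd w + Y) / (2 * PI) * (2 * PI) + 2 * PI) with (2 * PI * ((snd w + Y) / (2 * PI) + 1)) by ring.
      apply Rmult_le_compat_l; lra. }
    assert (aboveL l z) by (apply (HY l z); auto; lra).
    assert (~ aboveL l w) by (apply (HY l w); auto; lra).
    apply H2. apply (S0_aboveL l z w); auto. }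
  exists (Rabs (snd z0) + 2 * Rabs Y + 2 * PI). intros k z Hz Hf. rewrite strip_shift in Hz.
  assert (h0 : - M' <= fst z0) by (unfold M'; pose proof (Rmax_r M (- fst z0)); lra).
  assert (h1 : - M' <= fst (shift (- k) z)) by (simpl; unfold M'; pose proof (Rmax_l M (- fst z0)); lra).
  pose proof (Hkey _ _ Hz Hz0 h1 h0) as K1. pose proof (Hkey _ _ Hz0 Hz h0 h1) as K2.
  unfold shift in K1, K2; cbn [fst snd] in K1, K2. rewrite opp_IZR in *.
  pose proof (Rle_abs (snd z0)). pose proof (Rle_abs (- snd z0)) as h3. rewrite Rabs_Ropp in h3.
  apply Rabs_le. lra.
Qed.

Lemma strip_vert_bounded k : vert_bounded (T k).
Proof.
  intro M. destruct (strip_window M) as [W HW]. exists (W + Rabs (2 * PI * IZR k)). intros z Hz Hf.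
  specialize (HW k z Hz Hf). pose proof (Rabs_triang (snd z - 2 * PI * IZR k) (2 * PI * IZR k)) as h.
  replace (snd z - 2 * PI * IZR k + 2 * PI * IZR k) with (snd z) in h by ring. lra.
Qed.

(** Sides are constant on a strip, so a single reference point decides them, also for points
    arbitrarily far to the left, where heights say nothing. *)
Lemma strip_heights : exists m, (0 <= m)%Z /\ forall k z l, T k z ->
   ((l < k - m)%Z -> aboveL l z) /\ ((k + m < l)%Z -> ~ aboveL l z).
Proof.
  destruct S0_inhabited as [z0 Hz0]. destruct (aboveL_window (- fst z0)) as [Y HY]. pose proof PI_RGT_0.
  set (c := (Rabs Y + Rabs (snd z0)) / PI). pose proof (archimed c) as [A1 _].
  assert (Ec : c * PI = Rabs Y + Rabs (snd z0)) by (unfold c; field; lra).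
  pose proof (Rabs_pos Y). pose proof (Rabs_pos (snd z0)).
  assert (Hc : 0 <= c) by (apply Rmult_le_pos; [lra|left; apply Rinv_0_lt_compat; lra]).
  exists (up c). split. { apply le_IZR. simpl. lra. }
  intros k z l Hz. rewrite strip_shift in Hz.
  assert (Hl : aboveL l z <-> aboveL (l - k) z0).
  { pose proof (S0_aboveL (l - k) _ _ Hz Hz0) as h. rewrite aboveL_shift in h.
    replace (l - k - - k)%Z with l in h by lia. exact h. }
  pose proof (Rle_abs Y). pose proof (Rle_abs (snd z0)). pose proof (Rle_abs (- snd z0)) as h3. rewrite Rabs_Ropp in h3.
  rewrite Hl. split; intro h.
  - apply (HY (l - k)%Z z0); [lra|].
    assert (IZR (l - k) <= - IZR (up c)) by (rewrite <- opp_IZR; apply IZR_le; lia).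
    assert (c * PI <= PI * IZR (up c)) by nra. nra.
  - apply (HY (l - k)%Z z0); [lra|].
    assert (IZR (up c) <= IZR (l - k)) by (apply IZR_le; lia).
    assert (c * PI <= PI * IZR (up c)) by nra. nra.
Qed.

(** Images close to [f (L x)] on the ray have parameters close to [exp x], since the rest of the ray
    is closed. So a nearby cut point is a translate of a nearby point of [L]. *)
Lemma curve_isolated x r :
  r > 0 -> exists d, 0 < d <= r /\ forall w, Cdist w (L x) < d -> cut w -> on_curve L w.
Proof.
  intro Hr. destruct (L_cont x 1) as (e & He & HeL); [lra|].
  assert (Hgap : exists d, d > 0 /\ forall y, Cdist (f (L y)) (f (L x)) < d -> Rabs (y - x) < e).
  { assert (Hcl : closed (fun z => exists t, (0 <= t <= exp (x - e) \/ exp (x + e) <= t) /\ g t = z)).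
    { apply proper_image_closed; auto.
      - intros t Ht. apply NNPP. intro Hn.
        destruct (classic (t < 0)) as [h|h].
        + destruct (Ht (- t)) as (s & Hs & Hd); [lra|]. apply Rabs_def2 in Hd. pose proof (exp_pos (x + e)). lra.
        + assert (exp (x - e) < t < exp (x + e)) by lra.
          destruct (Ht (Rmin (t - exp (x - e)) (exp (x + e) - t))) as (s & Hs & Hd); [apply Rmin_glb_lt; lra|].
          pose proof (Rmin_l (t - exp (x - e)) (exp (x + e) - t)). pose proof (Rmin_r (t - exp (x - e)) (exp (x + e) - t)).
          apply Rabs_def2 in Hd. lra.
      - intro M. destruct (g_proper M) as [B HB]. exists B. intros t Ht HM.
        assert (0 <= t) by (pose proof (exp_pos (x + e)); lra). rewrite Rabs_pos_eq; auto. }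
    destruct (closed_compl _ Hcl (f (L x))) as [d [Hd Hd']].
    - intros (t & Ht & E). rewrite L_f in E.
      assert (exp (x - e) < exp x < exp (x + e)) by (split; apply exp_increasing; lra).
      pose proof (exp_pos x). pose proof (exp_pos (x + e)). apply g_inj in E; lra.
    - exists d. split; auto. intros y Hy. apply NNPP. intro Hn. apply (Hd' _ Hy). exists (exp y).
      rewrite L_f. split; auto. pose proof (exp_pos y).
      destruct (Rle_dec y (x - e)) as [h|h].
      + left. split; [lra|]. destruct h as [h|h]; [left; apply exp_increasing; auto|rewrite h; lra].
      + right. assert (x + e <= y) as h2.
        { apply Rnot_lt_le. intro h2. apply Hn. apply Rabs_def1; lra. }
        destruct h2 as [h2|h2]; [left; apply exp_increasing; auto|rewrite h2; lra]. }
  destruct Hgap as (d & Hd & H). destruct (expmap_cont a (L x) d Hd) as (d1 & Hd1 & H1).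
  (* Both [w] and [L y] are within 1 of [L x], so a translation by [2 * PI * l] between them has
     [l = 0]. *)
  exists (Rmin r (Rmin d1 1)). split; [split; [repeat apply Rmin_glb_lt; lra|apply Rmin_l]|].
  intros w Hw Hc. pose proof (Rmin_r r (Rmin d1 1)). pose proof (Rmin_l d1 1). pose proof (Rmin_r d1 1).
  apply cut_iff in Hc. destruct Hc as (y & l & E).
  assert (Hy : Rabs (y - x) < e).
  { apply H. rewrite <- (expmap_shift a l (L y)), <- E. apply H1. lra. }
  apply HeL in Hy. exists y. rewrite E.
  assert (l = 0%Z); [|subst l; symmetry; apply shift_0].
  apply IZR_small. pose proof PI_4. pose proof PI2_1.
  pose proof (Cdist_snd w (L x)) as h1. pose proof (Cdist_snd (L y) (L x)) as h2.
  assert (Es : snd w = snd (L y) + 2 * PI * IZR l) by (rewrite E; reflexivity). rewrite Es in h1.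
  assert (h3 : -1 < snd (L y) - snd (L x) < 1) by (split; [|]; apply Rabs_le_bounds in h2; lra).
  assert (h4 : -1 < snd (L y) + 2 * PI * IZR l - snd (L x) < 1) by (apply Rabs_le_bounds in h1; lra).
  apply Rabs_def1; nra.
Qed.

(** If both sides of the curve near [L x] had the same colour, a gap could be cut into the curve and the two
    remaining disjoint rays, neither of which separates the plane, would separate it. *)
Lemma curve_two_sided x r :
  r > 0 -> exists w w', Cdist w (L x) < r /\ Cdist w' (L x) < r /\ ~ cut w /\ ~ cut w' /\ above L w /\ ~ above L w'.
Proof.
  intro Hr. destruct (curve_isolated x r Hr) as (rho & [Hrho Hle] & Honly).
  apply NNPP. intro Hn.
  assert (Hv : exists v : R, (v = 0 \/ v = 1) /\ forall w, Cdist w (L x) < rho -> ~ on_curve L w -> indic (above L) w = v).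
  { destruct (classic (exists w, Cdist w (L x) < rho /\ ~ cut w /\ above L w)) as [(w & Hw & Hcw & Ha)|Hna].
    - exists 1. split; auto. intros w' Hw' Hc'. apply indic_1. apply NNPP. intro Hna. apply Hn.
      exists w, w'. repeat split; auto; lra.
    - exists 0. split; auto. intros w' Hw' Hc'. apply indic_0. intro Ha. apply Hna. exists w'. repeat split; auto. }
  destruct Hv as (v & Hv01 & Hv).
  destruct (L_cont x (rho / 2)) as (d & Hd & Hd'); [lra|].
  set (P1 := fun z => exists t, t <= x - d/2 /\ L t = z). set (P2 := fun z => exists t, x + d/2 <= t /\ L t = z).
  (* Points of the curve receive the common colour [v] of its surroundings, which makes [Q] locally
     constant across the gap. *)
  set (Q := fun z => if excluded_middle_informative (on_curve L z) then v = 1 else above L z).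
  assert (Lmono : forall s t, L s = L t -> s = t).
  { intros s t E. rewrite <- (shift_0 (L t)) in E. apply L_inj in E. tauto. }
  assert (C1 : closed P1).
  { apply subcurve_closed; auto using L_left, L_right. intros t Ht. apply Rnot_lt_le. intro h.
    destruct (Ht (t - (x - d/2))) as (s & Hs & Hds); [lra|]. apply Rabs_def2 in Hds. lra. }
  assert (C2 : closed P2).
  { apply subcurve_closed; auto using L_left, L_right. intros t Ht. apply Rnot_lt_le. intro h.
    destruct (Ht (x + d/2 - t)) as (s & Hs & Hds); [lra|]. apply Rabs_def2 in Hds. lra. }
  assert (Qoff : forall z, ~ on_curve L z -> indic Q z = indic (above L) z).
  { intros z Hz. unfold indic, Q. destruct (excluded_middle_informative (on_curve L z)); [tauto|reflexivity]. }
  assert (Qball : forall w, Cdist w (L x) < rho -> indic Q w = v).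
  { intros w Hw. destruct (classic (on_curve L w)) as [h|h]; [|rewrite Qoff; auto].
    unfold indic, Q. destruct (excluded_middle_informative (on_curve L w)); [|tauto].
    destruct excluded_middle_informative; destruct Hv01; auto; lra. }
  destruct (mayer_vietoris P1 P2 Q C1 C2) as (alpha & beta & Ha & Hb & E).
  - intros z (t & Ht & E1) (s & Hs & E2). rewrite <- E2 in E1. apply Lmono in E1. lra.
  - intros z [n1 n2]. destruct (classic (on_curve L z)) as [(t & <-)|h].
    + assert (Ht : Rabs (t - x) < d).
      { assert (x - d/2 < t) by (apply Rnot_le_lt; intro h; apply n1; exists t; auto).
        assert (t < x + d/2) by (apply Rnot_le_lt; intro h; apply n2; exists t; auto).
        apply Rabs_def1; lra. }
      apply Hd' in Ht. exists (rho / 2). split; [lra|]. intros w _ Hw.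
      rewrite !Qball; auto; [lra|]. pose proof (Cdist_triangle w (L t) (L x)). lra.
    + destruct (closed_compl _ (on_curve_closed L L_cont L_left L_right) z h) as (r1 & Hr1 & H1).
      destruct (above_loc_const L L_cont L_left L_right z h) as (r2 & Hr2 & H2).
      exists (Rmin r1 r2). split; [apply Rmin_glb_lt; auto|]. intros w _ Hw.
      pose proof (Rmin_l r1 r2). pose proof (Rmin_r r1 r2).
      assert (~ on_curve L w) by (apply H1; unfold ball; lra). rewrite !Qoff by auto. apply H2; auto; lra.
  - destruct (aboveL_window 0) as [Y HY]. destruct (L_window 0) as [Y' HY'].
    set (h := Rabs Y + Rabs Y' + 1). pose proof (Rle_abs Y). pose proof (Rle_abs Y').
    pose proof (Rabs_pos Y). pose proof (Rabs_pos Y').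
    assert (Hoff : forall s, Y' < Rabs s -> ~ on_curve L (0, s)).
    { intros s Hs (t & E1). assert (Rabs (snd (L t)) <= Y') by (apply HY'; rewrite E1; simpl; lra).
      rewrite E1 in *. simpl in *. lra. }
    assert (np : ~ on_curve L (0, h)) by (apply Hoff; rewrite Rabs_pos_eq; unfold h; lra).
    assert (nq : ~ on_curve L (0, - h)) by (apply Hoff; rewrite Rabs_left; unfold h; lra).
    assert (Hp : aboveL 0 (0, h)) by (apply (HY 0%Z (0, h)); unfold h; simpl; lra).
    assert (Hq : ~ aboveL 0 (0, - h)) by (apply (HY 0%Z (0, - h)); unfold h; simpl; lra).
    unfold aboveL in Hp, Hq. simpl Z.opp in Hp, Hq. rewrite shift_0 in Hp, Hq.
    (* The sign [e] orients the two remaining rays, one towards the left end and one towards the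
       right. *)
    assert (Hray : forall (s : R) (e : R), Rabs e = 1 ->
              unseparated (fun z => exists t, 0 <= t /\ L (s + e * t) = z) (0, h) (0, - h)).
    { intros s e He.
      assert (He0 : e <> 0) by (intros ->; rewrite Rabs_R0 in He; lra).
      apply (ray_unseparated (fun t => L (s + e * t))).
      - intro t. apply (cont_comp _ Rdist _ L (fun t => s + e * t)); [|apply L_cont].
        apply cont_plus; [apply cont_const, Rdist_refl|apply cont_scal, cont_id].
      - intros t1 t2 _ _ E1. apply Lmono in E1. apply (Rmult_eq_reg_l e); auto. lra.
      - intro M. destruct (curve_params_bounded L L_left L_right M) as [B HB]. exists (B + Rabs s).
        intros t Ht HM. pose proof (Cnorm_fst (L (s + e * t))). specialize (HB (s + e * t) ltac:(lra)).
        pose proof (Rabs_triang (s + e * t) (- s)) as h1. rewrite Rabs_Ropp in h1.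
        replace (s + e * t + - s) with (e * t) in h1 by ring. rewrite Rabs_mult, He, (Rabs_pos_eq t) in h1 by lra. lra.
      - intros (t & _ & E1). apply np. exists (s + e * t). auto.
      - intros (t & _ & E1). apply nq. exists (s + e * t). auto. }
    assert (Ea : alpha (0, h) = alpha (0, - h)).
    { apply (Hray (x - d/2) (-1)); [rewrite Rabs_left; lra|].
      apply (loc_const_sub (fun z => ~ P1 z)); auto. intros z Hz (t & Ht & E1). apply Hz.
      exists (x - d/2 - t). split; [lra|]. rewrite <- E1. f_equal. ring. }
    assert (Eb : beta (0, h) = beta (0, - h)).
    { apply (Hray (x + d/2) 1); [rewrite Rabs_pos_eq; lra|].
      apply (loc_const_sub (fun z => ~ P2 z)); auto. intros z Hz (t & Ht & E1). apply Hz.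
      exists (t - (x + d/2)). split; [lra|]. rewrite <- E1. f_equal. ring. }
    assert (Hno : forall z, ~ on_curve L z -> ~ P1 z /\ ~ P2 z).
    { intros z Hz. split; intros (t & _ & E1); apply Hz; exists t; auto. }
    pose proof (E (0, h) (proj1 (Hno _ np)) (proj2 (Hno _ np))) as E1.
    pose proof (E (0, - h) (proj1 (Hno _ nq)) (proj2 (Hno _ nq))) as E2.
    rewrite Qoff, indic_1 in E1 by auto. rewrite Qoff, indic_0 in E2 by auto. lra.
Qed.

(** Otherwise all uncut points near [z] would belong to the strip of index [k]. But they lie on both
    sides of the curve through [z], and a strip lies on one side. *)
Lemma cut_adherent z k : cut z -> exists j, j <> k /\ closure (T j) z.
Proof.
  intro Hz. apply cut_iff in Hz. destruct Hz as (x & l & ->).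
  apply NNPP. intro Hn.
  destruct (strip_window (Rabs (fst (L x)) + 1)) as [W HW]. pose proof PI2_1 as Hpi.
  set (z := shift l (L x)) in *.
  (* Only strips of index below [N] in modulus come within distance 1 of [z], so finitely many radii
     have to be minimised. *)
  destruct (INR_unbounded (W + Rabs (snd z) + 1)) as [N HN].
  assert (Hfin : forall n : nat, exists r, r > 0 /\ forall j w, (Z.abs j < Z.of_nat n)%Z -> T j w -> Cdist w z < r -> j = k).
  { assert (Hone : forall j, exists r, r > 0 /\ forall w, T j w -> Cdist w z < r -> j = k).
    { intro j. destruct (Z.eq_dec j k) as [->|hj]; [exists 1; split; [lra|auto]|].
      apply NNPP. intro Hn2. apply Hn. exists j. split; auto. intros e He. apply NNPP. intro Hn3.
      apply Hn2. exists e. split; auto. intros w Tw Hw. exfalso. apply Hn3. exists w. rewrite Cdist_sym. auto. }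
    induction n as [|n (r & Hr & IH)]; [exists 1; split; [lra|intros; lia]|].
    destruct (Hone (Z.of_nat n)) as (r1 & Hr1 & H1). destruct (Hone (- Z.of_nat n)%Z) as (r2 & Hr2 & H2).
    exists (Rmin r (Rmin r1 r2)). split; [repeat apply Rmin_glb_lt; auto|].
    intros j w Hj Tw Hw. pose proof (Rmin_l r (Rmin r1 r2)). pose proof (Rmin_r r (Rmin r1 r2)).
    pose proof (Rmin_l r1 r2). pose proof (Rmin_r r1 r2).
    destruct (Z.lt_ge_cases (Z.abs j) (Z.of_nat n)) as [h|h].
    - apply (IH j w); auto. lra.
    - assert (j = Z.of_nat n \/ j = - Z.of_nat n)%Z as [->| ->] by lia.
      + apply (H1 w); auto. lra.
      + apply (H2 w); auto. lra. }
  destruct (Hfin N) as (r & Hr & HN').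
  destruct (curve_two_sided x (Rmin r 1)) as (w & w' & d1 & d2 & c1 & c2 & a1 & a2); [apply Rmin_glb_lt; lra|].
  pose proof (Rmin_l r 1). pose proof (Rmin_r r 1).
  assert (Hk : forall v, Cdist v (L x) < Rmin r 1 -> ~ cut v -> T k (shift l v)).
  { intros v Hv Hc. destruct (strip_cover (shift l v)) as [j Hj]; [rewrite cut_shift; auto|].
    assert (Hd : Cdist (shift l v) z < Rmin r 1) by (unfold z; rewrite shift_dist; auto).
    assert (Ej : j = k); [|subst j; auto]. apply (HN' j (shift l v)); auto; [|lra].
    specialize (HW j _ Hj). pose proof (Cdist_fst (shift l v) z) as f1. pose proof (Cdist_snd (shift l v) z) as f2.
    assert (Hf : fst z = fst (L x)) by reflexivity.
    pose proof (Rle_abs (- fst (L x))) as f3. rewrite Rabs_Ropp in f3.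
    apply Rabs_le_bounds in f1. rewrite Hf in f1.
    specialize (HW ltac:(lra)).
    apply lt_IZR. rewrite <- INR_IZR_INZ, abs_IZR.
    pose proof (Rabs_triang (- (snd (shift l v) - 2 * PI * IZR j)) (snd (shift l v))) as t1.
    replace (- (snd (shift l v) - 2 * PI * IZR j) + snd (shift l v)) with (2 * PI * IZR j) in t1 by ring.
    rewrite Rabs_Ropp, Rabs_mult, (Rabs_pos_eq (2 * PI)) in t1 by lra.
    pose proof (Rabs_triang (snd (shift l v) - snd z) (snd z)) as t2.
    replace (snd (shift l v) - snd z + snd z) with (snd (shift l v)) in t2 by ring.
    pose proof (Rabs_pos (IZR j)). nra. }
  apply a2. pose proof (strip_aboveL k l _ _ (Hk w d1 c1) (Hk w' d2 c2)) as h.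
  rewrite !aboveL_shift in h. replace (l - l)%Z with 0%Z in h by lia.
  unfold aboveL in h. simpl Z.opp in h. rewrite !shift_0 in h. tauto.
Qed.

(** Where an orbit meets the cut, its itinerary can be changed in a single entry. *)
Lemma unique_itinerary z u :
  is_itinerary f S0 z u -> (forall v, is_itinerary f S0 z v -> forall j, v j = u j) ->
  forall n, T (u n) (fiter f n z).
Proof.
  intros Hu Huniq n. apply strip_closure; [|apply Hu]. intro Hc.
  destruct (cut_adherent _ (u n) Hc) as (k & Hk & Hcl). apply Hk.
  pose proof (Huniq (fun j => if Nat.eq_dec j n then k else u j)) as H. cbv beta in H.
  specialize (H ltac:(intro j; destruct (Nat.eq_dec j n) as [->|]; auto) n).
  destruct (Nat.eq_dec n n); auto. tauto.
Qed.

(** * Escaping points near the cut, and unbounded sets of nonescaping points *)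

Hypothesis g_esc : forall t, 0 < t -> escaping f (g t).

Lemma cut_escaping z : cut z -> escaping f z.
Proof. intro H. apply cut_gpos in H. destruct H as (t & Ht & E). apply escaping_f. rewrite E. auto. Qed.

Lemma fiter_open z n e :
  e > 0 -> exists d, d > 0 /\ forall w, Cdist w (fiter f n z) < d -> exists y, fiter f n y = w /\ Cdist y z < e.
Proof.
  revert e. induction n as [|n IH]; intros e He.
  - exists e. split; auto. intros w Hw. exists w. auto.
  - destruct (IH e He) as (d & Hd & H). destruct (expmap_open a (fiter f n z) d Hd) as (d' & Hd' & H').
    exists d'. split; auto. intros w Hw. destruct (H' w Hw) as (v & Ev & Hv). destruct (H v Hv) as (y & Ey & Hy).
    exists y. split; auto. simpl. congruence.
Qed.

(** [L] meets every vertical line, and its translates repeat at height 2 pi, which is less than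
    10. *)
Lemma cut_near w : exists c, cut c /\ Cdist c w <= 10.
Proof.
  assert (Hx : exists x, fst (L x) = fst w).
  { apply NNPP. intro Hn. destruct (L_left (fst w)) as [X0 H0]. destruct (L_right (fst w)) as [X1 H1].
    assert (fst (L X1) < fst w).
    { apply (avoid_value (fun x => fst (L x)) (fst w)) with (s := X0).
      - intro x. apply (cont_fst _ L), L_cont.
      - eauto.
      - apply H0. lra. }
    specialize (H1 X1 (Rle_refl _)). lra. }
  destruct Hx as [x Hx]. set (q := (snd w - snd (L x)) / (2 * PI)). destruct (archimed q) as [A1 A2].
  pose proof PI_RGT_0. pose proof PI_4.
  assert (Eq : q * (2 * PI) = snd w - snd (L x)) by (unfold q; field; lra).
  exists (shift (up q) (L x)). split; [apply cut_curve|].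
  eapply Rle_trans; [apply Cdist_le_sum|]. unfold shift. cbn [fst snd]. rewrite Hx.
  replace (fst w - fst w) with 0 by ring. rewrite Rabs_R0.
  assert (0 <= 2 * PI * (IZR (up q) - q) <= 2 * PI) by nra.
  rewrite Rabs_pos_eq; lra.
Qed.

(** A cut point near f^(N+m)(z) is pulled back along the orbit of [z], where [f] expands. *)
Lemma cut_dense z e : escaping f z -> e > 0 -> exists y m, Cdist y z < e /\ cut (fiter f m y).
Proof.
  (* With modulus of the derivative above 80, the distance 10 is within the range 80/2 of the local
     inverse, whose factor 4/80 is below 1/2. *)
  intros Hz He. destruct (escaping_fst a z (ln 80) Hz) as [N HN].
  assert (Hexp : forall n, (N <= n)%nat -> 80 < exp (fst (fiter f n z))).
  { intros n Hn. rewrite <- (exp_ln 80) by lra. apply exp_increasing. auto. }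
  assert (Hpull : forall m w, Cdist w (fiter f (N + m) z) <= 10 ->
            exists y, fiter f m y = w /\ Cdist y (fiter f N z) <= Cdist w (fiter f (N + m) z) * (/ 2) ^ m).
  { induction m as [|m IH]; intros w Hw.
    - rewrite Nat.add_0_r in *. exists w. simpl. split; auto. lra.
    - rewrite Nat.add_succ_r in *. simpl fiter in Hw. specialize (Hexp (N + m)%nat ltac:(lia)).
      destruct (expmap_local_inverse a (fiter f (N + m) z) w) as (v & Ev & Hv); [lra|].
      pose proof (Cdist_nonneg w (f (fiter f (N + m) z))) as Hnn.
      assert (Hv2 : Cdist v (fiter f (N + m) z) <= Cdist w (f (fiter f (N + m) z)) * / 2).
      { eapply Rle_trans; [exact Hv|].
        apply (Rmult_le_reg_r (exp (fst (fiter f (N + m) z)))); [lra|].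
        replace (4 * (Cdist w (f (fiter f (N + m) z)) / exp (fst (fiter f (N + m) z))) * exp (fst (fiter f (N + m) z)))
          with (4 * Cdist w (f (fiter f (N + m) z))) by (field; lra). nra. }
      destruct (IH v) as (y & Ey & Hy); [lra|]. exists y. split; [simpl; congruence|].
      eapply Rle_trans; [exact Hy|]. simpl fiter.
      replace (Cdist w (f (fiter f (N + m) z)) * (/ 2) ^ S m) with (Cdist w (f (fiter f (N + m) z)) * / 2 * (/ 2) ^ m) by (simpl; ring).
      apply Rmult_le_compat_r; auto. apply pow_le. lra. }
  destruct (fiter_open z N e He) as (d & Hd & Hopen).
  destruct (pow_lt_1_zero (/ 2)) with (y := d / 10) as [m Hm]; [rewrite Rabs_pos_eq; lra|lra|].
  specialize (Hm m (le_n _)). rewrite Rabs_pos_eq in Hm by (apply pow_le; lra).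
  destruct (cut_near (fiter f (N + m) z)) as (c & Hc & Hdc).
  destruct (Hpull m c Hdc) as (y & Ey & Hy).
  destruct (Hopen y) as (x & Ex & Hx).
  - eapply Rle_lt_trans; [exact Hy|]. pose proof (pow_le (/ 2) m ltac:(lra)).
    assert (Cdist c (fiter f (N + m) z) * (/ 2) ^ m <= 10 * (/ 2) ^ m) by (apply Rmult_le_compat_r; auto). lra.
  - exists x, (m + N)%nat. split; auto. rewrite fiter_add, Ex, Ey. auto.
Qed.

(** * Growth at most like an iterated exponential *)

Fixpoint tower (x : R) (n : nat) : R := match n with O => x | S n => exp (tower x n) end.

Lemma tower_nonneg x n : 0 <= x -> 0 <= tower x n.
Proof. intro H. destruct n; simpl; auto. left; apply exp_pos. Qed.

Lemma exp_ge_1 x : 0 <= x -> 1 <= exp x.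
Proof. intro H. pose proof (exp_ineq1_le x). lra. Qed.

(** Additive errors at any level can be absorbed into the starting value. *)
Lemma tower_add x c n : 0 <= x -> 0 <= c -> tower x n + c <= tower (x + c) n.
Proof.
  intros Hx Hc. induction n as [|n IH]; simpl; [lra|].
  apply Rle_trans with (exp (tower x n + c)).
  - rewrite exp_plus. pose proof (exp_ge_1 (tower x n) (tower_nonneg x n Hx)). pose proof (exp_ineq1_le c). nra.
  - destruct IH as [h|h]; [left; apply exp_increasing; auto|rewrite h; lra].
Qed.

Lemma tower_ge x n : 0 <= x -> x + INR n <= tower x n.
Proof.
  intro Hx. induction n as [|n IH]; [simpl; lra|]. rewrite S_INR. simpl. pose proof (exp_ineq1_le (tower x n)). lra.
Qed.

Lemma tower_step x n m : 0 <= x -> (n <= m)%nat -> tower x n <= tower x m.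
Proof.
  intros Hx H. induction H as [|m H IH]; [lra|]. simpl. pose proof (exp_ineq1_le (tower x m)). lra.
Qed.

Lemma orbit_tower z : exists x, 0 <= x /\ forall n, Cnorm (fiter f n z) <= tower x n.
Proof.
  (* The induction needs [Cnorm a + c <= exp c - 1], which for this [c] is [2 * c <= exp c]. *)
  set (c := Cnorm a + 1). pose proof (Cnorm_nonneg a) as Ha. pose proof (Cnorm_nonneg z) as Hz.
  assert (H : forall n, Cnorm (fiter f n z) + c <= tower (Cnorm z + c) n).
  { induction n as [|n IH]; [simpl; lra|]. cbn [tower fiter].
    pose proof (expmap_norm_le a (fiter f n z)) as h1.
    pose proof (Cnorm_fst (fiter f n z)). pose proof (Rle_abs (fst (fiter f n z))).
    pose proof (Cnorm_nonneg (fiter f n z)) as Hn.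
    assert (h2 : exp (fst (fiter f n z)) <= exp (Cnorm (fiter f n z))).
    { destruct (Req_dec (fst (fiter f n z)) (Cnorm (fiter f n z))) as [->|]; [lra|left; apply exp_increasing; lra]. }
    assert (h3 : exp (Cnorm (fiter f n z) + c) <= exp (tower (Cnorm z + c) n)).
    { destruct IH as [h| <-]; [left; apply exp_increasing; auto|lra]. }
    rewrite exp_plus in h3. pose proof (exp_ge_1 _ Hn) as h4.
    assert (h5 : 2 * c <= exp c).
    { replace c with (c / 2 + c / 2) at 2 by field. rewrite exp_plus. pose proof (exp_ineq1_le (c/2)) as h6.
      assert (0 <= c) by (unfold c; lra).
      assert ((1 + c/2) * (1 + c/2) <= exp (c/2) * exp (c/2)) by (apply Rmult_le_compat; lra).
      pose proof (Rle_0_sqr (1 - c/2)) as h7. unfold Rsqr in h7. lra. }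
    assert (1 <= exp c) by (apply exp_ge_1; unfold c; lra).
    assert (exp c - 1 <= exp (Cnorm (fiter f n z)) * (exp c - 1)) by nra.
    unfold c in *. lra. }
  exists (Cnorm z + c). split; [unfold c; lra|]. intro n. specialize (H n). unfold c in *. lra.
Qed.

Definition tower_bounded (k : nat -> Z) : Prop := exists x, 0 <= x /\ forall n, 2 * PI * Rabs (IZR (k n)) <= tower x n.

Definition left_unbounded (E : Cplx -> Prop) : Prop := forall M, exists z, E z /\ fst z < - M.

Lemma not_left_unbounded E : ~ left_unbounded E -> exists M, forall z, E z -> - M <= fst z.
Proof.
  intro H. apply NNPP. intro Hn. apply H. intro M. apply NNPP. intro Hn2. apply Hn. exists M.
  intros z Ez. apply Rnot_lt_le. intro h. apply Hn2. eauto.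
Qed.

(** Far to the right, the points of [E] whose first [n] images stay to the right form a relatively clopen
    subset of [E]; by compactness it misses the line [Re z = B 0] for large [n], as a limit point would escape.
    Hence it is empty, which is absurd if no image of [E] is left-unbounded. *)
Lemma nonescaping_left_unbounded (E : Cplx -> Prop) (k : nat -> Z) R0 :
  connected E -> ~ bounded E -> (forall n z, E z -> T (k n) (fiter f n z)) ->
  (forall z, closure E z -> escaping f z -> fst z <= R0) -> tower_bounded k ->
  exists j, left_unbounded (image (fiter f j) E).
Proof.
  intros Hconn Hunb Hstr Hcl (x & Hx & Htow). apply NNPP. intro Hno.
  assert (Hlb : forall j, exists M, forall z, E z -> - M <= fst (fiter f j z)).
  { intro j. destruct (not_left_unbounded (image (fiter f j) E)) as [M HM].
    - intro h. apply Hno. eauto.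
    - exists M. intros z Ez. apply HM. exists z. auto. }
  destruct (strip_window 0) as [W HW].
  assert (Hne : exists e0, E e0).
  { apply NNPP. intro h. apply Hunb. exists 0. intros z Ez. exfalso; eauto. }
  destruct Hne as [e0 He0].
  (* [Rabs W] passes from strip indices to heights. [R0] and [e0] put the starting line to the right
     of the admissible escaping limit points and of one point of [E]. The rest absorbs [a] and the
     constants. *)
  set (y0 := x + (Rabs W + Rabs R0 + Rabs (fst e0) + Cnorm a + 10)).
  pose proof (Rle_abs W). pose proof (Rabs_pos W). pose proof (Rle_abs R0). pose proof (Rabs_pos R0).
  pose proof (Rle_abs (fst e0)). pose proof (Rabs_pos (fst e0)). pose proof (Cnorm_nonneg a) as Ha.
  assert (Hy0 : 0 <= y0) by (unfold y0; lra).
  set (B := fun n => tower y0 n + 2).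
  assert (HyB : forall n, y0 + INR n + 2 <= B n).
  { intro n. unfold B. pose proof (tower_ge y0 n Hy0). lra. }
  assert (HBpos : forall n, 0 < B n) by (intro n; specialize (HyB n); pose proof (pos_INR n); lra).
  assert (Him : forall n z, E z -> 0 <= fst (fiter f n z) -> Rabs (snd (fiter f n z)) <= tower y0 n).
  { intros n z Ez Hf. specialize (HW _ _ (Hstr n z Ez) ltac:(lra)).
    pose proof (Rabs_triang (snd (fiter f n z) - 2 * PI * IZR (k n)) (2 * PI * IZR (k n))) as h.
    replace (snd (fiter f n z) - 2 * PI * IZR (k n) + 2 * PI * IZR (k n)) with (snd (fiter f n z)) in h by ring.
    rewrite (Rabs_mult (2 * PI)), (Rabs_pos_eq (2 * PI)) in h by (pose proof PI_RGT_0; lra).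
    specialize (Htow n).
    pose proof (tower_add x (Rabs W + Rabs R0 + Rabs (fst e0) + Cnorm a + 10) n Hx ltac:(lra)). unfold y0. lra. }
  (* If the next real part is nonnegative, the next height is at most a tower, while the modulus is
     at least [exp 2] times that tower minus [Cnorm a]. So real parts between 0 and [B (S n)] do not
     occur; this gap makes [D n] relatively open. *)
  assert (Hstep : forall n z, E z -> B n <= fst (fiter f n z) -> 0 <= fst (fiter f (S n) z) -> B (S n) <= fst (fiter f (S n) z)).
  { intros n z Ez HB Hf. pose proof (Him (S n) z Ez Hf) as h1. cbn [fiter] in *.
    pose proof (expmap_norm_ge a (fiter f n z)) as h2.
    pose proof (Cnorm_le_sum (f (fiter f n z))) as h3. rewrite (Rabs_pos_eq (fst _)) in h3 by auto.
    assert (h4 : exp (B n) <= exp (fst (fiter f n z))).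
    { destruct HB as [h| <-]; [left; apply exp_increasing; auto|lra]. }
    unfold B in h4 at 1. rewrite exp_plus in h4. change (exp (tower y0 n)) with (tower y0 (S n)) in h4.
    pose proof (exp_ineq1_le 2) as h5. pose proof (tower_ge y0 (S n) Hy0) as h6. pose proof (pos_INR (S n)).
    unfold B. unfold y0 in h6 at 1. nra. }
  set (D := fun n z => forall j, (j <= n)%nat -> B j <= fst (fiter f j z)).
  assert (Hfar : exists n, forall z, E z -> D n z -> fst z <> B 0%nat).
  { apply NNPP. intro Hn.
    assert (Hseq : forall n, exists z, E z /\ D n z /\ fst z = B 0%nat).
    { intro n. apply NNPP. intro Hn2. apply Hn. exists n. intros z Ez Dz e. apply Hn2. eauto. }
    set (s := fun n => proj1_sig (constructive_indefinite_description _ (Hseq n))).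
    assert (Hs : forall n, E (s n) /\ D n (s n) /\ fst (s n) = B 0%nat).
    { intro n. unfold s. destruct constructive_indefinite_description as [q Hq]. exact Hq. }
    clearbody s.
    destruct (cluster_exists s (B 0%nat + tower y0 0)) as [y Hy].
    { intro n. destruct (Hs n) as (h1 & _ & h3). eapply Rle_trans; [apply Cnorm_le_sum|].
      specialize (HBpos 0%nat). pose proof (Him 0%nat (s n) h1) as h4. cbn [fiter] in h4.
      rewrite h3 in *. rewrite Rabs_pos_eq by lra. specialize (h4 ltac:(lra)). lra. }
    assert (Hyj : forall j, B j <= fst (fiter f j y)).
    { intro j. apply Rnot_lt_le. intro h.
      destruct (cluster_cont s y (fiter f j) Hy (fiter_cont a j y) (B j - fst (fiter f j y))) with (N := j) as (n & Hn1 & Hn2); [lra|].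
      destruct (Hs n) as (_ & h2 & _). specialize (h2 j Hn1).
      pose proof (Cdist_fst (fiter f j (s n)) (fiter f j y)) as h3. apply Rabs_le_bounds in h3. lra. }
    assert (fst y <= R0).
    { apply Hcl.
      - apply (cluster_closure E s); auto. intro n. apply Hs.
      - apply escaping_of_fst. intro M. destruct (INR_unbounded M) as [N HN]. exists N. intros n Hn1.
        apply le_INR in Hn1. specialize (Hyj n). specialize (HyB n). lra. }
    specialize (Hyj 0%nat). specialize (HyB 0%nat). cbn [fiter] in Hyj. simpl in HyB. unfold y0 in HyB. lra. }
  destruct Hfar as [n Hn].
  assert (Hempty : forall z, E z -> ~ D n z).
  { intros z Ez Dz.
    assert (HF : loc_const E (indic (D n))).
    { intros v Ev. destruct (classic (D n v)) as [Dv|Dv].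
      - assert (Hind : forall m, (m <= n)%nat -> exists r, r > 0 /\ forall w, E w -> Cdist w v < r -> D m w).
        { induction m as [|m IH]; intro Hm.
          - pose proof (Hn v Ev Dv) as hne. pose proof (Dv 0%nat ltac:(lia)) as h0. cbn [fiter] in h0.
            exists (fst v - B 0%nat). split; [lra|]. intros w _ Hw j Hj. replace j with 0%nat by lia. cbn [fiter].
            pose proof (Cdist_fst w v) as h1. apply Rabs_le_bounds in h1. lra.
          - destruct (IH ltac:(lia)) as (r1 & Hr1 & Hc1). pose proof (Dv (S m) Hm) as h0. specialize (HBpos (S m)).
            destruct (fiter_cont a (S m) v (B (S m)) HBpos) as (r2 & Hr2 & Hc2).
            exists (Rmin r1 r2). split; [apply Rmin_glb_lt; auto|]. intros w Ew Hw j Hj.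
            pose proof (Rmin_l r1 r2). pose proof (Rmin_r r1 r2).
            assert (Dm : D m w) by (apply Hc1; auto; lra).
            destruct (Nat.eq_dec j (S m)) as [->|hj]; [|apply Dm; lia].
            apply Hstep; auto. specialize (Hc2 w ltac:(lra)).
            pose proof (Cdist_fst (fiter f (S m) w) (fiter f (S m) v)) as h1. apply Rabs_le_bounds in h1. lra. }
        destruct (Hind n (le_n _)) as (r & Hr & H'). exists r. split; auto. intros w Ew Hw. rewrite !indic_1; auto.
      - assert (exists j, (j <= n)%nat /\ fst (fiter f j v) < B j) as (j & Hj & Hjv).
        { apply NNPP. intro h. apply Dv. intros j Hj. apply Rnot_lt_le. intro. apply h. eauto. }
        destruct (fiter_cont a j v (B j - fst (fiter f j v))) as (r & Hr & H'); [lra|].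
        exists r. split; auto. intros w Ew Hw. rewrite !indic_0; auto.
        intro Dw. specialize (Dw j Hj). specialize (H' w Hw).
        pose proof (Cdist_fst (fiter f j w) (fiter f j v)) as h1. apply Rabs_le_bounds in h1. lra. }
    pose proof (connected_loc_const E (indic (D n)) Hconn HF z e0 Ez He0) as Eq.
    apply (indic_eq _ _ _ Eq) in Dz. specialize (Dz 0%nat ltac:(lia)). cbn [fiter] in Dz.
    specialize (HyB 0%nat). simpl in HyB. unfold y0 in HyB. lra. }
  (* Points far to the right have images of large modulus and, no image being left-unbounded, of
     bounded height; so these images are again far to the right. *)
  assert (Hbig : forall j V, exists Z, forall z, E z -> Z <= fst z -> V <= fst (fiter f j z)).
  { induction j as [|j IH]; intro V; [exists V; auto|].
    destruct (Hlb (S j)) as [M HM]. destruct (strip_vert_bounded (k (S j)) M) as [W' HW'].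
    set (V' := Rabs V + Rabs M + Rabs W' + Cnorm a).
    destruct (IH V') as [Z HZ]. exists Z. intros z Ez Hz. specialize (HZ z Ez Hz). specialize (HM z Ez).
    specialize (HW' _ (Hstr (S j) z Ez) HM). cbn [fiter] in *.
    pose proof (expmap_norm_ge a (fiter f j z)) as h2. pose proof (exp_ineq1_le (fst (fiter f j z))) as h3.
    pose proof (Cnorm_le_sum (f (fiter f j z))) as h4.
    pose proof (Rle_abs V). pose proof (Rle_abs M). pose proof (Rle_abs W'). pose proof (Rabs_pos V). pose proof (Rabs_pos M).
    unfold V' in HZ. revert h4. unfold Rabs at 1. destruct Rcase_abs; intro; lra. }
  assert (Hall : exists Z, forall z, E z -> Z <= fst z -> D n z).
  { clear Hn Hempty. induction n as [|n [Z HZ]].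
    - exists (B 0%nat). intros z _ Hz j Hj. replace j with 0%nat by lia. exact Hz.
    - destruct (Hbig (S n) (B (S n))) as [Z' HZ']. exists (Rmax Z Z'). intros z Ez Hz j Hj.
      pose proof (Rmax_l Z Z'). pose proof (Rmax_r Z Z').
      destruct (Nat.eq_dec j (S n)) as [->|hj]; [apply HZ'; auto; lra|apply HZ; auto; [lra|lia]]. }
  destruct Hall as [Z HZ]. destruct (Hlb 0%nat) as [M HM]. destruct (strip_vert_bounded (k 0%nat) M) as [W' HW'].
  apply Hunb. exists (Rabs Z + Rabs M + Rabs W'). intros z Ez. apply Rnot_lt_le. intro h.
  apply (Hempty z Ez), HZ; auto. specialize (HM z Ez). specialize (HW' _ (Hstr 0%nat z Ez) HM). cbn [fiter] in *.
  pose proof (Cnorm_le_sum z) as h4.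
  pose proof (Rle_abs Z). pose proof (Rle_abs M). pose proof (Rle_abs W'). pose proof (Rabs_pos Z). pose proof (Rabs_pos M).
  revert h4. unfold Rabs at 1. destruct Rcase_abs; intro; lra.
Qed.

Variable u : nat -> Z.
Hypothesis u_orbit : forall n, T (u n) (fiter f n a).

Lemma left_unbounded_itinerary (E : Cplx -> Prop) (k : nat -> Z) j :
  (forall n z, E z -> T (k n) (fiter f n z)) -> left_unbounded (image (fiter f j) E) ->
  forall i, k (S j + i)%nat = u i.
Proof.
  intros Hstr Hleft i. apply (strip_closure_disjoint _ _ (fiter f i a)); auto.
  apply (closure_mono (image (fiter f i) (image (fiter f (S j)) E))).
  - intros w (v & (z & Ez & <-) & <-). rewrite <- fiter_add. replace (i + S j)%nat with (S j + i)%nat by lia. auto.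
  - apply closure_image_cont; [apply fiter_cont|]. intros e He.
    destruct (Hleft (- ln e)) as (w & (z & Ez & <-) & Hw).
    exists (fiter f (S j) z). split; [exists z; auto|]. cbn [fiter]. rewrite Cdist_sym, expmap_dist.
    rewrite <- (exp_ln e) by auto. apply exp_increasing. lra.
Qed.

Lemma connected_strips (A : Cplx -> Prop) :
  connected A -> (forall z, A z -> ~ escaping f z) ->
  exists k : nat -> Z, forall n z, A z -> T (k n) (fiter f n z).
Proof.
  intros HA Hne.
  assert (H : forall n, exists j, forall z, A z -> T j (fiter f n z)).
  { intro n. destruct (classic (exists z0, A z0)) as [[z0 Az0]|Hno]; [|exists 0%Z; intros z Az; exfalso; eauto].
    assert (Huncut : forall w, image (fiter f n) A w -> ~ cut w).
    { intros w (z & Az & <-) Hc. apply (Hne z Az), (escaping_fiter a n), cut_escaping, Hc. }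
    destruct (strip_cover (fiter f n z0)) as [j Hj]; [apply Huncut; exists z0; auto|].
    exists j. intros z Az. apply (strip_maximal (image (fiter f n) A) j (fiter f n z0)); auto.
    - apply image_connected; auto. apply fiter_cont.
    - exists z0. auto.
    - exists z. auto. }
  exists (fun n => proj1_sig (constructive_indefinite_description _ (H n))).
  intro n. destruct constructive_indefinite_description as [j Hj]. exact Hj.
Qed.

(** The time [p] may lag behind [t], which permits an orbit to be restarted: a shorter tower is a
    smaller one. *)
Lemma tower_bounded_intro (k : nat -> Z) w c N0 :
  (forall t, (N0 <= t)%nat -> exists p, (p <= t)%nat /\ 2 * PI * Rabs (IZR (k t)) <= Cnorm (fiter f p w) + c) ->
  tower_bounded k.
Proof.
  intro H. destruct (orbit_tower w) as (x & Hx & Hw).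
  destruct (finite_bound (fun t => 2 * PI * Rabs (IZR (k t))) N0) as (M & HM & Hfin).
  pose proof (Rabs_pos c). pose proof (Rle_abs c).
  exists (x + (Rabs c + M)). split; [lra|]. intro t.
  pose proof (tower_add x (Rabs c + M) t Hx ltac:(lra)) as h1. pose proof (tower_nonneg x t Hx) as h2.
  destruct (Nat.lt_ge_cases t N0) as [h|h].
  - specialize (Hfin t h). pose proof (Rle_abs (2 * PI * Rabs (IZR (k t)))). lra.
  - destruct (H t h) as (p & Hp & Hk). specialize (Hw p). pose proof (tower_step x p t Hx Hp). lra.
Qed.

Lemma tower_bounded_shift k n : tower_bounded k -> tower_bounded (fun m => k (n + m)%nat).
Proof.
  intros (x & Hx & H). exists (tower x n). split; [apply tower_nonneg; auto|]. intro m.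
  replace (tower (tower x n) m) with (tower x (n + m)); auto.
  rewrite Nat.add_comm. induction m as [|m IH]; simpl; congruence.
Qed.

(** Once the orbit is in the right half-plane, [strip_window] compares index and height. The
    finitely many earlier indices go into [c]. *)
Lemma strip_index_bound w :
  escaping f w -> exists c, forall p j, T j (fiter f p w) -> 2 * PI * Rabs (IZR j) <= Cnorm (fiter f p w) + c.
Proof.
  intro Hw. destruct (escaping_fst a w 0 Hw) as [N HN]. destruct (strip_window 0) as [W HW].
  (* The index of the strip visited at time [p], with value 0 if the orbit is then on the cut. *)
  set (kap := fun p => match excluded_middle_informative (exists j, T j (fiter f p w)) with
                       | left h => IZR (proj1_sig (constructive_indefinite_description _ h)) | right _ => 0 end).
  destruct (finite_bound kap N) as (M & HM & Hfin). pose proof PI_RGT_0.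
  exists (Rabs W + 2 * PI * M). intros p j Hj. pose proof (Rle_abs W). pose proof (Rabs_pos W).
  destruct (Nat.lt_ge_cases p N) as [h|h].
  - specialize (Hfin p h). unfold kap in Hfin.
    destruct (excluded_middle_informative (exists j, T j (fiter f p w))) as [e|e]; [|exfalso; eauto].
    destruct constructive_indefinite_description as [j' Hj']. simpl in Hfin.
    rewrite (strip_disjoint j j' _ Hj Hj'). pose proof (Cnorm_nonneg (fiter f p w)). nra.
  - specialize (HN p h). specialize (HW j _ Hj ltac:(lra)).
    pose proof (Rabs_triang (- (snd (fiter f p w) - 2 * PI * IZR j)) (snd (fiter f p w))) as t1.
    replace (- (snd (fiter f p w) - 2 * PI * IZR j) + snd (fiter f p w)) with (2 * PI * IZR j) in t1 by ring.
    rewrite Rabs_Ropp, Rabs_mult, (Rabs_pos_eq (2 * PI)) in t1 by lra.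
    pose proof (Cnorm_snd (fiter f p w)). nra.
Qed.

(** * Nonescaping connected sets separating the escaping set *)

Variable K : Cplx -> Prop.
Hypothesis K_connected : connected K.
Hypothesis K_closed : closed K.
Hypothesis K_nonescaping : forall z, K z -> ~ escaping f z.
Variable k : nat -> Z.
Hypothesis K_strip : forall n z, K z -> T (k n) (fiter f n z).
Notation Kn n := (image (fiter f n) K).

Definition orbit_before (n : nat) (z : Cplx) : Prop := exists i, (i < n)%nat /\ fiter f i a = z.

Lemma Kn_nonescaping n z : Kn n z -> ~ escaping f z.
Proof. intros (w & Kw & <-) H. apply (K_nonescaping w Kw). apply (escaping_fiter a n). auto. Qed.

Lemma Kn_strip n z : Kn n z -> T (k n) z.
Proof. intros (w & Kw & <-). auto. Qed.

Lemma image_S n E z : image (fiter f (S n)) E z <-> image f (image (fiter f n) E) z.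
Proof.
  split.
  - intros (w & Ew & <-). exists (fiter f n w). split; auto. exists w. auto.
  - intros (v & (w & Ew & <-) & <-). exists w. auto.
Qed.

Lemma image_S' n E z : image (fiter f (S n)) E z <-> image (fiter f n) (image f E) z.
Proof.
  split.
  - intros (w & Ew & <-). exists (f w). split; [exists w; auto|symmetry; apply fiter_S].
  - intros (v & (w & Ew & <-) & <-). exists w. split; auto. apply fiter_S.
Qed.

(** Each application of [f] can add only the asymptotic value [a] to the closure; limit points added
    earlier are carried forward along the orbit of [a]. *)
Lemma Kn_closure n z : closure (Kn n) z -> Kn n z \/ orbit_before n z.
Proof.
  revert z. induction n as [|n IH]; intros z Hz.
  - left. exists z. split; auto. apply K_closed. eapply closure_mono; try exact Hz. intros w (v & Kv & <-). auto.
  - destruct (classic (z = a)) as [->|Hne]; [right; exists 0%nat; split; [lia|auto]|].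
    destruct (closure_image a (Kn n) z) as (v & Hv & <-); auto.
    + intro M. destruct (strip_vert_bounded (k n) M) as [W HW]. exists W. intros w Hw. apply HW, Kn_strip, Hw.
    + eapply closure_mono; try exact Hz. intros w. apply image_S.
    + destruct (IH v Hv) as [h|(i & Hi & <-)].
      * left. apply image_S. exists v. auto.
      * right. exists (S i). split; [lia|auto].
Qed.

(** An escaping limit point of the image belongs to the finite piece of the orbit of [a], which
    occurs here because [a] may escape. *)
Lemma Kn_escaping_closure n : exists R0, forall z, closure (Kn n) z -> escaping f z -> fst z <= R0.
Proof.
  destruct (finite_bound (fun i => fst (fiter f i a)) n) as (M & _ & HM). exists M. intros z Hz He.
  destruct (Kn_closure n z Hz) as [h|(i & Hi & <-)].
  - exfalso. apply (Kn_nonescaping n z); auto.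
  - specialize (HM i Hi). pose proof (Rle_abs (fst (fiter f i a))). lra.
Qed.

Lemma Kn_left_unbounded n :
  ~ bounded (Kn n) -> tower_bounded (fun m => k (n + m)%nat) -> exists j, left_unbounded (Kn (n + j)).
Proof.
  intros Hunb Htow. destruct (Kn_escaping_closure n) as [R0 HR0].
  destruct (nonescaping_left_unbounded (Kn n) (fun m => k (n + m)%nat) R0) as [j Hj]; auto.
  - apply image_connected; auto. apply fiter_cont.
  - intros m z (w & Kw & <-). rewrite <- fiter_add, Nat.add_comm. auto.
  - exists j. intro M. destruct (Hj M) as (z & (v & (w & Kw & <-) & <-) & Hz).
    exists (fiter f (n + j) w). split; [exists w; auto|]. rewrite <- fiter_add, Nat.add_comm in Hz. auto.
Qed.

Lemma Kn_itinerary n : left_unbounded (Kn n) -> forall i, k (S n + i)%nat = u i.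
Proof. intros H i. apply (left_unbounded_itinerary K k n); auto. Qed.

Lemma two_left_excursions n :
  left_unbounded (Kn n) -> ~ bounded (Kn (S n)) -> tower_bounded u -> periodic_seq u.
Proof.
  intros Hn Hunb Htow. pose proof (Kn_itinerary n Hn) as Hk.
  destruct (Kn_left_unbounded (S n) Hunb) as [j Hj].
  { destruct Htow as (x & Hx & H). exists x. split; auto. intro m. rewrite Hk. auto. }
  (* From time [S n] on, [k] runs through [u], and it starts [u] afresh [S j] steps later. *)
  exists (S j). split; [lia|]. intro i. rewrite <- (Kn_itinerary _ Hj i), <- Hk. f_equal. lia.
Qed.

(** Orbit points of [a] have to be allowed because [a], an asymptotic value of [f], may be a frontier point
    of the image of an open set. *)
Definition carried (n : nat) (G : Cplx -> Prop) : Prop :=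
  is_open G /\ forall z, frontier G z -> Kn n z \/ orbit_before n z.

Lemma carried_ext n G H : (forall z, G z <-> H z) -> carried n G -> carried n H.
Proof.
  intros E [Ho Hf]. split.
  - intros z Hz. apply E in Hz. destruct (Ho z Hz) as [r [Hr Hr']]. exists r. split; auto. intros w Hw. apply E; auto.
  - intros z [Hc Hn]. apply Hf. split; [|rewrite E; auto]. eapply closure_mono; try exact Hc. intro; apply E.
Qed.

Lemma carried_loc_const n G : carried n G -> loc_const (fun z => ~ Kn n z /\ ~ orbit_before n z) (indic G).
Proof.
  intros [Ho Hf]. apply (loc_const_sub (fun z => ~ frontier G z)); [|apply frontier_loc_const; auto].
  intros z [h1 h2] h. destruct (Hf z h); auto.
Qed.

Lemma carried_exterior n G : carried n G -> carried n (fun z => ~ closure G z).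
Proof.
  intros [Ho Hf]. split; [apply closed_compl, closure_closed|]. intros z [Hc Hn]. apply NNPP in Hn.
  apply Hf. split; auto. intro Gz. destruct (Ho z Gz) as [r [Hr Hr']]. destruct (Hc r Hr) as (w & Hw & Hd).
  apply Hw. apply closure_incl, Hr'. unfold ball. rewrite Cdist_sym. auto.
Qed.

Lemma orbit_uncut n z : orbit_before n z -> ~ cut z.
Proof. intros (i & _ & <-). apply (strip_uncut (u i)). auto. Qed.

Lemma cut_off_frontier n z : cut z -> ~ Kn n z /\ ~ orbit_before n z.
Proof.
  intro Hz. split; intro h.
  - apply (Kn_nonescaping n z h), cut_escaping, Hz.
  - apply (orbit_uncut n z); auto.
Qed.

(** The part of [G] in another strip would have its frontier among finitely many orbit points. A
    vertical segment avoiding them stays in that part, yet leads from the strip into its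
    translate. *)
Lemma carried_uncut_strip n G : carried n G -> (forall z, G z -> ~ cut z) -> forall z, G z -> T (k n) z.
Proof.
  intros [Ho Hf] Huncut z Gz. destruct (strip_cover z (Huncut z Gz)) as [l Tl].
  destruct (Z.eq_dec l (k n)) as [->|Hl]; auto. exfalso.
  set (O := fun v => G v /\ T l v).
  assert (HO : is_open O).
  { intros v [Gv Tv]. destruct (Ho v Gv) as [r1 [Hr1 H1]]. destruct (strip_open l v Tv) as [r2 [Hr2 H2]].
    exists (Rmin r1 r2). split; [apply Rmin_glb_lt; auto|]. unfold ball. intros w Hw.
    pose proof (Rmin_l r1 r2). pose proof (Rmin_r r1 r2). split; [apply H1|apply H2]; unfold ball; lra. }
  assert (HfO : forall v, frontier O v -> orbit_before n v).
  { intros v [Hc Hn].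
    assert (HcG : closure G v) by (eapply closure_mono; try exact Hc; intros w [h _]; exact h).
    assert (HcT : closure (T l) v) by (eapply closure_mono; try exact Hc; intros w [_ h]; exact h).
    destruct (classic (G v)) as [Gv|Gv].
    - exfalso. apply Hn. split; auto. apply strip_closure; auto.
    - destruct (Hf v) as [h|h]; [split; auto| |auto].
      exfalso. apply Hl. apply (strip_closure_disjoint l (k n) v); auto. apply Kn_strip, h. }
  destruct (HO z (conj Gz Tl)) as [r [Hr Hr']].
  (* A nearby abscissa different from those of the exceptional orbit points. *)
  destruct (finite_avoid (fun i => fst (fiter f i a)) n (fst z) r Hr) as (y & Hy & Havoid).
  set (v := (y, snd z)).
  assert (Ov : O v).
  { apply Hr'. unfold ball. eapply Rle_lt_trans; [apply Cdist_le_sum|]. unfold v. cbn [fst snd].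
    replace (snd z - snd z) with 0 by ring. rewrite Rabs_R0, Rabs_pos_eq by lra. lra. }
  assert (E : indic O v = indic O (shift 1 v)).
  { apply (seg_loc_const (fun z => ~ frontier O z)); [|apply frontier_loc_const; auto].
    intros t _ h. apply HfO in h. destruct h as (i & Hi & Ei). apply (Havoid i Hi). rewrite Ei.
    unfold seg, shift, v. cbn [fst snd]. ring. }
  destruct (indic_eq _ _ _ E Ov) as [_ Tv]. apply strip_of_shift in Tv. destruct Ov as [_ Tv'].
  pose proof (strip_disjoint _ _ _ Tv Tv'). lia.
Qed.

Lemma carried_image n G : carried n G -> (forall z, G z -> T (k n) z) -> carried (S n) (image f G).
Proof.
  intros [Ho Hf] HT. split.
  - intros y (z & Gz & <-). destruct (Ho z Gz) as [r [Hr Hr']].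
    destruct (expmap_open a z r Hr) as (d & Hd & H). exists d. split; auto. intros w Hw.
    destruct (H w Hw) as (x & Ex & Hx). exists x. split; auto.
  - intros y [Hc Hn]. destruct (classic (y = a)) as [->|Hne]; [right; exists 0%nat; split; [lia|auto]|].
    destruct (closure_image a G y) as (v & Hv & <-); auto.
    + intro M. destruct (strip_vert_bounded (k n) M) as [W HW]. exists W. intros w Hw. apply HW, HT, Hw.
    + destruct (Hf v) as [h|(i & Hi & <-)].
      * split; auto. intro Gv. apply Hn. exists v. auto.
      * left. apply image_S. exists v. auto.
      * right. exists (S i). split; [lia|auto].
Qed.

(** [m] is the first time at which the image of [G] meets the cut. The strips visited before are
    recorded because they later bound [k]. *)
Lemma carried_reaches_cut j : forall n G x,
  carried n G -> G x -> cut (fiter f j x) ->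
  exists m, (forall i z, (i < m)%nat -> G z -> T (k (n + i)%nat) (fiter f i z)) /\
    carried (n + m) (image (fiter f m) G) /\ exists y, image (fiter f m) G y /\ cut y.
Proof.
  induction j as [|j IH]; intros n G x HG Gx Hx.
  - exists 0%nat. split; [intros; lia|]. rewrite Nat.add_0_r. split.
    + apply (carried_ext n G); auto. intro z. split; [intro Gz; exists z; auto|intros (w & Gw & <-); auto].
    + exists x. split; auto. exists x. auto.
  - destruct (classic (exists y, G y /\ cut y)) as [(y & Gy & Hy)|Hno].
    + exists 0%nat. split; [intros; lia|]. rewrite Nat.add_0_r. split.
      * apply (carried_ext n G); auto. intro z. split; [intro Gz; exists z; auto|intros (w & Gw & <-); auto].
      * exists y. split; auto. exists y. auto.
    + assert (HT : forall z, G z -> T (k n) z).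
      { apply carried_uncut_strip; auto. intros z Gz Hz. apply Hno. eauto. }
      destruct (IH (S n) (image f G) (f x)) as (m & H1 & H2 & (y & Hy1 & Hy2)).
      * apply carried_image; auto.
      * exists x. auto.
      * rewrite <- fiter_S. auto.
      * exists (S m). split; [|split].
        -- intros i z Hi Gz. destruct i as [|i]; [rewrite Nat.add_0_r; apply HT; auto|].
           rewrite fiter_S. replace (n + S i)%nat with (S n + i)%nat by lia. apply H1; [lia|]. exists z. auto.
        -- replace (n + S m)%nat with (S n + m)%nat by lia. apply (carried_ext _ (image (fiter f m) (image f G))); auto.
           intro z. symmetry. apply image_S'.
        -- exists y. split; auto. apply image_S'. auto.
Qed.

(** * Frontiers that separate neighbouring curves *)

Definition contains_curve (G : Cplx -> Prop) (l : Z) : Prop := G (shift l (L 0)).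

Lemma shifted_curve_cont l x : contRC (fun x => shift l (L x)) x.
Proof. apply (cont_comp _ Cdist _ (shift l) L); [apply L_cont|apply shift_cont]. Qed.

(** A curve consists of escaping cut points, so it misses the frontier of a carried set and one
    point decides for all. *)
Lemma contains_curve_iff n G l x : carried n G -> (contains_curve G l <-> G (shift l (L x))).
Proof.
  intro HG.
  assert (E : indic G (shift l (L 0)) = indic G (shift l (L x))).
  { apply (curve_loc_const' _ (indic G) (fun x => shift l (L x)) (fun _ => True)) with (2 := fun t _ => shifted_curve_cont l t) (4 := carried_loc_const n G HG); auto.
    intros t _. apply cut_off_frontier, cut_curve. }
  split; apply indic_eq; auto.
Qed.

Definition splits (n : nat) : Prop :=
  exists G l, carried n G /\ ~ (contains_curve G l <-> contains_curve G (l + 1)).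

(** On every abscissa attained by the curve, the vertical segment from one of the two curves to the
    other has to cross the frontier. *)
Lemma splits_vertical n : splits n -> forall x, exists z, (Kn n z \/ orbit_before n z) /\ fst z = fst (L x).
Proof.
  intros (G & l & HG & Hl) x. apply NNPP. intro Hn. apply Hl.
  rewrite (contains_curve_iff n G l x HG), (contains_curve_iff n G (l + 1) x HG).
  assert (E : indic G (shift l (L x)) = indic G (shift (l + 1) (L x))).
  { apply (seg_loc_const (fun z => ~ Kn n z /\ ~ orbit_before n z)); [|apply carried_loc_const; auto].
    intros t _.
    assert (Hf : fst (seg (shift l (L x)) (shift (l + 1) (L x)) t) = fst (L x)) by (unfold seg, shift; cbn [fst snd]; ring).
    split; intro h; apply Hn; eauto. }
  split; apply indic_eq; auto.
Qed.

Lemma splits_left n : splits n -> left_unbounded (Kn n).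
Proof.
  intros Hs M. destruct (finite_bound (fun i => fst (fiter f i a)) n) as (B & HB & Hfin).
  destruct (L_left (- (Rabs M + B))) as [X HX]. specialize (HX X (Rle_refl _)).
  pose proof (Rle_abs M). pose proof (Rabs_pos M).
  destruct (splits_vertical n Hs X) as (z & [h|(i & Hi & <-)] & Ez).
  - exists z. split; auto. lra.
  - exfalso. specialize (Hfin i Hi). apply Rabs_le_bounds in Hfin. lra.
Qed.

Lemma splits_unbounded n : splits n -> ~ bounded (Kn (S n)).
Proof.
  intros Hs [M HM]. destruct (finite_bound (fun i => fst (fiter f i a)) n) as (B & HB & Hfin).
  destruct (L_right (Rabs M + B + Cnorm a)) as [X HX]. specialize (HX X (Rle_refl _)).
  pose proof (Rle_abs M). pose proof (Rabs_pos M). pose proof (Cnorm_nonneg a).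
  destruct (splits_vertical n Hs X) as (z & [h|(i & Hi & <-)] & Ez).
  - specialize (HM (f z)). pose proof (expmap_norm_ge a z). pose proof (exp_ineq1_le (fst z)).
    assert (Cnorm (f z) <= M) by (apply HM, image_S; exists z; auto). lra.
  - specialize (Hfin i Hi). apply Rabs_le_bounds in Hfin. lra.
Qed.

(** Two different curves met by an image of the ray would be joined inside the escaping set, and by
    translation so would any two neighbouring curves. *)
Lemma splits_one_curve N n t t' l l' :
  splits N -> ~ escaping f a -> 0 < t -> 0 < t' ->
  on_curveL l (fiter f n (g t)) -> on_curveL l' (fiter f n (g t')) -> l = l'.
Proof.
  intros (G & l0 & HG & Hl0) Ha.
  assert (Hc : forall s, contRC (fun s => fiter f n (g s)) s).
  { intro s. apply (cont_comp _ Cdist _ (fiter f n) g); [apply g_cont|apply fiter_cont]. }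
  assert (Hmain : forall t t' l l', 0 < t -> 0 < t' ->
     on_curveL l (fiter f n (g t)) -> on_curveL l' (fiter f n (g t')) -> (l < l')%Z -> False).
  { clear t t' l l'. intros t t' l l' Ht Ht' Hl Hl' Hll.
    (* On the way from [C_l] to [C_l'] the side relative to [C_(l+1)] changes, so that curve is met
       too. *)
    assert (Hnext : exists t3, 0 < t3 /\ on_curveL (l + 1) (fiter f n (g t3))).
    { destruct (Z.eq_dec l' (l + 1)) as [->|hne]; [eauto|]. apply NNPP. intro Hno.
      assert (E : indic (aboveL (l + 1)) (fiter f n (g t)) = indic (aboveL (l + 1)) (fiter f n (g t'))).
      { apply (curve_loc_const' _ (indic (aboveL (l + 1))) (fun s => fiter f n (g s)) (fun s => 0 < s)) with (2 := fun s _ => Hc s) (4 := aboveL_loc_const (l + 1)); auto.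
        - intros s1 s2 s h1 h2 h3. lra.
        - intros s Hs h. apply Hno. eauto. }
      apply on_curveL_iff in Hl, Hl'. destruct Hl as [x Ex], Hl' as [x' Ex']. rewrite Ex, Ex' in E.
      assert (h : aboveL (l + 1) (shift l' (L x'))) by (apply aboveL_curve; lia).
      symmetry in E. apply (indic_eq _ _ _ E) in h. apply aboveL_curve in h; lia. }
    destruct Hnext as (t3 & Ht3 & Hl3). apply Hl0.
    (* The translated path consists of escaping points, hence misses the image of [K], and also the
       orbit of [a], which does not escape. *)
    assert (E : indic G (shift (l0 - l) (fiter f n (g t))) = indic G (shift (l0 - l) (fiter f n (g t3)))).
    { apply (curve_loc_const' (fun z => ~ Kn N z /\ ~ orbit_before N z) (indic G) (fun s => shift (l0 - l) (fiter f n (g s))) (fun s => 0 < s)); auto.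
      - intros s1 s2 s h1 h2 h3. lra.
      - intros s _. apply (cont_comp _ Cdist _ (shift (l0 - l)) (fun s => fiter f n (g s))); [apply Hc|apply shift_cont].
      - intros s Hs. assert (He : escaping f (shift (l0 - l) (fiter f n (g s)))).
        { apply escaping_shift. apply -> (escaping_fiter a n). auto. }
        split; intro h; [apply (Kn_nonescaping N _ h He)|].
        destruct h as (i & _ & E). apply Ha. apply (escaping_fiter a i). rewrite E. auto.
      - apply carried_loc_const; auto. }
    apply on_curveL_iff in Hl, Hl3. destruct Hl as [x Ex], Hl3 as [x3 Ex3]. rewrite Ex, Ex3, !shift_shift in E.
    replace (l0 - l + l)%Z with l0 in E by lia. replace (l0 - l + (l + 1))%Z with (l0 + 1)%Z in E by lia.
    rewrite (contains_curve_iff N G l0 x HG), (contains_curve_iff N G (l0 + 1) x3 HG).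
    split; apply indic_eq; auto. }
  intros Ht Ht' Hl Hl'. destruct (Z.lt_trichotomy l l') as [h|[h|h]]; auto; exfalso; eauto.
Qed.

(** If [a] escapes, its own orbit bounds [u]. Otherwise the image under f^n of the piece of [g] from
    [a] to [g 1] meets at most one curve, so f^n(a) and f^n([g 1]) are on the same side of all
    others, and their heights in terms of curves are comparable. *)
Lemma splits_tower N : splits N -> tower_bounded u.
Proof.
  intro Hs. destruct (classic (escaping f a)) as [Ha|Ha].
  - destruct (strip_index_bound a Ha) as [c Hc]. apply (tower_bounded_intro u a c 0). intros t _. exists t.
    split; auto.
  - destruct (escaping_fst a (g 1) 0 (g_esc 1 ltac:(lra))) as [N0 HN0].
    destruct (aboveL_window 0) as [Y HY]. destruct strip_heights as (m & Hm & Hh).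
    pose proof PI_RGT_0. pose proof (Rle_abs Y). pose proof (Rabs_pos Y).
    (* [m] is the uncertainty in [strip_heights], and [Y] that in [aboveL_window]. The summand 3
       leaves room for choosing an unmet curve among two consecutive ones. *)
    apply (tower_bounded_intro u (g 1) (2 * PI * (IZR m + 3) + Rabs Y) N0). intros n Hn. exists n. split; auto.
    set (w := fiter f n (g 1)). specialize (HN0 n Hn). fold w in HN0.
    set (met := fun l => exists t, 0 < t <= 1 /\ on_curveL l (fiter f n (g t))).
    assert (Hone : forall l l', met l -> met l' -> l = l').
    { intros l l' (t & Ht & h) (t' & Ht' & h'). apply (splits_one_curve N n t t'); auto; lra. }
    assert (Hsame : forall l, ~ met l -> (aboveL l (fiter f n a) <-> aboveL l w)).
    { intros l Hl.
      assert (E : indic (aboveL l) (fiter f n (g 0)) = indic (aboveL l) (fiter f n (g 1))).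
      { apply (curve_loc_const (fun z => ~ on_curveL l z) (indic (aboveL l)) (fun s => fiter f n (g s))); [lra| | |apply aboveL_loc_const].
        - intros s _. apply (cont_comp _ Cdist _ (fiter f n) g); [apply g_cont|apply fiter_cont].
        - intros s Hs2 h. destruct (Req_dec s 0) as [->|h0].
          + rewrite g_0 in h. apply (strip_uncut (u n) (fiter f n a)); auto. apply cut_on_curveL. eauto.
          + apply Hl. exists s. split; auto; lra. }
      rewrite g_0 in E. fold w in E. split; apply indic_eq; auto. }
    pose proof (Cnorm_snd w) as Hw. apply Rabs_le_bounds in Hw.
    assert (Hpick : forall l, exists j, (j = l \/ j = (l + 1)%Z) /\ ~ met j).
    { intro l. destruct (classic (met l)) as [h|h]; [|eauto]. exists (l + 1)%Z. split; auto.
      intro h'. pose proof (Hone _ _ h h'). lia. }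
    apply Rnot_lt_le. intro Hlt.
    destruct (Z.le_gt_cases 0 (u n)) as [hu|hu].
    + rewrite (Rabs_pos_eq (IZR (u n))) in Hlt by (apply (IZR_le 0); auto).
      destruct (Hpick (u n - m - 2)%Z) as (j & Hj & Hnm). apply Hsame in Hnm.
      assert (h1 : aboveL j (fiter f n a)) by (apply (Hh (u n) (fiter f n a) j); auto; lia).
      apply Hnm in h1. revert h1. apply (HY j w); [lra|].
      assert (h2 : IZR (u n) - IZR m - 2 <= IZR j).
      { rewrite <- !minus_IZR. apply IZR_le. lia. }
      assert (2 * PI * (IZR (u n) - IZR m - 2) <= 2 * PI * IZR j) by (apply Rmult_le_compat_l; lra). lra.
    + rewrite (Rabs_left (IZR (u n))) in Hlt by (apply (IZR_lt _ 0); auto).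
      destruct (Hpick (u n + m + 1)%Z) as (j & Hj & Hnm). apply Hsame in Hnm.
      assert (h1 : ~ aboveL j (fiter f n a)) by (apply (Hh (u n) (fiter f n a) j); auto; lia).
      apply h1, Hnm. apply (HY j w); [lra|].
      assert (h2 : IZR j <= IZR (u n) + IZR m + 2).
      { rewrite <- !plus_IZR. apply IZR_le. lia. }
      assert (2 * PI * IZR j <= 2 * PI * (IZR (u n) + IZR m + 2)) by (apply Rmult_le_compat_l; lra). lra.
Qed.

Lemma splits_periodic N : splits N -> periodic_seq u.
Proof.
  intro Hs. apply (two_left_excursions N); [apply splits_left|apply splits_unbounded|apply (splits_tower N)]; auto.
Qed.

Lemma contains_curve_all n G l : carried n G -> ~ splits n -> contains_curve G l -> forall j, contains_curve G j.
Proof.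
  intros HG Hns Hl.
  assert (Hstep : forall j, contains_curve G j <-> contains_curve G (j + 1)).
  { intro j. apply NNPP. intro h. apply Hns. exists G, j. auto. }
  assert (Hup : forall i : nat, contains_curve G (l + Z.of_nat i) /\ contains_curve G (l - Z.of_nat i)).
  { induction i as [|i [IH1 IH2]]; [simpl; rewrite Z.add_0_r, Z.sub_0_r; auto|]. split.
    - apply Hstep in IH1. replace (l + Z.of_nat (S i))%Z with (l + Z.of_nat i + 1)%Z by lia. auto.
    - apply Hstep. replace (l - Z.of_nat (S i) + 1)%Z with (l - Z.of_nat i)%Z by lia. auto. }
  intro j. destruct (Z.le_gt_cases l j) as [h|h].
  - replace j with (l + Z.of_nat (Z.to_nat (j - l)))%Z by lia. apply Hup.
  - replace j with (l - Z.of_nat (Z.to_nat (l - j)))%Z by lia. apply Hup.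
Qed.

(** * Open sets that contain the ray and miss the cut *)

Definition surrounds (n : nat) : Prop :=
  exists G, carried n G /\ (forall z, G z -> ~ cut z) /\ forall t, 0 < t -> G (g t).

(** By [cut_dense] some image of [G] meets the cut; the first such image [H] contains all curves, so
    its exterior misses the cut. A point [g t] is not in [H], as the preceding image would have met
    the cut, and not on its frontier: it escapes, and if it were on the orbit of [a], it would be
    [a] itself or have a predecessor on the cut. *)
Lemma carried_step n G :
  (forall N, ~ splits N) -> carried n G -> (forall z, G z -> ~ cut z) -> (exists x, G x /\ escaping f x) ->
  exists m, (1 <= m)%nat /\ (forall i z, (i < m)%nat -> G z -> T (k (n + i)%nat) (fiter f i z)) /\ surrounds (n + m).
Proof.
  intros Hns HG Huncut (x & Gx & Hx).
  destruct (proj1 HG x Gx) as [r [Hr Hr']]. destruct (cut_dense x r Hx Hr) as (y & j & Hy & Hcy).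
  destruct (carried_reaches_cut j n G y HG (Hr' y Hy) Hcy) as (m & Hstr & HH & (c & Hc1 & Hc2)).
  assert (Hm : (1 <= m)%nat).
  { destruct m as [|m]; [|lia]. exfalso. destruct Hc1 as (w & Gw & Ew). simpl in Ew. subst w. apply (Huncut c); auto. }
  exists m. split; [auto|]. split; [auto|].
  set (H := image (fiter f m) G) in *.
  assert (Hall : forall l x, H (shift l (L x))).
  { intros l x0. apply cut_iff in Hc2. destruct Hc2 as (x1 & l1 & ->).
    apply (contains_curve_iff (n + m) H l x0 HH). apply (contains_curve_all (n + m) H l1 HH); [apply Hns|].
    apply (contains_curve_iff (n + m) H l1 x1 HH). auto. }
  exists (fun z => ~ closure H z). split; [apply carried_exterior; auto|]. split.
  - intros z Hz Hc. apply cut_iff in Hc. destruct Hc as (x0 & l & ->). apply Hz, closure_incl, Hall.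
  - intros t Ht Hcl.
    assert (Hcut : forall v, f v = g t -> cut v) by (intros v E; exists t; split; auto; lra).
    destruct (classic (H (g t))) as [(z & Gz & Ez)|Hn].
    + destruct m as [|m]; [lia|]. simpl in Ez. apply Hcut in Ez.
      apply (strip_uncut (k (n + m)%nat) (fiter f m z)); auto.
    + destruct (proj2 HH (g t) (conj Hcl Hn)) as [h|(i & Hi & Ei)].
      * apply (Kn_nonescaping _ _ h). auto.
      * destruct i as [|i].
        -- simpl in Ei. rewrite <- g_0 in Ei. apply g_inj in Ei; lra.
        -- simpl in Ei. apply Hcut in Ei. apply (strip_uncut (u i) (fiter f i a)); auto.
Qed.

Lemma surrounds_step n :
  (forall N, ~ splits N) -> surrounds n ->
  exists m, (1 <= m)%nat /\ (forall i, (i < m)%nat -> T (k (n + i)%nat) (fiter f i (g 1))) /\ surrounds (n + m).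
Proof.
  intros Hns (G & HG & Hun & Hg). destruct (carried_step n G) as (m & Hm & Hstr & Hsur); auto.
  - exists (g 1). split; [apply Hg; lra|apply g_esc; lra].
  - exists m. split; auto. split; auto. intros i Hi. apply Hstr; auto. apply Hg. lra.
Qed.

(** [p] is the time elapsed since the last restart of the orbit of [g 1]. *)
Lemma surrounds_strips n d :
  (forall N, ~ splits N) -> surrounds n -> exists p, (p <= d)%nat /\ T (k (n + d)%nat) (fiter f p (g 1)).
Proof.
  intro Hns. revert n. induction d as [d IH] using lt_wf_ind. intros n Hn.
  destruct (surrounds_step n Hns Hn) as (m & Hm & Hstr & Hsur).
  destruct (Nat.lt_ge_cases d m) as [h|h]; [exists d; auto|].
  destruct (IH (d - m)%nat ltac:(lia) (n + m)%nat Hsur) as (p & Hp & HT).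
  exists p. split; [lia|]. replace (n + d)%nat with (n + m + (d - m))%nat by lia. auto.
Qed.

Lemma surrounds_later n d : (forall N, ~ splits N) -> surrounds n -> exists n', (d <= n')%nat /\ surrounds n'.
Proof.
  intros Hns Hn. induction d as [|d (n' & Hd & Hn')]; [exists n; split; [lia|auto]|].
  destruct (surrounds_step n' Hns Hn') as (m & Hm & _ & Hsur). exists (n' + m)%nat. split; [lia|auto].
Qed.

(** Otherwise the frontier would miss a right half-plane, where a segment joins the ray, inside [G],
    to the curve [L], outside [G]. *)
Lemma surrounds_unbounded n : surrounds n -> ~ bounded (Kn n).
Proof.
  intros (G & HG & Hun & Hg) [M HM].
  destruct (finite_bound (fun i => fst (fiter f i a)) n) as (B & HB & Hfin).
  destruct (L_right (Rabs M + B)) as [X HX]. specialize (HX X (Rle_refl _)).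
  destruct (g_right (Rabs M + B)) as [X1 HX1]. set (t := Rmax X1 1).
  assert (Ht : fst (g t) > Rabs M + B) by (apply HX1, Rle_ge, Rmax_l).
  assert (Ht0 : 0 < t) by (pose proof (Rmax_r X1 1); unfold t; lra).
  pose proof (Rle_abs M). pose proof (Rabs_pos M).
  assert (E : indic G (g t) = indic G (L X)).
  { apply (seg_loc_const (fun z => ~ Kn n z /\ ~ orbit_before n z)); [|apply carried_loc_const; auto].
    intros s Hs.
    assert (Hf : Rabs M + B < fst (seg (g t) (L X) s)).
    { unfold seg. cbn [fst snd]. destruct (Rle_dec s (1/2)); nra. }
    split.
    - intro h. specialize (HM _ h). pose proof (Cnorm_fst (seg (g t) (L X) s)) as h1.
      apply Rabs_le_bounds in h1. lra.
    - intros (i & Hi & Ei). specialize (Hfin i Hi). rewrite Ei in Hfin. apply Rabs_le_bounds in Hfin. lra. }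
  apply (Hun (L X)).
  - apply (indic_eq _ _ _ E). auto.
  - rewrite <- (shift_0 (L X)). apply cut_curve.
Qed.

Lemma Kn_bounded_mono n m : (n <= m)%nat -> bounded (Kn n) -> bounded (Kn m).
Proof.
  intros Hnm Hb. induction Hnm as [|m Hnm [M HM]]; auto.
  exists (exp M + Cnorm a). intros z Hz. apply image_S in Hz. destruct Hz as (w & Hw & <-).
  specialize (HM w Hw). pose proof (expmap_norm_le a w). pose proof (Cnorm_fst w) as h. apply Rabs_le_bounds in h.
  assert (exp (fst w) <= exp M).
  { destruct (Req_dec (fst w) M) as [->|]; [lra|left; apply exp_increasing; lra]. }
  lra.
Qed.

Lemma surrounds_periodic n : (forall N, ~ splits N) -> surrounds n -> periodic_seq u.
Proof.
  intros Hns Hn.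
  (* Surrounding recurs at arbitrarily late times, and a bounded image would remain bounded from
     then on. *)
  assert (Hunb : forall m, ~ bounded (Kn m)).
  { intros m Hb. destruct (surrounds_later n m Hns Hn) as (n' & Hm & Hn').
    apply (surrounds_unbounded n' Hn'). apply (Kn_bounded_mono m); auto. }
  assert (Htow : tower_bounded k).
  { destruct (strip_index_bound (g 1)) as [c Hc]; [apply g_esc; lra|].
    apply (tower_bounded_intro k (g 1) c n). intros t Ht.
    destruct (surrounds_strips n (t - n) Hns Hn) as (p & Hp & HT). exists p. split; [lia|].
    replace (n + (t - n))%nat with t in HT by lia. auto. }
  destruct (Kn_left_unbounded 0) as [j Hj]; auto.
  apply (two_left_excursions (0 + j)); auto.
  (* A tail of [k] is [u], so the bound on [k] passes to [u]. *)
  destruct (tower_bounded_shift k (S (0 + j)) Htow) as (x & Hx & H). exists x. split; auto.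
  intro m. specialize (H m). cbv beta in H. rewrite (Kn_itinerary _ Hj) in H. auto.
Qed.

(** When no image splits neighbouring curves, [D] contains all curves or none. The recursion then
    starts from the exterior of [D], which contains [p], or from [D], which contains [q]. *)
Lemma frontier_periodic D p q :
  is_open D -> (forall z, frontier D z -> K z) -> escaping f p -> ~ closure D p -> escaping f q -> D q ->
  periodic_seq u.
Proof.
  intros HD Hfr Hp HpD Hq HqD.
  destruct (classic (exists N, splits N)) as [[N HN]|Hns]; [apply (splits_periodic N); auto|].
  assert (Hns' : forall N, ~ splits N) by (intros N h; apply Hns; eauto).
  assert (HcD : carried 0 D).
  { split; auto. intros z Hz. left. exists z. auto. }
  assert (Hdone : forall G x, carried 0 G -> (forall z, G z -> ~ cut z) -> G x -> escaping f x -> periodic_seq u).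
  { intros G x HG Hun Gx Hx. destruct (carried_step 0 G) as (m & _ & _ & Hsur); eauto.
    apply (surrounds_periodic (0 + m)); auto. }
  destruct (classic (contains_curve D 0)) as [h|h].
  - apply (Hdone (fun z => ~ closure D z) p); auto.
    + apply carried_exterior; auto.
    + intros z Hz Hc. apply cut_iff in Hc. destruct Hc as (x & l & ->). apply Hz, closure_incl.
      apply (contains_curve_iff 0 D l x HcD). apply (contains_curve_all 0 D 0); auto.
  - apply (Hdone D q); auto. intros z Hz Hc. apply h. apply cut_iff in Hc. destruct Hc as (x & l & ->).
    apply (contains_curve_all 0 D l); auto. apply (contains_curve_iff 0 D l x HcD). auto.
Qed.

End Strips.

Lemma is_component_ext (A B S : Cplx -> Prop) :
  (forall z, A z <-> B z) -> is_component A S -> is_component B S.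
Proof.
  intros E (z & Az & H). exists z. split; [apply E, Az|]. intro w. rewrite H.
  split; intros (C & HC & Hsub & h); exists C; (split; [auto|split; [|auto]]); intros v Cv; apply E, Hsub, Cv.
Qed.

Theorem theorem4p3 (a : Cplx) (gamma : R -> Cplx) (S0 : Cplx -> Prop) (u : nat -> Z) :
  accessible_curve (expmap a) a gamma ->
  is_component (fun z => ~ preimage_curve (expmap a) gamma z) S0 ->
  is_itinerary (expmap a) S0 a u ->
  (forall v : nat -> Z, is_itinerary (expmap a) S0 a v -> forall j, v j = u j) ->
  ~ periodic_seq u ->
  connected (escaping (expmap a)).
Proof.
  intros (_ & Hcont & Hinj & H0 & _ & Hesc & Hright) Hcomp Hu Huniq Hper.
  (* Extended constantly to negative parameters, the curve is continuous on the whole line. *)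
  set (g := fun t => gamma (Rmax 0 t)).
  assert (Eg : forall t, 0 <= t -> g t = gamma t) by (intros t Ht; unfold g; rewrite Rmax_right; auto).
  assert (g_cont : forall t, contRC g t).
  { intros t e He. destruct (Hcont (Rmax 0 t) (Rmax_l 0 t) e He) as (d & Hd & H). exists d. split; auto.
    intros s Hs. apply H; [apply Rmax_l|]. unfold Rdist in Hs. revert Hs. unfold Rmax.
    repeat destruct Rle_dec; unfold Rabs; repeat destruct Rcase_abs; lra. }
  assert (g_inj : forall s t, 0 <= s -> 0 <= t -> g s = g t -> s = t).
  { intros s t Hs Ht. rewrite !Eg by auto. auto. }
  assert (g_0 : g 0 = a) by (rewrite Eg by lra; auto).
  assert (g_right : forall M, exists T, forall t, t >= T -> fst (g t) > M).
  { intro M. destruct (Hright M) as [T HT]. exists (Rmax T 0). intros t Ht.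
    pose proof (Rmax_l T 0). pose proof (Rmax_r T 0). rewrite Eg by lra. apply HT. lra. }
  assert (g_esc : forall t, 0 < t -> escaping (expmap a) (g t)) by (intros t Ht; rewrite Eg by lra; auto).
  assert (Hcomp' : is_component (fun z => ~ preimage_curve (expmap a) g z) S0).
  { apply (is_component_ext (fun z => ~ preimage_curve (expmap a) gamma z)); auto.
    intro z. split; intros h (t & Ht & E); apply h; exists t; (split; [auto|]); rewrite E, Eg; auto. }
  destruct (curve_log a g g_cont g_inj g_0) as (L & L_cont & L_f).
  assert (u_orbit : forall n, strip S0 (u n) (fiter (expmap a) n a)) .
  { apply (unique_itinerary a g) with (L := L); auto. }
  apply NNPP. intro Hdis. apply Hper.
  destruct (disconnected_frontier _ Hdis) as (D & p & q & HD & Hconn & Hne & Hp & HpD & Hq & HqD).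
  assert (Hk : exists k, forall n z, frontier D z -> strip S0 (k n) (fiter (expmap a) n z)).
  { apply (connected_strips a g) with (L := L); auto. }
  destruct Hk as [k Hk].
  eapply (frontier_periodic a g) with (K := frontier D) (L := L) (p := p) (q := q); eauto.
  apply frontier_closed, HD.
Qed.
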